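(* Let $F$ be a natural exponential family on $\mathbb{R}$ with domain of the means $M_F$ and variance function $V_F$, and let $TF$ be its T-exponential family. (A) In each of the following cases the dual $TF^*$ of $TF$ exists, and there are measures $\mu,\nu\in\mathcal{M}(\mathbb{R})$ with $F(\mu)=F$, $TF(\mu)=TF$ and $TF(\nu)=TF^*$ for which the listed data hold. Each case is presented as a quadruple $$\big(V_{F(\mu)}(m),\ B_\mu(s);\ V_{F(\nu)}(m),\ B_\nu(s)\big),$$ where a question mark means that no explicit expression is given for that entry. 1. (Poisson) $M_F=(0,\infty)$: $\big(m,\ \exp(e^{-s});\ e^m,\ e^{-s}s^s\big)$. 2. (Bernoulli) $M_F=(0,1)$: $\big(m-m^2,\ 1+e^{-s};\ 4\cosh^2\frac m2,\ s^s(1-s)^{1-s}\big)$. More generally (binomial, $N$ a positive integer), $M_F=(0,N)$: $\big(m-\frac{m^2}{N},\ (1+e^{-s})^N;\ \frac4N\cosh^2\frac m2,\ s^s(N-s)^{N-s}\big)$. 3. (Negative binomial) $M_F=(0,\infty)$: $\big(m+m^2,\ (1-e^{-s})^{-1};\ 4\sinh^2\frac m2,\ s^s(1+s)^{-1-s}\big)$. 4. (Gamma, $\lambda>0$; self dual) $M_F=(0,\infty)$: $\big(\frac{m^2}{\lambda},\ s^{-\lambda};\ \frac{m^2}{\lambda},\ s^{-\lambda}\big)$. 5. (Gaussian, $\sigma>0$) $M_F=\mathbb{R}$: $\big(\sigma^2,\ \exp(\frac12\sigma^2s^2);\ \sigma^{-2},\ \exp(\frac12\sigma^{-2}s^2)\big)$.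 6. (Abel) $M_F=(0,\infty)$: $\big(m(1+m)^2,\ ?;\ ?,\ \frac{s^s}{(s+1)^s}\big)$. 7. (Takács, $R>1$) $M_F=(0,\infty)$: $\Big(m(1+m)(1+Rm),\ ?;\ ?,\ \dfrac{s^s(s+1)^{\frac{s+1}{R-1}}}{(Rs+1)^{\frac{Rs+1}{R-1}}}\Big)$. 8. (Kendall–Ressel) $M_F=(0,\infty)$: $\big(m^2(1+m),\ ?;\ ?,\ (\frac{s+1}{s})^{s+1}\big)$. 9. (Inverse Gaussian, $\lambda>0$) $M_F=(0,\infty)$: $\big(\frac{m^3}{\lambda},\ e^{-\lambda\sqrt{2s}};\ 2^{3/2}\lambda m^{3/2},\ \exp(\lambda^2/4s)\big)$, where $\lambda^2/4s$ means $\frac{\lambda^2}{4s}$. 10. (Strict arcsine) $M_F=(0,\infty)$: $\Big(m(1+m^2),\ ?;\ ?,\ \big(\frac{s}{\sqrt{1+s^2}}\big)^s e^{\arctan s}\Big)$. 11. (Large arcsine, $0<a<\pi/2$) $M_F=(0,\infty)$: $\big(m(1+2m\cos a+m^2),\ ?;\ ?,\ B_{\nu}(s)\big)$, where $\nu=\mu^*$ is a dual measure of $\mu$ and $\ell_{\mu^*}=\log B_{\mu^*}$ is given by $$\begin{aligned}\ell_{\mu^*}(s)={}&s\log s-\tfrac12(s+\cos a)\log(s+\cos a)+\Big(-\tfrac12+\big(\tfrac{\pi}{2}-a\big)\cos a\Big)s-\tfrac12(\cot a)\log(1+2s\cos a+s^2)\\&+(\cot a)\Big(\frac{s+\cos a}{\sin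 a}\Big)\arctan\Big(\frac{s+\cos a}{\sin a}\Big)+\tfrac12\cos a\,\log\cos a+(\cot a)^2\big(\tfrac{\pi}{2}-a\big).\end{aligned}$$ The functions $B_\nu(s)$ are taken on $(0,1)$ for Bernoulli, on $(0,N)$ for the binomial, on $\mathbb{R}$ for the Gaussian case, and on $(0,\infty)$ in all other cases. (B) (Hyperbolic) If $V_F(m)=m^2+1$ on $M_F=\mathbb{R}$, then $TF$ has no dual.
   Context: For a positive measure $\mu$ on $\mathbb{R}$ let $B_\mu(s)=\int_{\mathbb{R}}e^{-sx}\mu(dx)$ (its Laplace transform), let $S(\mu)$ be the interior of $\{s: B_\mu(s)<\infty\}$, and $\ell_\mu=\log B_\mu$. $\mathcal{M}(\mathbb{R})$ is the set of positive (possibly unbounded) measures on $\mathbb{R}$ not concentrated on one point and with $S(\mu)\neq\emptyset$. The natural exponential family generated by $\mu\in\mathcal{M}(\mathbb{R})$ is $F(\mu)=\{P(-s,\mu): s\in S(\mu)\}$, $P(-s,\mu)(dx)=e^{-sx-\ell_\mu(s)}\mu(dx)$; its domain of the means is $M_{F(\mu)}=-\ell'_\mu(S(\mu))$; with $\varphi_\mu$ the inverse of $s\mapsto-\ell'_\mu(s)$, its variance function is $V_{F(\mu)}(m)=\ell''_\mu(\varphi_\mu(m))$, $m\in M_{F(\mu)}$. The T-exponential family of $F=F(\mu)$ is the set of all translates $TF=TF(\mu)=\{P(-s,\mu)*\delta_{b}: s\in S(\mu),\ b\in\mathbb{R}\}$. A measure $\mu^*\in\mathcal{M}(\mathbb{R})$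 is a dual measure of $\mu$ if $-\ell'_{\mu^*}(-\ell'_\mu(s))=s$ for all $s\in S(\mu)$ (so $\ell_{\mu^*}$ is considered on $M_{F(\mu)}$). If a generating measure $\mu$ of $TF$ has a dual measure $\mu^*$, then all generating measures of $TF$ do, and one says that the dual of $TF$ exists and sets $TF^*=TF(\mu^* )$, which does not depend on the choice of $\mu$; otherwise $TF$ has no dual. $B_\mu$ and $B_\nu$ are determined by their T-exponential families only up to translation, exponential tilting and a multiplicative constant. In exponents, $s^s=e^{s\log s}$, etc.; $\cot a=\cos a/\sin a$.
   Formalization: Misprints corrected: case 9 is (m³/λ, e^{-√λ√(2s)}; 2^{3/2}m^{3/2}/√λ, e^{λ/(2s)}); case 10 has e^{-arctan s}; case 11 has s log s − (s/2)log(1+2s cos a+s²) − ((1+s cos a)/sin a)arctan((s+cos a)/sin a) plus the printed affine terms. *)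

(* Defs.v *)
(* MathComp-Analysis *)
From HB Require Import structures.
From mathcomp Require Import all_boot all_order all_algebra.
From mathcomp Require Import all_classical all_reals all_analysis.

Set Implicit Arguments.
Unset Strict Implicit.
Unset Printing Implicit Defensive.

Import Order.TTheory GRing.Theory Num.Theory.
Import numFieldNormedType.Exports.

Local Open Scope classical_set_scope.
Local Open Scope ring_scope.

Section laplace.
Context {R : realType}.
Implicit Types mu nu : {measure set (measurableTypeR R) -> \bar R}.

Definition laplace mu (s : R) : \bar R :=
  (\int[mu]_x (expR (- (s * x)))%:E)%E.

Definition lapdom mu : set R := interior [set s | (laplace mu s < +oo)%E].

(* Only meaningful where [laplace mu s] is finite and positive. *)
Definition ell mu (s : R) : R := ln (fine (laplace mu s)).

(* The class M(R). The first condition also excludes the zero measure. *)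
Definition calM mu : Prop :=
  (forall a : R, mu (~` [set a]) != 0%E) /\ lapdom mu !=set0.

(* P(-s, mu), as a set function. *)
Definition tilt mu (s : R) (A : set R) : \bar R :=
  (\int[mu]_(x in A) (expR (- (s * x) - ell mu s))%:E)%E.

(* Library measures carry irrelevant values on non-measurable sets, so a law
   belongs to a family as soon as it agrees with a member on measurable sets;
   [=] between families is then equality as sets of Borel probabilities. *)
Definition NEF mu : set (probability (measurableTypeR R) R) :=
  [set P | exists2 s, lapdom mu s &
     forall A : set (measurableTypeR R), measurable A -> P A = tilt mu s A].

(* Translates of the members of [F]: P convolved with the Dirac mass at b is
   the image of P under x |-> x + b. *)
Definition TEF (F : set (probability (measurableTypeR R) R)) :
    set (probability (measurableTypeR R) R) :=
  [set Q | exists2 P, F P & exists b : R,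
     forall A : set (measurableTypeR R), measurable A ->
       Q A = P [set x | A (x + b)]].

Definition mean mu (s : R) : R := - (ell mu)^`()%classic s.

Definition meandom mu : set R := mean mu @` lapdom mu.

(* phi_mu, the inverse of [mean mu] on [lapdom mu]. *)
Definition inv_mean mu : R -> R := pinv (lapdom mu) (mean mu).

Definition varfun mu (m : R) : R := (ell mu)^`(2)%classic (inv_mean mu m).

Definition has_varfun mu (D : set R) (V : R -> R) : Prop :=
  meandom mu = D /\ forall m, D m -> varfun mu m = V m.

Definition has_laplace mu (D : set R) (B : R -> R) : Prop :=
  lapdom mu = D /\ forall s, D s -> laplace mu s = (B s)%:E.

(* Derivatives being total, the domain condition must be explicit. *)
Definition dual_measure mu mus : Prop :=
  calM mus /\
  forall s, lapdom mu s -> lapdom mus (mean mu s) /\ mean mus (mean mu s) = s.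

Definition generates mu (T : set (probability (measurableTypeR R) R)) : Prop :=
  calM mu /\ TEF (NEF mu) = T.

(* [Ts] is the dual of the T-exponential family [T]; it does not depend on
   the generating measure and dual measure that are used. *)
Definition is_dual (T Ts : set (probability (measurableTypeR R) R)) : Prop :=
  exists mu mus, [/\ generates mu T, dual_measure mu mus & TEF (NEF mus) = Ts].

Definition has_dual (T : set (probability (measurableTypeR R) R)) : Prop :=
  exists mu mus, generates mu T /\ dual_measure mu mus.

Definition dual_pair (F : set (probability (measurableTypeR R) R)) mu nu :
    Prop :=
  [/\ calM mu, calM nu, NEF mu = F, TEF (NEF mu) = TEF F &
      is_dual (TEF F) (TEF (NEF nu))].

End laplace.

Section elementary.
Context {R : realType}.

Definition cosh (x : R) : R := (expR x + expR (- x)) / 2.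
Definition sinh (x : R) : R := (expR x - expR (- x)) / 2.
Definition cot (x : R) : R := cos x / sin x.

(* The log-Laplace transform l on s > 0 of a dual of the large arcsine family:
   l'' must be the reciprocal 1 / (s (1 + 2 s cos a + s^2)) of the variance
   function, and
     l' (s) = ln s - ln (1 + 2 s cos a + s^2) / 2
              - cot a * atan ((s + cos a) / sin a) + constant.
   The last three terms are affine in s: they only fix a translation and a
   multiplicative constant. The published expression, which has
   (s + cos a) ln (s + cos a) / 2 and cot a * u * atan u with
   u = (s + cos a) / sin a, does not have this second derivative. *)
Definition large_arcsine_ell (a s : R) : R :=
  s * ln s
  - 2^-1 * s * ln (1 + 2 * s * cos a + s ^+ 2)
  - ((1 + s * cos a) / sin a) * atan ((s + cos a) / sin a)
  + (- 2^-1 + (pi / 2 - a) * cos a) * s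
  + 2^-1 * cos a * ln (cos a)
  + cot a ^+ 2 * (pi / 2 - a).

End elementary.

(* Main.v *)
Require Import Defs.
From HB Require Import structures.
From mathcomp Require Import all_boot all_order all_algebra.
From mathcomp Require Import all_classical all_reals all_analysis.
From mathcomp Require Import measurable_realfun ring lra.

Set Implicit Arguments.
Unset Strict Implicit.
Unset Printing Implicit Defensive.

Import Order.TTheory GRing.Theory Num.Theory.
Import numFieldNormedType.Exports.

Local Open Scope classical_set_scope.
Local Open Scope ring_scope.

(** Let V be the variance function of the family on its domain of the means D, and
    let G be an antiderivative of 1 / V on D. Along the family the mean satisfies
    mean' = - V (mean), so that G (mean s) = c - s for a constant c; replacing the
    generating measure by its tilt by c makes c vanish. If L is an antiderivative
    of G and exp L is on D the Laplace transform of a measure nu, then the mean of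
    nu is - G, which inverts the mean of the tilted measure: nu is a dual measure
    ([dual_family]). The Laplace transform of nu is finite on no larger open set.
    Otherwise, by convexity, its domain would contain an end point e of D; its
    variance is continuous at e, but it equals 1 / V on D, while V is continuous
    and V e = 0 ([dual_lapdom]). The domain of the means of mu, hence the data
    listed for mu and nu, follow by solving the same equations
    ([dual_case_explicit]).

    What remains is that each exp L is a Laplace transform. A pointwise limit on
    the half-line of Laplace transforms is one ([isLap_limit]): the distribution
    functions are bounded by Markov's inequality, an ultrafilter selects a
    pointwise limit, and comparison with finite sums over a grid identifies its
    transform. Laplace transforms are also closed under sums, products and tilts,
    so the set of exponents K such that exp (t K) is a Laplace transform for all
    t >= 0 is a convex cone, closed under limits and integrals, that contains the
    affine functions and the Laplace transforms ([isID]). Integrating 1 / (s + u)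
    against suitable weights in u gives ln ((s + c) / s) and, up to constants, - ln s
    in the limit (gamma); integrating the latter gives the dual of the negative binomial family
    and, in the limit, s ln s (the dual of the Poisson family); the weights u and
    1 - u give the duals of the Abel and Kendall-Ressel families, and a combination
    of these gives those of the Takacs families. The dual of the binomial family is
    the convolution of the measure with exponent s ln s and a reflected tilt of
    it. For the arcsine families 1 / V is the Laplace transform of an explicit
    nonnegative function h with h x <= x^2 / 2, hence the second derivative of the
    Laplace transform of h x / x^2 dx, which differs from L by an affine function
    ([isID_arcsine]).

    For V m = m^2 + 1 a dual measure would, after a tilt, have variance
    1 / (1 + s^2) for all real s. The first four moments at s = 0 are then those of
    the symmetric law on {m - 1, m + 1}, which forces the measure to be carried by
    these two points; but then its variance decreases exponentially
    ([no_cauchy_variance]). *)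

(** * Measures with a density *)

Section density.
Local Open Scope ereal_scope.
Context d (T : measurableType d) (R : realType).
Import HBNNSimple.

(** The set function A |-> int_A f dmu is a measure; the formula for its integrals
    passes from simple functions to nonnegative measurable ones by monotone
    convergence. *)
Lemma density_measure (mu : {measure set T -> \bar R}) (f : T -> R) :
  measurable_fun [set: T] f -> (forall x, (0 <= f x)%R) ->
  exists nu : {measure set T -> \bar R},
    (forall A, nu A = \int[mu]_(x in A) (f x)%:E) /\
    (forall g : T -> \bar R, measurable_fun [set: T] g -> (forall x, 0 <= g x) ->
      \int[nu]_x g x = \int[mu]_x (g x * (f x)%:E)).
Proof.
move=> mf f0.
pose dn (A : set T) : \bar R := \int[mu]_(x in A) (f x)%:E.
have dn0 : dn set0 = 0 by rewrite /dn integral_set0.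
have dn_ge0 A : 0 <= dn A by apply: integral_ge0 => x _; rewrite lee_fin.
have mfE A : measurable_fun A (EFin \o f).
  by apply: measurable_funTS; exact/measurable_EFinP.
have dns : semi_sigma_additive dn.
  move=> /= A mA tA mUA.
  rewrite /dn/= ge0_integral_bigcup//=; last by move=> x _; rewrite lee_fin.
  apply: is_cvg_ereal_nneg_natsum_cond => n _ _.
  exact: dn_ge0.
pose nu : {measure set T -> \bar R} := HB.pack dn (isMeasure.Build _ _ _ dn dn0 dn_ge0 dns).
exists nu; split => // g mg g0.
have nuI (h : {nnsfun T >-> R}) : \int[nu]_x (h x)%:E = \int[mu]_x ((h x)%:E * (f x)%:E).
  under eq_integral do rewrite fimfunE -fsumEFin//.
  rewrite ge0_integral_fsum//; last 2 first.
    - by move=> r; exact/measurable_EFinP/measurable_funM.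
    - by move=> r x _; rewrite nnfun_muleindic_ge0.
  transitivity (\sum_(r \in range h)
     \int[mu]_x ((r * \1_(h @^-1` [set r]) x)%:E * (f x)%:E)).
    apply: eq_fsbigr => r _.
    rewrite integralZl_indic_nnsfun// integral_indic//= setIT.
    have [r0|r0] := leP 0%R r; last first.
      rewrite preimage_nnfun0// dn0 mule0 integral0_eq// => x _.
      by rewrite indicE in_set0 mulr0 mul0e.
    under [RHS]eq_integral => x _ do rewrite EFinM -muleA.
    rewrite ge0_integralZl//=; last 2 first.
    - by apply: emeasurable_funM => //; exact/measurable_EFinP.
    - by move=> x _; rewrite mule_ge0// lee_fin.
    congr (_ * _); rewrite /dn [LHS]integral_mkcond; apply: eq_integral => x _.
    rewrite /= patchE indicE; case: ifP => _ ; by rewrite ?mul1e ?mul0e.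
  rewrite -ge0_integral_fsum//.
  - apply: eq_integral => x _; rewrite [in RHS]fimfunE -fsumEFin//.
    rewrite ge0_mule_fsuml//.
    by move=> r; rewrite nnfun_muleindic_ge0.
  - by move=> r; apply: emeasurable_funM => //; exact/measurable_EFinP/measurable_funM.
  - by move=> r x _; rewrite mule_ge0// ?nnfun_muleindic_ge0// lee_fin.
pose g_ := nnsfun_approx measurableT mg.
transitivity (limn (fun n => \int[nu]_x (g_ n x)%:E)).
  rewrite -monotone_convergence//.
  - apply: eq_integral => y yD; apply/esym/cvg_lim => //.
    by apply: cvg_nnsfun_approx.
  - by move=> n; exact/measurable_EFinP/measurable_funP.
  - by move=> n y _; rewrite lee_fin.
  - by move=> y _ m n mn; rewrite lee_fin; exact/lefP/nd_nnsfun_approx.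
transitivity (limn (fun n => \int[mu]_x ((g_ n x)%:E * (f x)%:E))).
  by congr (limn _); apply/funext => n; exact: nuI.
rewrite -monotone_convergence//.
- apply: eq_integral => y _; apply/cvg_lim => //.
  apply: cvgeMr => //.
  by apply: cvg_nnsfun_approx.
- by move=> n; apply: emeasurable_funM => //; exact/measurable_EFinP/measurable_funP.
- by move=> n y _; rewrite mule_ge0// lee_fin.
- by move=> y _ m n mn; rewrite lee_wpmul2r ?lee_fin//; exact/lefP/nd_nnsfun_approx.
Qed.

End density.

(** * Operations on Laplace transforms *)

Lemma sigma_finite_measure_of d (T : measurableType d) (R : realType) (mu : {measure set T -> \bar R}) :
  sigma_finite [set: T] mu -> exists m : {sigma_finite_measure set T -> \bar R}, mu = m.
Proof.
case: mu => m cm sf.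
pose H := Measure_isSigmaFinite.Build _ _ _ (Measure.Pack cm) sf.
pose m' : {sigma_finite_measure set T -> \bar R} := HB.pack m cm H.
by exists m'; apply: eq_measure.
Qed.

Section laplace_closure.
Context {R : realType}.
Implicit Types mu nu : {measure set (measurableTypeR R) -> \bar R}.

Lemma measurable_expN (s : R) :
  measurable_fun [set: measurableTypeR R] (fun x : measurableTypeR R => expR (- (s * x))).
Proof.
apply: measurableT_comp => //.
apply: measurableT_comp => //.
Qed.

Lemma measurable_EexpN (s : R) :
  measurable_fun [set: measurableTypeR R]
    (fun x : measurableTypeR R => (expR (- (s * x)))%:E).
Proof. by apply: measurableT_comp => //; exact: measurable_expN. Qed.

Lemma laplace_ge0 mu (s : R) : (0 <= laplace mu s)%E.
Proof. by apply: integral_ge0 => x _; rewrite lee_fin expR_ge0. Qed.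

Lemma laplace_tilt mu (c b : R) : 0 <= c ->
  exists nu, (forall A, nu A = \int[mu]_(x in A) (c * expR (- (b * x)))%:E)%E /\
   (forall g : measurableTypeR R -> \bar R, measurable_fun [set: measurableTypeR R] g ->
     (forall x, (0 <= g x)%E) ->
     (\int[nu]_x g x = \int[mu]_x (g x * (c * expR (- (b * x)))%:E))%E) /\
   (forall s, laplace nu s = c%:E * laplace mu (s + b))%E.
Proof.
move=> c0.
have mf : measurable_fun [set: measurableTypeR R]
    (fun x : measurableTypeR R => c * expR (- (b * x))).
  by apply: measurable_funM; [exact: measurable_cst|exact: measurable_expN].
have f0 (x : measurableTypeR R) : 0 <= c * expR (- (b * x)).
  by rewrite mulr_ge0// expR_ge0.
have [nu [nuA nuI]] := density_measure mu mf f0.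
exists nu; split; [exact: nuA|split; [exact: nuI|]] => s.
rewrite /laplace nuI//; last exact: measurable_EexpN.
rewrite -ge0_integralZl//; last exact: measurable_EexpN.
apply: eq_integral => x _; rewrite -!EFinM mulrCA -expRD.
by congr (_ * expR _)%:E; ring.
Qed.

Lemma laplace_pushforward d (T : measurableType d) (m : {measure set T -> \bar R})
    (phi : T -> measurableTypeR R) : measurable_fun [set: T] phi -> forall s : R,
  (\int[pushforward m phi]_y (expR (- (s * y)))%:E = \int[m]_x (expR (- (s * phi x)))%:E)%E.
Proof.
move=> mphi s.
apply: (ge0_integral_pushforward mphi m measurableT (measurable_EexpN s)) => x _.
by rewrite lee_fin expR_ge0.
Qed.

Lemma laplace_affine mu (a b : R) :
  exists nu, forall s, laplace nu s = ((expR (- (s * b)))%:E * laplace mu (a * s))%E.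
Proof.
have mp : measurable_fun [set: measurableTypeR R]
    (fun x : measurableTypeR R => a * x + b : measurableTypeR R).
  by apply: measurable_funD => //; exact: measurable_funM.
exists (pushforward mu (fun x : measurableTypeR R => a * x + b : measurableTypeR R)).
move=> s; rewrite /laplace laplace_pushforward//.
rewrite -ge0_integralZl//; last exact: measurable_EexpN.
apply: eq_integral => x _ /=; rewrite -EFinM -expRD.
by congr (expR _)%:E; ring.
Unshelve. exact: mp.
Qed.

Lemma laplace_add mu nu : exists rho, forall s, (laplace rho s = laplace mu s + laplace nu s)%E.
Proof.
exists (measure_add mu nu) => s.
by rewrite /laplace ge0_integral_measure_add//; exact: measurable_EexpN.
Qed.

Lemma laplace_dirac (a : R) : exists nu, forall s, laplace nu s = (expR (- (s * a)))%:E.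
Proof.
exists (\d_(a : measurableTypeR R)) => s.
rewrite /laplace integral_dirac//; last exact: measurable_EexpN.
by rewrite diracT mul1e.
Qed.

(** A bounded interval has finite mass because x |-> exp (- s x) is bounded below
    by a positive constant there. *)
Lemma laplace_sigma_finite mu (s : R) : (laplace mu s < +oo)%E ->
  sigma_finite [set: measurableTypeR R] mu.
Proof.
move=> fin; exists (fun k => `[(- k%:R), k%:R]%classic).
  apply/esym; rewrite -subTset => /= x _ /=.
  exists (Num.bound `|x|) => //=; rewrite in_itv/= -ler_norml.
  exact/ltW/archi_boundP.
move=> k; split; first exact: measurable_itv.
have mI : measurable (`[- k%:R, k%:R]%classic : set (measurableTypeR R)).
  exact: measurable_itv.
set e := expR (- (`|s| * k%:R)).
have e0 : 0 < e by exact: expR_gt0.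
have : (e%:E * mu `[(- k%:R)%R, k%:R%R]%classic <= laplace mu s)%E.
  rewrite /laplace -integral_cst//.
  apply: (@le_trans _ _ (\int[mu]_(x in `[(- k%:R)%R, k%:R%R]) (expR (- (s * x)))%:E)%E).
    apply: ge0_le_integral => //=.
    - by move=> x _; rewrite lee_fin ltW.
    - by apply/measurable_funTS; exact: measurable_EexpN.
    - move=> x; rewrite /= in_itv/= -ler_norml => xk.
      rewrite lee_fin ler_expR lerN2 (le_trans (ler_norm _))// normrM.
      by rewrite ler_wpM2l.
  apply: ge0_subset_integral => //.
  exact: (measurable_EexpN s).
move=> /le_lt_trans/(_ fin).
case: (mu _) (measure_ge0 mu `[(- k%:R)%R, k%:R%R]%classic) => [r||]// _.
  by move=> _; rewrite ltry.
by rewrite mulry gtr0_sg// mul1e.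
Qed.

(** The convolution is the image of the product measure under addition; finiteness
    of the transforms at one point gives the sigma-finiteness that Tonelli's
    theorem requires. *)
Lemma laplace_convolution mu nu :
  (exists s, laplace mu s < +oo)%E -> (exists s, laplace nu s < +oo)%E ->
  exists rho, forall s, (laplace rho s = laplace mu s * laplace nu s)%E.
Proof.
move=> [s1 f1] [s2 f2].
have [m1 mE1] := sigma_finite_measure_of (laplace_sigma_finite f1).
have [m2 mE2] := sigma_finite_measure_of (laplace_sigma_finite f2).
pose add (z : measurableTypeR R * measurableTypeR R) : measurableTypeR R := z.1 + z.2.
have madd : measurable_fun setT add by exact: measurable_funD.
exists (pushforward (m1 \x m2)%E add) => s.
have mL := measurable_EexpN s; rewrite mE1 mE2.
rewrite [LHS]/laplace laplace_pushforward//.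
have mF : measurable_fun [set: measurableTypeR R * measurableTypeR R]
    (fun z : measurableTypeR R * measurableTypeR R => (expR (- (s * add z)))%:E).
  exact: (measurableT_comp mL madd).
rewrite (@fubini_tonelli1 _ _ _ _ _ m1 m2 _ mF)//.
transitivity (\int[m1]_x ((expR (- (s * x)))%:E * laplace m2 s))%E.
  apply: eq_integral => x _; rewrite /fubini_F /laplace -ge0_integralZl//.
  by apply: eq_integral => y _; rewrite -EFinM -expRD -opprD -mulrDr.
by rewrite ge0_integralZr ?laplace_ge0.
Unshelve. exact: madd.
Qed.

End laplace_closure.

(** * Laplace transforms as limits of finite sums over a distribution function *)

Section grid.
Context {R : realType}.
Variables (s dl t0 : R).
Hypotheses (s0 : 0 < s) (dl0 : 0 < dl).

(** The step function [grid_fun m] takes on the cell ](grid_pt i), (grid_pt i.+1)]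
    the value of exp (- s x) - exp (- s (grid_pt m)) at its right end. Its integral
    is a finite combination of values of the distribution function. *)
Definition grid_pt (i : nat) : R := t0 + dl * i%:R.
Definition grid_wt (i : nat) : R := expR (- (s * grid_pt i)) - expR (- (s * grid_pt i.+1)).
Definition grid_fun (m : nat) (x : R) : R :=
  \sum_(i < m) grid_wt i * \1_(`]-oo, grid_pt i]%classic : set R) x.
Definition grid_sum (H : R -> R) (m : nat) : R :=
  \sum_(i < m) grid_wt i * H (grid_pt i).

Lemma grid_ptS i : grid_pt i.+1 = grid_pt i + dl.
Proof. by rewrite /grid_pt -natr1; ring. Qed.

Lemma grid_wt_ge0 i : 0 <= grid_wt i.
Proof.
rewrite subr_ge0 ler_expR lerN2 ler_pM2l// grid_ptS.
by rewrite lerDl ltW.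
Qed.

Lemma indic_Ny (a x : R) : (\1_(`]-oo, a]%classic : set R) : R -> R) x = ((x <= a)%R)%:R.
Proof. by rewrite indicE mem_setE/= in_itv. Qed.

Lemma grid_fun_ge0 m x : 0 <= grid_fun m x.
Proof. by apply: sumr_ge0 => i _; rewrite mulr_ge0 ?grid_wt_ge0. Qed.

(** The weights telescope, so that below [grid_pt m] the step function is at most
    exp (- s x) - exp (- s (grid_pt m)). *)
Lemma grid_fun_le m x : grid_fun m x <= expR (- (s * x)).
Proof.
suff : grid_fun m x <= Num.max (0 : R) (expR (- (s * x)) - expR (- (s * grid_pt m))).
  rewrite le_max => /orP[/le_trans|/le_trans]; apply; rewrite ?expR_ge0//.
  by rewrite gerBl expR_ge0.
elim: m => [|m IH]; first by rewrite /grid_fun big_ord0 le_max lexx.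
rewrite /grid_fun big_ord_recr/= -/(grid_fun m x) indic_Ny.
have [xm|xm] := leP x (grid_pt m).
  rewrite mulr1 le_max; apply/orP; right.
  move: IH; rewrite le_max => /orP[]IH; rewrite /grid_wt.
    have : expR (- (s * grid_pt m)) <= expR (- (s * x)).
      by rewrite ler_expR lerN2 ler_pM2l.
    lra.
  lra.
rewrite mulr0 addr0 /grid_fun big1 ?le_max ?lexx// => i _.
rewrite indic_Ny leNgt (le_lt_trans _ xm) ?mulr0//.
by rewrite lerD2l ler_pM2l// ler_nat ltnW.
Qed.

(** Going one mesh to the right absorbs the discretisation error; what is lost
    beyond the end of the grid is the last term. *)
Lemma grid_fun_ge m x : t0 <= x + dl ->
  expR (- (s * (x + dl))) <= grid_fun m x + expR (- (s * grid_pt m)).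
Proof.
move=> tx; elim: m => [|m IH].
  rewrite /grid_fun big_ord0 add0r ler_expR lerN2 ler_pM2l//.
  by rewrite /grid_pt mulr0 addr0.
rewrite /grid_fun big_ord_recr/= -/(grid_fun m x) indic_Ny.
have [xm|xm] := leP x (grid_pt m).
  by rewrite mulr1 /grid_wt; lra.
rewrite mulr0 addr0; apply: (@le_trans _ _ (expR (- (s * grid_pt m.+1)))).
  by rewrite ler_expR lerN2 ler_pM2l// grid_ptS lerD2r ltW.
by rewrite lerDr grid_fun_ge0.
Qed.

Lemma measurable_grid_fun m :
  measurable_fun [set: measurableTypeR R] (grid_fun m : measurableTypeR R -> R).
Proof.
by apply: measurable_sum => i; apply: measurable_funM.
Qed.

Lemma integral_grid_fun (nu : {measure set (measurableTypeR R) -> \bar R}) H m :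
  (forall x, nu `]-oo, x]%classic = (H x)%:E) ->
  (\int[nu]_x (grid_fun m x)%:E = (grid_sum H m)%:E)%E.
Proof.
move=> nuH; rewrite /grid_fun /grid_sum.
under eq_integral => x _ do rewrite -sumEFin.
rewrite ge0_integral_sum//; last 2 first.
- move=> i; apply/measurable_EFinP; apply: measurable_funM => //.
- by move=> i x _; rewrite lee_fin mulr_ge0 ?grid_wt_ge0.
rewrite -sumEFin; apply: eq_bigr => i _.
under eq_integral => x _ do rewrite EFinM.
rewrite ge0_integralZl//; last 2 first.
- by apply/measurable_EFinP; exact: measurable_indic.
- by rewrite lee_fin grid_wt_ge0.
by rewrite integral_indic// setIT nuH.
Qed.

Lemma grid_sum_le_laplace (nu : {measure set (measurableTypeR R) -> \bar R}) H m :
  (forall x, nu `]-oo, x]%classic = (H x)%:E) ->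
  ((grid_sum H m)%:E <= laplace nu s)%E.
Proof.
move=> nuH; rewrite -(integral_grid_fun _ nuH).
apply: ge0_le_integral => //.
- by move=> x _; rewrite lee_fin grid_fun_ge0.
- by apply/measurable_EFinP; exact: measurable_grid_fun.
- exact: measurable_EexpN.
- by move=> x _; rewrite lee_fin grid_fun_le.
Qed.

End grid.

Section grid_shift.
Context {R : realType}.

(** Moving the grid by one mesh turns a comparison of [F] and [G] at distinct points
    into one of their sums, at the cost of a factor tending to 1. It absorbs the
    passage from a monotone function to its right-continuous version. *)
Lemma grid_sum_shift (s dl t0 : R) (F G : R -> R) m : 0 < s -> 0 < dl ->
  (forall x y, x < y -> F x <= G y) ->
  grid_sum s dl t0 F m <= expR (s * dl) * grid_sum s dl (t0 + dl) G m.
Proof.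
move=> s0 dl0 FG; rewrite /grid_sum mulr_sumr; apply: ler_sum => i _.
have E j : grid_pt dl (t0 + dl) j = grid_pt dl t0 j + dl by rewrite /grid_pt; ring.
have -> : grid_wt s dl t0 i = expR (s * dl) * grid_wt s dl (t0 + dl) i.
  rewrite /grid_wt !E mulrBr -!expRD; congr (expR _ - expR _); ring.
rewrite mulrA ler_wpM2l ?mulr_ge0 ?expR_ge0 ?grid_wt_ge0//.
by apply: FG; rewrite E ltrDl.
Qed.

(** The grid on [-(N+1), N+1] with mesh 1 / (N+1). *)
Definition mesh (N : nat) : R := N.+1%:R^-1.
Definition halfwidth (N : nat) : R := N.+1%:R.
Definition ncells (N : nat) : nat := (2 * N.+1 ^ 2)%N.

Lemma mesh_gt0 N : 0 < mesh N. Proof. by rewrite invr_gt0 ltr0n. Qed.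
Lemma grid_pt_end N : grid_pt (mesh N) (- halfwidth N) (ncells N) = halfwidth N.
Proof.
rewrite /grid_pt /mesh /halfwidth /ncells natrM natrX.
have : N.+1%:R != 0 :> R by rewrite pnatr_eq0.
by move=> h; field.
Qed.

(** Outside the grid exp (- s x) is exp (- e (N+1)) times one of the exponentials
    with parameter s - e or s + e, which bounds both tails uniformly by values of
    the transform at two neighbouring points. *)
Lemma expN_le_grid (s e x : R) N : 0 < e -> e < s ->
  expR (- (s * x)) <= expR (s * mesh N) * (grid_fun s (mesh N) (- halfwidth N) (ncells N) x +
     expR (- (e * halfwidth N)) * (expR (- ((s - e) * x)) + expR (- ((s + e) * x)))).
Proof.
move=> e0 es; have s0 : 0 < s by lra.
have g0 := grid_fun_ge0 (- halfwidth N) s0 (mesh_gt0 N) (ncells N) x.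
have ed1 : 1 <= expR (s * mesh N).
  by rewrite -expR0 ler_expR mulr_ge0 ?ltW ?mesh_gt0.
have [xM|xM] := leP (- halfwidth N) x; last first.
  have : expR (- (s * x)) <= expR (- (e * halfwidth N)) * expR (- ((s + e) * x)).
    rewrite -expRD ler_expR -subr_ge0.
    rewrite (_ : _ - _ = e * (- halfwidth N - x)); last by ring.
    by rewrite mulr_ge0 ?subr_ge0// ltW.
  move=> h; apply: (le_trans h).
  rewrite -[leLHS]mul1r ler_pM ?mulr_ge0 ?expR_ge0//.
  rewrite -[leLHS]add0r lerD// ler_wpM2l ?expR_ge0//.
  by rewrite lerDr expR_ge0.
have := @grid_fun_ge _ s (mesh N) (- halfwidth N) s0 (mesh_gt0 N) (ncells N) x.
rewrite grid_pt_end => /(_ _).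
have h1 : - halfwidth N <= x + mesh N by rewrite (le_trans xM)// lerDl ltW// mesh_gt0.
move=> /(_ h1) h2.
rewrite -ler_pdivrMl ?expR_gt0// -expRN -expRD.
rewrite (_ : - (s * mesh N) + _ = - (s * (x + mesh N))); last by ring.
have [xM2|xM2] := leP x (halfwidth N).
  apply: (le_trans h2); rewrite lerD2l.
  apply: (@le_trans _ _ (expR (- (e * halfwidth N)) * expR (- ((s - e) * x)))).
    rewrite -expRD ler_expR -subr_ge0.
    rewrite (_ : _ - _ = (s - e) * (halfwidth N - x)); last by ring.
    by rewrite mulr_ge0 ?subr_ge0// ltW.
  by rewrite ler_wpM2l ?expR_ge0// lerDl expR_ge0.
apply: (@le_trans _ _ (expR (- (e * halfwidth N)) * expR (- ((s - e) * x)))).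
  rewrite -expRD ler_expR -subr_ge0.
  rewrite (_ : _ - _ = e * (x - halfwidth N) + s * mesh N); last by ring.
  by rewrite addr_ge0// mulr_ge0 ?subr_ge0 ?ltW// mesh_gt0.
rewrite -[leLHS]add0r lerD// ler_wpM2l ?expR_ge0//.
by rewrite lerDl expR_ge0.
Qed.

Lemma laplace_le_grid (nu : {measure set (measurableTypeR R) -> \bar R}) H (s e b b1 b2 : R) N :
  0 < e -> e < s ->
  (forall x, nu `]-oo, x]%classic = (H x)%:E) ->
  laplace nu s = b%:E -> laplace nu (s - e) = b1%:E -> laplace nu (s + e) = b2%:E ->
  b <= expR (s * mesh N) * (grid_sum s (mesh N) (- halfwidth N) H (ncells N) +
     expR (- (e * halfwidth N)) * (b1 + b2)).
Proof.
move=> e0 es nuH lb lb1 lb2; have s0 : 0 < s by lra.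
have dl0 := mesh_gt0 N.
have mg : measurable_fun [set: measurableTypeR R]
   (fun x : measurableTypeR R => (grid_fun s (mesh N) (- halfwidth N) (ncells N) x)%:E).
  by apply/measurable_EFinP; exact: measurable_grid_fun.
have m1 := measurable_EexpN (s - e); have m2 := measurable_EexpN (s + e).
have m3 : measurable_fun [set: measurableTypeR R]
   (fun x : measurableTypeR R => ((expR (- ((s - e) * x)))%:E + (expR (- ((s + e) * x)))%:E)%E).
  exact: emeasurable_funD.
have m4 : measurable_fun [set: measurableTypeR R]
   (fun x : measurableTypeR R => ((expR (- (e * halfwidth N)))%:E *
     ((expR (- ((s - e) * x)))%:E + (expR (- ((s + e) * x)))%:E))%E).
  exact: emeasurable_funM.
have m5 : measurable_fun [set: measurableTypeR R]
   (fun x : measurableTypeR R => ((grid_fun s (mesh N) (- halfwidth N) (ncells N) x)%:E +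
     (expR (- (e * halfwidth N)))%:E *
     ((expR (- ((s - e) * x)))%:E + (expR (- ((s + e) * x)))%:E))%E).
  exact: emeasurable_funD.
rewrite -lee_fin -lb EFinM !EFinD EFinM -(integral_grid_fun _ s0 dl0 _ nuH) EFinD -lb1 -lb2.
rewrite /laplace -ge0_integralD//.
rewrite -ge0_integralZl//; last by move=> x _; rewrite adde_ge0 ?lee_fin ?expR_ge0.
rewrite -ge0_integralD//; last 2 first.
- by move=> x _; rewrite lee_fin grid_fun_ge0.
- by move=> x _; rewrite mule_ge0 ?adde_ge0 ?lee_fin ?expR_ge0.
rewrite -ge0_integralZl//; last first.
  by move=> x _; rewrite adde_ge0 ?mule_ge0 ?adde_ge0 ?lee_fin ?grid_fun_ge0 ?expR_ge0.
apply: ge0_le_integral => //.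
- exact: measurable_EexpN.
- exact: emeasurable_funM.
- by move=> x _; rewrite -?EFinD -?EFinM -?EFinD -?EFinM lee_fin expN_le_grid.
Qed.

End grid_shift.

(** * Pointwise limits of Laplace transforms *)

Section limit.
Context {R : realType}.

Lemma ultra_bounded_cvg (U : set_system nat) (UU : UltraFilter U) (u : nat -> R) (M : R) :
  (forall n, 0 <= u n <= M) -> exists l : R, u n @[n --> U] --> l.
Proof.
move=> uM; have PU : ProperFilter U by exact: ultra_proper.
have cK := @segment_compact R 0 M.
have UK : U (u @^-1` `[0, M]) by apply: filterE => n /=; rewrite in_itv/= uM.
have [p [_ clp]] := cK (u @ U) _ UK.
exists p => B Bp.
have [//|UnB] := in_ultra_setVsetC (u @^-1` B) UU.
by have [q [nBq Bq]] := clp (~` B) B UnB Bp; exfalso; exact: nBq.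
Qed.

(** Markov's inequality for exp (- s x). *)
Lemma cdf_le_laplace (nu : {measure set (measurableTypeR R) -> \bar R}) (s b x : R) :
  0 < s -> laplace nu s = b%:E ->
  (nu `]-oo, x]%classic <= (expR (s * x) * b)%:E)%E.
Proof.
move=> s0 lb.
have mI : measurable (`]-oo, x]%classic : set (measurableTypeR R)) by exact: measurable_itv.
have : ((expR (- (s * x)))%:E * nu `]-oo, x]%classic <= b%:E)%E.
  rewrite -lb /laplace -integral_cst//.
  apply: (@le_trans _ _ (\int[nu]_(y in `]-oo, x]) (expR (- (s * y)))%:E)%E).
    apply: ge0_le_integral => //=.
    - by apply/measurable_funTS; exact: measurable_EexpN.
    - move=> y; rewrite in_itv/= => yx.
      by rewrite lee_fin ler_expR lerN2 ler_pM2l.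
  apply: ge0_subset_integral => //.
  exact: (measurable_EexpN s).
rewrite EFinM expRN.
by rewrite lee_pdivrMl ?expR_gt0.
Qed.

Lemma lebesgue_stieltjes_itvoc (F : cumulative R R) (a b : R) : a <= b ->
  lebesgue_stieltjes_measure F `]a, b]%classic = (F b - F a)%:E.
Proof.
move=> ab; rewrite /lebesgue_stieltjes_measure/= /measure_extension/=.
rewrite measurable_mu_extE/=; last exact: is_ocitv.
by rewrite wlength_itv_bnd.
Qed.

(** The Lebesgue-Stieltjes measure of [F]; its mass on a left half-line is obtained
    from intervals ](x - n), x], where the vanishing of [F] at - oo enters. *)
Lemma measure_of_cdf (F : R -> R) : {homo F : x y / x <= y} ->
  (forall x e, 0 < e -> exists2 y, x < y & F y < F x + e) ->
  (forall x, 0 <= F x) -> (F (- n%:R) @[n --> \oo] --> 0) ->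
  exists nu : {measure set (measurableTypeR R) -> \bar R},
    forall x, nu `]-oo, x]%classic = (F x)%:E.
Proof.
move=> ndF rcF F0 FNy.
have rcF' : right_continuous F.
  move=> x; apply/cvgrPdist_lt => e e0.
  have [y xy Fy] := rcF x e e0.
  near=> z.
  have xz : x < z by near: z; exact: nbhs_right_gt.
  have zy : z < y by near: z; exact: nbhs_right_lt.
  rewrite distrC ger0_norm ?subr_ge0 ?ndF ?ltW//.
  by rewrite ltrBlDl (le_lt_trans _ Fy)// ndF// ltW.
pose cF : cumulative R R := HB.pack F (isCumulative.Build R _ R F ndF rcF').
exists (lebesgue_stieltjes_measure cF) => x.
have LSE (a b : R) : a <= b -> lebesgue_stieltjes_measure cF `]a, b]%classic = (F b - F a)%:E.
  exact: lebesgue_stieltjes_itvoc.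
pose A n : set (measurableTypeR R) := `](x - n%:R), x]%classic.
have AE : \bigcup_n A n = `]-oo, x]%classic.
  apply/seteqP; split => y /=.
    by move=> [n _]; rewrite /A /= !in_itv/= => /andP[].
  rewrite in_itv/= => yx; exists (Num.bound (x - y)) => //.
  rewrite /A /= in_itv/= yx andbT ltrBlDr -ltrBlDl.
  by apply: archi_boundP; rewrite subr_ge0.
have h1 : (lebesgue_stieltjes_measure cF \o A) n @[n --> \oo] --> lebesgue_stieltjes_measure cF (\bigcup_n A n).
  apply: nondecreasing_cvg_mu.
  - by move=> i; exact: measurable_itv.
  - by rewrite AE; exact: measurable_itv.
  - move=> n m nm; apply/subsetPset => y; rewrite /A /= !in_itv/= => /andP[h ->].
    by rewrite andbT (le_lt_trans _ h)// lerB// ler_nat.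
have h2 : (lebesgue_stieltjes_measure cF \o A) n @[n --> \oo] --> (F x)%:E.
  rewrite (_ : _ \o _ = fun n => (F x - F (x - n%:R))%:E); last first.
    by apply/funext => n /=; rewrite LSE// gerBl.
  apply/fine_cvgP; split; first by near=> n.
  rewrite /comp/= -[X in _ --> X]subr0; apply: cvgB; first exact: cvg_cst.
  have [k xk] : exists k : nat, x <= k%:R.
    by exists (Num.bound `|x|); rewrite (le_trans (ler_norm _))// ltW// archi_boundP.
  apply: (@squeeze_cvgr _ _ _ _ (cst 0) (fun n => F (- (n - k)%:R))).
  - near=> n; rewrite F0/= ndF//.
    have kn : (k <= n)%N by near: n; exact: nbhs_infty_ge.
    by rewrite natrB// opprB lerB.
  - exact: cvg_cst.
  - by rewrite -(cvg_shiftn k)/=; under eq_fun do rewrite addnK.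
rewrite -AE; apply: cvg_unique h1 h2 => //.
Unshelve. all: by end_near. Qed.

(** Only the half-line s > 0 matters: it is the domain of most of the transforms
    below, and tilts by u >= 0 preserve it. *)
Definition isLap (B : R -> R) := exists nu : {measure set (measurableTypeR R) -> \bar R},
  forall s, 0 < s -> laplace nu s = (B s)%:E.

Lemma isLap_ge0 B s : isLap B -> 0 < s -> 0 <= B s.
Proof. by move=> [nu h] s0; rewrite -lee_fin -h// laplace_ge0. Qed.

Lemma cvg_mesh : @mesh R N @[N --> \oo] --> (0 : R).
Proof. exact: cvg_harmonic. Qed.

Lemma cvg_exp_mesh (s : R) : expR (s * mesh N) @[N --> \oo] --> (1 : R).
Proof.
rewrite -[X in _ --> X]expR0; apply: continuous_cvg; first exact: continuous_expR.
by rewrite -[X in _ --> X](mulr0 s); apply: cvgM; [exact: cvg_cst|exact: cvg_mesh].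
Qed.

Lemma cvg_exp_halfwidth (e : R) : 0 < e -> expR (- (e * halfwidth N)) @[N --> \oo] --> (0 : R).
Proof.
move=> e0.
apply: (@squeeze_cvgr _ _ _ _ (cst 0) (fun N => e^-1 * mesh N)).
- near=> N; rewrite expR_ge0/= expRN /mesh -invfM lef_pV2 ?posrE ?expR_gt0 ?mulr_gt0//.
  by apply: le_trans (expR_ge1Dx _); rewrite lerDr.
- exact: cvg_cst.
- by rewrite -[X in _ --> X](mulr0 e^-1); apply: cvgM; [exact: cvg_cst|exact: cvg_mesh].
Unshelve. all: by end_near. Qed.

(** A form of Helly's selection theorem. Along an ultrafilter the distribution
    functions converge pointwise to a monotone G, whose right-continuous version F
    defines a measure. For fixed N the grid sums are finite, so they pass to the
    limit; as N grows, they determine the transform of the limit measure because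
    the tails are controlled by the values at s / 2 and 3 s / 2. *)
Theorem isLap_limit (B_ : nat -> R -> R) (B : R -> R) :
  (forall n, isLap (B_ n)) ->
  (forall s, 0 < s -> B_ n s @[n --> \oo] --> B s) -> isLap B.
Proof.
move=> /choice[nu nuB] cvB.
(* An ultrafilter makes every bounded sequence converge, so no subsequence has to
   be extracted. *)
have [U [UU sU]] := @ultraFilterLemma nat \oo _.
have PU : ProperFilter U by exact: ultra_proper.
have cvBU s : 0 < s -> B_ n s @[n --> U] --> B s.
  by move=> s0 A /(cvB s s0) /sU.
have B0 s : 0 < s -> 0 <= B s.
  move=> s0; apply: (@ler_cvg_to _ _ PU _ _ _ _ _ (cvg_cst 0) (cvBU s s0)).
  apply: filterE => n; apply: isLap_ge0 s0; by exists (nu n); exact: nuB.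
have [M BM] : exists M, forall n, B_ n 1 <= M.
  have /cvg_seq_bounded : cvgn (fun n => B_ n 1) by apply/cvg_ex; exists (B 1); exact: cvB.
  move=> [M0 [_ /(_ (M0 + 1))]]; rewrite ltrDl => /(_ ltr01) hM.
  by exists (M0 + 1) => n; apply: (le_trans (ler_norm _)); apply: hM.
pose H n x := fine (nu n `]-oo, x]%classic).
have HE n x : nu n `]-oo, x]%classic = (H n x)%:E.
  rewrite /H fineK// ge0_fin_numE//.
  exact: le_lt_trans (cdf_le_laplace x ltr01 (nuB n 1 ltr01)) (ltry _).
have Hle n s x : 0 < s -> H n x <= expR (s * x) * B_ n s.
  by move=> s0; rewrite -lee_fin -HE; exact: cdf_le_laplace x s0 (nuB n s s0).
have H0 n x : 0 <= H n x by rewrite fine_ge0.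
have Hnd n x y : x <= y -> H n x <= H n y.
  move=> xy; rewrite -lee_fin -!HE le_measure ?inE//; try exact: measurable_itv.
  by move=> z; rewrite /= !in_itv/= => /le_trans; apply.
have /choice[G cvG] : forall x, exists l : R, H n x @[n --> U] --> l.
  move=> x; apply: (@ultra_bounded_cvg U UU _ (expR x * M)) => n.
  rewrite H0/=; have := @Hle n 1 x ltr01; rewrite mul1r => /le_trans; apply.
  by rewrite ler_wpM2l ?expR_ge0.
have G0 x : 0 <= G x.
  by apply: (@ler_cvg_to _ _ PU _ _ _ _ _ (cvg_cst 0) (cvG x)); apply: filterE.
have Gnd x y : x <= y -> G x <= G y.
  move=> xy; apply: (@ler_cvg_to _ _ PU _ _ _ _ _ (cvG x) (cvG y)).
  by apply: filterE => n; exact: Hnd.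
have Gle x : G x <= expR x * B 1.
  have c2 : expR x * B_ n 1 @[n --> U] --> expR x * B 1.
    by apply: cvgM; [exact: cvg_cst|exact: cvBU].
  apply: (@ler_cvg_to _ _ PU _ _ _ _ _ (cvG x) c2).
  by apply: filterE => n; have := @Hle n 1 x ltr01; rewrite mul1r.
(* G need not be right-continuous; F is its right-continuous version. *)
pose F x := inf [set G y | y in `]x, +oo[%classic].
have hasF x : has_inf [set G y | y in `]x, +oo[%classic].
  split; first by exists (G (x + 1)), (x + 1) => //=; rewrite in_itv/= andbT ltrDl.
  by exists 0 => _ [y _ <-].
have GF x : G x <= F x.
  apply: lb_le_inf; first exact: (hasF x).1.
  by move=> z [y /=]; rewrite in_itv/= andbT => xy <-; apply: Gnd; exact: ltW.
have FG x y : x < y -> F x <= G y.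
  move=> xy; apply: ge_inf; first exact: (hasF x).2.
  by exists y => //=; rewrite in_itv/= andbT.
have [nuF nuFE] : exists nu : {measure set (measurableTypeR R) -> \bar R},
    forall x, nu `]-oo, x]%classic = (F x)%:E.
  apply: measure_of_cdf.
  - move=> x y; rewrite le_eqVlt => /predU1P[->//|xy].
    exact: le_trans (FG _ _ xy) (GF _).
  - move=> x e e0.
    have [z [y /=]] := inf_adherent e0 (hasF x).
    rewrite in_itv/= andbT => xy <- Gy.
    exists ((x + y) / 2); first by rewrite midf_lt.
    by apply: le_lt_trans Gy; apply: FG; rewrite midf_lt.
  - by move=> x; exact: le_trans (G0 x) (GF x).
  - apply: (@squeeze_cvgr _ _ _ _ (cst 0) (fun n => expR (1 - n%:R) * B 1)).
    + near=> n; rewrite (le_trans (G0 _) (GF _))/=.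
      apply: le_trans (Gle _); apply: FG; lra.
    + exact: cvg_cst.
    + rewrite -[X in _ --> X](mul0r (B 1)); apply: cvgM; last exact: cvg_cst.
      have -> : (fun n : nat => expR (1 - n%:R : R)) = (fun n => expR 1 * expR (- n%:R)).
        by apply/funext => n; rewrite expRD.
      rewrite -[X in _ --> X](mulr0 (expR 1)); apply: cvgM; first exact: cvg_cst.
      exact: cvgn_expR.
exists nuF => s s0.
have sumG (dl t0 : R) m : 0 < dl -> grid_sum s dl t0 (H n) m @[n --> U] --> grid_sum s dl t0 G m.
  move=> dl0; rewrite /grid_sum; elim: m => [|m IH].
    by under eq_fun do rewrite big_ord0; rewrite big_ord0; exact: cvg_cst.
  under eq_fun do rewrite big_ord_recr/=.
  rewrite big_ord_recr/=; apply: cvgD; first exact: IH.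
  by apply: cvgM; [exact: cvg_cst|exact: cvG].
have up (N : nat) : grid_sum s (mesh N) (- halfwidth N) F (ncells N) <= expR (s * mesh N) * B s.
  have dl0 := @mesh_gt0 R N.
  apply: (le_trans (grid_sum_shift _ _ s0 dl0 FG)).
  rewrite ler_wpM2l ?expR_ge0//.
  apply: (@ler_cvg_to _ _ PU _ _ _ _ _ (sumG _ _ _ dl0) (cvBU s s0)).
  apply: filterE => n; rewrite -lee_fin -(nuB n s s0).
  exact: grid_sum_le_laplace.
(* Fatou's lemma for the step functions. *)
have upper : (laplace nuF s <= (B s)%:E)%E.
  have gcv x : (grid_fun s (mesh N) (- halfwidth N) (ncells N) x) @[N --> \oo] --> expR (- (s * x)).
    apply: (@squeeze_cvgr _ _ _ _ (fun N => expR (- (s * x)) * expR ((- s) * mesh N) - expR (- (s * halfwidth N)))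
       (cst (expR (- (s * x))))).
    - near=> N; have dl0 := @mesh_gt0 R N.
      rewrite grid_fun_le// andbT lerBlDr.
      have := @grid_fun_ge _ s (mesh N) (- halfwidth N) s0 dl0 (ncells N) x.
      rewrite grid_pt_end -expRD (_ : - (s * x) + - s * mesh N = - (s * (x + mesh N))); last by ring.
      apply.
      suff : `|x| <= halfwidth N by rewrite ler_norml => /andP[]; lra.
      rewrite (@le_trans _ _ N%:R)//; last by rewrite ler_nat.
      by near: N; exact: nbhs_infty_ger.
    - rewrite -[X in _ --> X]subr0; apply: cvgB; last exact: cvg_exp_halfwidth.
      rewrite -[X in _ --> X]mulr1; apply: cvgM; first exact: cvg_cst.
      exact: cvg_exp_mesh.
    - exact: cvg_cst.
  have -> : laplace nuF s = (\int[nuF]_x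
      limn_einf (fun N => (grid_fun s (mesh N) (- halfwidth N) (ncells N) x)%:E))%E.
    apply: eq_integral => x _.
    have : (grid_fun s (mesh N) (- halfwidth N) (ncells N) x)%:E @[N --> \oo] --> (expR (- (s * x)))%:E.
      by apply/fine_cvgP; split; [near=> n|exact: gcv].
    by move=> /cvg_limn_einf_sup[-> _].
  apply: (le_trans (fatou _ _ _ _)) => //.
  - by move=> N; apply/measurable_EFinP; apply: measurable_grid_fun.
  - by move=> N x _; rewrite lee_fin grid_fun_ge0// mesh_gt0.
  under eq_fun => N do rewrite (integral_grid_fun _ s0 (@mesh_gt0 R N) _ nuFE).
  have c1 : (expR (s * mesh N) * B s)%:E @[N --> \oo] --> (B s)%:E.
    apply/fine_cvgP; split; first by near=> n.
    rewrite /comp/= -[X in _ --> X]mul1r; apply: cvgM; last exact: cvg_cst.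
    exact: cvg_exp_mesh.
  have [<- _] := cvg_limn_einf_sup c1.
  rewrite !limn_einf_lim; apply: lee_lim; do ?exact: is_cvg_einfs.
  near=> n; apply: le_ereal_inf_tmp => _ [k nk <-].
  apply: (@le_trans _ _ (grid_sum s (mesh k) (- halfwidth k) F (ncells k))%:E); last by rewrite lee_fin.
  by apply: ereal_inf_lbound; exists k.
have [l lE] : exists l, laplace nuF s = l%:E.
  by case: (laplace nuF s) (laplace_ge0 nuF s) upper => [l||]//; exists l.
rewrite lE; congr EFin; apply/eqP; rewrite eq_le; apply/andP; split.
  by move: upper; rewrite lE lee_fin.
(* Conversely the transforms of the approximating measures are bounded by grid
   sums up to the tails. *)
have e0 : 0 < s / 2 by rewrite divr_gt0.
have es : s / 2 < s by lra.
have s1 : 0 < s - s / 2 by lra.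
have s2 : 0 < s + s / 2 by lra.
have c3 : expR (s * mesh N) * (l + expR (- ((s / 2) * halfwidth N)) * (B (s - s / 2) + B (s + s / 2)))
    @[N --> \oo] --> l.
  rewrite -[X in _ --> X]mul1r; apply: cvgM; first exact: cvg_exp_mesh.
  rewrite -[X in _ --> X]addr0; apply: cvgD; first exact: cvg_cst.
  rewrite -[X in _ --> X](mul0r (B (s - s / 2) + B (s + s / 2))).
  by apply: cvgM; [exact: cvg_exp_halfwidth|exact: cvg_cst].
apply: (@ler_cvg_to _ _ _ _ _ _ _ _ (cvg_cst (B s)) c3).
near=> N.
have dl0 := @mesh_gt0 R N.
have c4 : expR (s * mesh N) * (grid_sum s (mesh N) (- halfwidth N) (H n) (ncells N) +
     expR (- (s / 2 * halfwidth N)) * (B_ n (s - s / 2) + B_ n (s + s / 2))) @[n --> U] -->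
   expR (s * mesh N) * (grid_sum s (mesh N) (- halfwidth N) G (ncells N) +
     expR (- (s / 2 * halfwidth N)) * (B (s - s / 2) + B (s + s / 2))).
  apply: cvgM; first exact: cvg_cst.
  apply: cvgD; first exact: sumG.
  apply: cvgM; first exact: cvg_cst.
  by apply: cvgD; exact: cvBU.
have h5 := @ler_cvg_to _ _ PU _ _ _ _ _ (cvBU s s0) c4.
apply: (le_trans (h5 _)).
  apply: filterE => n.
  by apply: (laplace_le_grid N e0 es (HE n)); exact: nuB.
rewrite ler_wpM2l ?expR_ge0// lerD2r.
rewrite -lee_fin -lE; apply: le_trans (grid_sum_le_laplace _ s0 dl0 (ncells N) nuFE).
rewrite lee_fin; apply: ler_sum => i _.
by apply: ler_wpM2l; [exact: grid_wt_ge0|exact: GF].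
Unshelve. all: by end_near. Qed.

End limit.

(** * Derivatives and Riemann sums *)

Section derivatives.
Context {R : realType}.
Implicit Types (f g : R -> R) (x a b : R).

(** A copy of [is_derive] that is not a type class: the rules below are then
    applied one by one, instead of being found by instance resolution. *)
Definition deriv1 f x a : Prop := is_derive x 1 f a.

Lemma dercst c x : deriv1 (fun _ : R => c : R) x 0.
Proof. exact: is_derive_cst. Qed.

Lemma derid x : deriv1 (fun y : R => y) x 1.
Proof. exact: is_derive_id. Qed.

Lemma derD f g x a b : deriv1 f x a -> deriv1 g x b ->
  deriv1 (fun y => f y + g y) x (a + b).
Proof. by move=> fa gb; exact: is_deriveD. Qed.

Lemma derN f x a : deriv1 f x a -> deriv1 (fun y => - f y) x (- a).
Proof. by move=> fa; exact: is_deriveN. Qed.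

Lemma derM f g x a b : deriv1 f x a -> deriv1 g x b ->
  deriv1 (fun y => f y * g y) x (f x * b + g x * a).
Proof. by move=> fa gb; exact: is_deriveM. Qed.

Lemma derV f x a : f x != 0 -> deriv1 f x a ->
  deriv1 (fun y => (f y)^-1) x (- (f x) ^- 2 * a).
Proof. by move=> f0 fa; exact: is_deriveV. Qed.

Lemma derX f n x a : deriv1 f x a ->
  deriv1 (fun y => f y ^+ n) x (n%:R * f x ^+ n.-1 * a).
Proof.
by move=> fa; have := @is_deriveX _ _ f n x 1 a fa; rewrite exprfctE.
Qed.

Lemma dercomp (h : R -> R) f x a b : deriv1 h (f x) b -> deriv1 f x a ->
  deriv1 (fun y => h (f y)) x (b * a).
Proof. exact: is_derive1_comp. Qed.

Lemma derexp f x a : deriv1 f x a ->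
  deriv1 (fun y => expR (f y)) x (expR (f x) * a).
Proof. by apply: dercomp; exact: is_derive_expR. Qed.

Lemma derln f x a : 0 < f x -> deriv1 f x a ->
  deriv1 (fun y => ln (f y)) x ((f x)^-1 * a).
Proof. by move=> f0; apply: dercomp; exact: is_derive1_ln. Qed.

Lemma deratan f x a : deriv1 f x a ->
  deriv1 (fun y => atan (f y)) x ((1 + f x ^+ 2)^-1 * a).
Proof. by apply: dercomp; exact: is_derive1_atan. Qed.

Lemma dersin f x a : deriv1 f x a ->
  deriv1 (fun y => sin (f y)) x (cos (f x) * a).
Proof. by apply: dercomp; exact: is_derive_sin. Qed.

Lemma dercos f x a : deriv1 f x a ->
  deriv1 (fun y => cos (f y)) x (- sin (f x) * a).
Proof. by apply: dercomp; exact: is_derive_cos. Qed.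

Lemma dereq f x a b : deriv1 f x a -> a = b -> is_derive x 1 f b.
Proof. by move=> + <-. Qed.

Lemma der_continuous f x a : deriv1 f x a -> {for x, continuous f}.
Proof. by move=> [/derivable1_diffP/differentiable_continuous]. Qed.

End derivatives.

Ltac der := repeat first
  [ apply: dercst | apply: derid | apply: derD | apply: derN | apply: derM
  | apply: derV | apply: derX | apply: derexp | apply: derln | apply: deratan
  | apply: dersin | apply: dercos ].

Section riemann.
Context {R : realType}.
Variables (P p : R -> R) (a b : R).
Hypothesis ab : a < b.
Hypothesis Pp : forall u, a <= u <= b -> is_derive u 1 P (p u).

Definition riem_sum (n : nat) : R :=
  \sum_(i < n.+1) (b - a) / n.+1%:R * p (a + (b - a) / n.+1%:R * i%:R).

(** On each cell the mean value theorem places the increment of [P] between the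
    values of [p] at the two ends. *)
Lemma riem_sum_bound n :
  (forall u v, a <= u -> u <= v -> v <= b -> p u <= p v) ->
  riem_sum n <= P b - P a <= riem_sum n + (b - a) / n.+1%:R * (p b - p a).
Proof.
move=> ndp.
set h := (b - a) / n.+1%:R.
have h0 : 0 < h by rewrite divr_gt0 ?subr_gt0.
pose x i : R := a + h * i%:R.
have xS i : x i.+1 = x i + h by rewrite /x -natr1; ring.
have x0 : x 0%N = a by rewrite /x mulr0 addr0.
have xn : x n.+1 = b by rewrite /x /h divfK ?pnatr_eq0//; ring.
have xab i : (i <= n.+1)%N -> a <= x i <= b.
  move=> ni; rewrite -xn /x lerDl mulr_ge0 ?(ltW h0)//=.
  by rewrite lerD2l ler_pM2l// ler_nat.
have cell i : (i < n.+1)%N -> h * p (x i) <= P (x i.+1) - P (x i) <= h * p (x i.+1).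
  move=> ni.
  have /andP[ai _] := xab i (ltnW ni); have /andP[_ ib] := xab i.+1 ni.
  have xx : x i < x i.+1 by rewrite xS ltrDl.
  have der u : u \in `](x i), (x i.+1)[ -> is_derive u 1 P (p u).
    rewrite in_itv/= => /andP[u1 u2]; apply: Pp.
    by rewrite (le_trans ai (ltW u1)) (le_trans (ltW u2) ib).
  have cP : {within `[(x i), (x i.+1)], continuous P}.
    apply: continuous_in_subspaceT => u; rewrite inE/= in_itv/= => /andP[u1 u2].
    by apply: der_continuous; apply: Pp; rewrite (le_trans ai u1) (le_trans u2 ib).
  have [c] := MVT xx der cP.
  rewrite in_itv/= => /andP[c1 c2] ->.
  have -> : x i.+1 - x i = h by rewrite xS; ring.
  rewrite [p c * h]mulrC !ler_pM2l//.
  rewrite ndp ?(ltW c1) ?(le_trans (ltW c2) ib)//=.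
  by rewrite ndp ?(ltW c2) ?(le_trans ai (ltW c1)).
have tel : P b - P a = \sum_(i < n.+1) (P (x i.+1) - P (x i)).
  by rewrite -x0 -xn -(big_mkord xpredT (fun i => P (x i.+1) - P (x i))) telescope_sumr.
have telp : p b - p a = \sum_(i < n.+1) (p (x i.+1) - p (x i)).
  by rewrite -x0 -xn -(big_mkord xpredT (fun i => p (x i.+1) - p (x i))) telescope_sumr.
apply/andP; split.
  by rewrite tel; apply: ler_sum => i _; have /andP[] := cell i (ltn_ord i).
rewrite tel telp mulr_sumr -big_split/=; apply: ler_sum => i _.
have /andP[_ +] := cell i (ltn_ord i).
by rewrite -/h -/(x i); lra.
Qed.

Lemma cvg_riem_sum_nd :
  (forall u v, a <= u -> u <= v -> v <= b -> p u <= p v) ->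
  riem_sum n @[n --> \oo] --> P b - P a.
Proof.
move=> ndp.
apply: (@squeeze_cvgr _ _ _ _ (fun n => P b - P a - (b - a) * mesh n * (p b - p a))
  (cst (P b - P a))).
- near=> n; have /andP[h1 h2] := riem_sum_bound n ndp.
  by rewrite lerBlDr h2 h1.
- rewrite -[X in _ --> X]subr0; apply: cvgB; first exact: cvg_cst.
  rewrite -[X in _ --> X](mul0r (p b - p a)); apply: cvgM; last exact: cvg_cst.
  rewrite -[X in _ --> X](mulr0 (b - a)); apply: cvgM; first exact: cvg_cst.
  exact: cvg_mesh.
- exact: cvg_cst.
Unshelve. all: by end_near. Qed.

End riemann.

Section riemann2.
Context {R : realType}.

Lemma cvg_riem_sum (P p : R -> R) (a b : R) : a < b ->
  (forall u, a <= u <= b -> is_derive u 1 P (p u)) ->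
  (forall u v, a <= u -> u <= v -> v <= b -> p u <= p v) \/
  (forall u v, a <= u -> u <= v -> v <= b -> p v <= p u) ->
  riem_sum p a b n @[n --> \oo] --> P b - P a.
Proof.
move=> ab Pp [ndp|nip]; first exact: cvg_riem_sum_nd.
have h : riem_sum (fun u => - p u) a b n @[n --> \oo] --> - P b - - P a.
  apply: (@cvg_riem_sum_nd _ (fun u => - P u)) => //.
    by move=> u /Pp; exact: derN.
  by move=> u v au uv vb; rewrite lerN2 nip.
have -> : P b - P a = - (- P b - - P a) by ring.
have -> : riem_sum p a b = fun n => - riem_sum (fun u => - p u) a b n.
  apply/funext => n; rewrite /riem_sum -sumrN; apply: eq_bigr => i _; ring.
exact: cvgN.
Qed.

End riemann2.

(** * Laplace transforms on the half-line and infinitely divisible exponents *)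

Section isLap_theory.
Context {R : realType}.
Implicit Types (B C K : R -> R).

Lemma isLap_ext B C : (forall s, 0 < s -> B s = C s) -> isLap B -> isLap C.
Proof. by move=> BC [nu h]; exists nu => s s0; rewrite -BC// h. Qed.

Lemma isLapM B C : isLap B -> isLap C -> isLap (fun s => B s * C s).
Proof.
move=> [mu hB] [nu hC].
have [|| rho h] := @laplace_convolution _ mu nu.
- by exists 1; rewrite hB// ltry.
- by exists 1; rewrite hC// ltry.
by exists rho => s s0; rewrite h hB// hC// EFinM.
Qed.

Lemma isLapD B C : isLap B -> isLap C -> isLap (fun s => B s + C s).
Proof.
move=> [mu hB] [nu hC]; have [rho h] := laplace_add mu nu.
by exists rho => s s0; rewrite h hB// hC// EFinD.
Qed.

Lemma isLap_tilt B (c u : R) : 0 <= c -> 0 <= u -> isLap B -> isLap (fun s => c * B (s + u)).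
Proof.
move=> c0 u0 [mu h]; have [nu [_ [_ hn]]] := laplace_tilt mu u c0.
by exists nu => s s0; rewrite hn h ?EFinM// ltr_wpDr.
Qed.

Lemma isLapZ B (c : R) : 0 <= c -> isLap B -> isLap (fun s => c * B s).
Proof.
move=> c0 /(isLap_tilt c0 (lexx 0)); apply: isLap_ext => s _; by rewrite addr0.
Qed.

Lemma isLap_expZ (a b : R) : isLap (fun s => expR (a * s + b)).
Proof.
have [nu h] := laplace_dirac (- a).
have : isLap (fun s : R => expR (a * s)).
  by exists nu => s _; rewrite h mulrN opprK mulrC.
move=> /(isLapZ (expR_ge0 b)); apply: isLap_ext => s _.
by rewrite -expRD addrC.
Qed.

Lemma isLap1 : isLap (fun=> 1 : R).
Proof.
by apply: isLap_ext (isLap_expZ 0 0) => s _; rewrite mul0r addr0 expR0.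
Qed.

Lemma isLap0 : isLap (fun=> 0 : R).
Proof. by apply: isLap_ext (isLapZ (lexx 0) isLap1) => s _; rewrite mul0r. Qed.

Lemma isLapX B n : isLap B -> isLap (fun s => B s ^+ n).
Proof.
move=> hB; elim: n => [|n IH]; first by apply: isLap_ext isLap1 => s _; rewrite expr0.
by apply: isLap_ext (isLapM hB IH) => s _; rewrite exprS.
Qed.

Lemma isLap_sum n (F : nat -> R -> R) : (forall i, (i < n)%N -> isLap (F i)) ->
  isLap (fun s => \sum_(i < n) F i s).
Proof.
elim: n => [|n IH] h; first by apply: isLap_ext isLap0 => s _; rewrite big_ord0.
apply: isLap_ext (isLapD (IH _) (h n (ltnSn n))) => [s _|i ni].
  by rewrite big_ord_recr.
by apply: h; rewrite ltnW.
Qed.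

(** The exponential series is a limit of polynomials with nonnegative coefficients. *)
Lemma isLap_expR K : isLap K -> isLap (fun s => expR (K s)).
Proof.
move=> hK; apply: (@isLap_limit _ (fun n s => series (exp_coeff (K s)) n)).
  move=> n; rewrite /series/=.
  apply: isLap_ext (@isLap_sum n (fun i s => i`!%:R^-1 * K s ^+ i) _) => [s _|i _].
    by rewrite big_mkord; apply: eq_bigr => i _; rewrite /exp_coeff/= mulrC.
  by apply: isLapZ; [rewrite invr_ge0|exact: isLapX].
by move=> s s0; exact: is_cvg_series_exp_coeff.
Qed.

(** Exponents of infinitely divisible Laplace transforms; unlike Laplace transforms
    they may be negative, and they form a cone stable under addition. *)
Definition isID K := forall t, 0 <= t -> isLap (fun s => expR (t * K s)).

Lemma isID_ext K L : (forall s, 0 < s -> K s = L s) -> isID K -> isID L.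
Proof. by move=> KL h t t0; apply: isLap_ext (h t t0) => s s0; rewrite KL. Qed.

Lemma isID_Lap K : isLap K -> isID K.
Proof. by move=> hK t t0; apply: isLap_expR; exact: isLapZ. Qed.

Lemma isIDD K L : isID K -> isID L -> isID (fun s => K s + L s).
Proof.
move=> hK hL t t0; apply: isLap_ext (isLapM (hK t t0) (hL t t0)) => s _.
by rewrite -expRD mulrDr.
Qed.

Lemma isIDZ K c : 0 <= c -> isID K -> isID (fun s => c * K s).
Proof.
move=> c0 hK t t0; apply: isLap_ext (hK (t * c) (mulr_ge0 t0 c0)) => s _.
by rewrite mulrA.
Qed.

Lemma isID_affine a b : isID (fun s => a * s + b).
Proof.
move=> t t0; apply: isLap_ext (isLap_expZ (t * a) (t * b)) => s _.
by congr expR; ring.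
Qed.

Lemma isID_tilt K u : 0 <= u -> isID K -> isID (fun s => K (s + u)).
Proof.
move=> u0 hK t t0; apply: isLap_ext (isLap_tilt ler01 u0 (hK t t0)) => s _.
by rewrite mul1r.
Qed.

Lemma isID_limit (K_ : nat -> R -> R) K : (forall n, isID (K_ n)) ->
  (forall s, 0 < s -> K_ n s @[n --> \oo] --> K s) -> isID K.
Proof.
move=> hK cK t t0; apply: isLap_limit (fun n => hK n t t0) _ => s s0.
apply: continuous_cvg; first exact: continuous_expR.
by apply: cvgM; [exact: cvg_cst|exact: cK].
Qed.

Lemma isID_sum n (F : nat -> R -> R) : (forall i, (i < n)%N -> isID (F i)) ->
  isID (fun s => \sum_(i < n) F i s).
Proof.
elim: n => [|n IH] h.
  by apply: isID_ext (isID_affine 0 0) => s _; rewrite big_ord0 mul0r addr0.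
apply: isID_ext (isIDD (IH _) (h n (ltnSn n))) => [s _|i ni].
  by rewrite big_ord_recr.
by apply: h; rewrite ltnW.
Qed.

(** Integrals over a parameter are limits of Riemann sums. [P ^~ s] is a given
    antiderivative in the parameter, which keeps the conclusion free of integrals. *)
Lemma isID_integral (P p : R -> R -> R) (a b : R) : a < b ->
  (forall u, a <= u <= b -> isID (p u)) ->
  (forall s u, 0 < s -> a <= u <= b -> is_derive u 1 (P ^~ s) (p u s)) ->
  (forall s, 0 < s ->
    (forall u v, a <= u -> u <= v -> v <= b -> p u s <= p v s) \/
    (forall u v, a <= u -> u <= v -> v <= b -> p v s <= p u s)) ->
  isID (fun s => P b s - P a s).
Proof.
move=> ab hp dP mono.
apply: (@isID_limit (fun n s => riem_sum (p ^~ s) a b n)); last first.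
  move=> s s0; apply: (@cvg_riem_sum _ (P ^~ s)) => //; last exact: mono.
  by move=> u; exact: dP.
move=> n; rewrite /riem_sum.
apply: (@isID_sum n.+1 (fun i s => (b - a) / n.+1%:R * p (a + (b - a) / n.+1%:R * i%:R) s)) => i ni.
have h0 : 0 <= (b - a) / n.+1%:R by rewrite divr_ge0 ?subr_ge0 ?ltW.
apply: isIDZ => //; apply: hp.
rewrite lerDl mulr_ge0//= -lerBrDl.
rewrite -[leRHS](@divfK _ n.+1%:R) ?pnatr_eq0// ler_wpM2l// ler_nat.
exact: ltnW.
Qed.

End isLap_theory.

(** * Moments, means and variances *)

Section moments.
Context {R : realType}.
Implicit Types mu nu : {measure set (measurableTypeR R) -> \bar R}.

Lemma laplace_fin_between mu (a t b : R) : a <= t -> t <= b ->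
  (laplace mu a < +oo)%E -> (laplace mu b < +oo)%E -> (laplace mu t < +oo)%E.
Proof.
move=> at_ tb fa fb.
apply: (@le_lt_trans _ _ (laplace mu a + laplace mu b)%E); last first.
  by rewrite lte_add_pinfty.
rewrite /laplace -ge0_integralD//; [|exact: measurable_EexpN..].
apply: ge0_le_integral => //.
- exact: measurable_EexpN.
- by apply: emeasurable_funD; exact: measurable_EexpN.
move=> x _; rewrite -EFinD lee_fin.
have [x0|x0] := leP 0 x.
  apply: (@le_trans _ _ (expR (- (a * x)))); last by rewrite lerDl expR_ge0.
  by rewrite ler_expR lerN2 ler_wpM2r.
apply: (@le_trans _ _ (expR (- (b * x)))); last by rewrite lerDr expR_ge0.
by rewrite ler_expR lerN2 ler_wnM2r// ltW.
Qed.

Lemma lapdomP mu (s : R) : lapdom mu s <->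
  exists2 e, 0 < e & (laplace mu (s - e) < +oo)%E /\ (laplace mu (s + e) < +oo)%E.
Proof.
split.
  rewrite /lapdom /interior => /nbhs_ballP[e /= e0 sub].
  exists (e / 2); first by rewrite divr_gt0.
  have e2 : e / 2 < e by rewrite ltr_pdivrMr// ltr_pMr// ltr1n.
  have e20 : 0 < e / 2 by rewrite divr_gt0.
  split; apply: sub; rewrite /ball/=.
    by rewrite (_ : s - (s - e / 2) = e / 2) ?gtr0_norm//; ring.
  by rewrite (_ : s - (s + e / 2) = - (e / 2)) ?normrN ?gtr0_norm//; ring.
move=> [e e0 [f1 f2]].
apply/nbhs_ballP; exists e => //= t; rewrite /ball/= => st.
have := ltW st; rewrite ler_norml => /andP[h1 h2].
apply: laplace_fin_between f1 f2; lra.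
Qed.

Lemma lapdom_between mu (a t b : R) : a <= t -> t <= b ->
  lapdom mu a -> lapdom mu b -> lapdom mu t.
Proof.
move=> at_ tb /lapdomP[e e0 [a1 a2]] /lapdomP[e' e'0 [b1 b2]]; apply/lapdomP.
exists (Num.min e e'); first by rewrite lt_min e0.
have h1 : Num.min e e' <= e by rewrite ge_min lexx.
have h2 : Num.min e e' <= e' by rewrite ge_min lexx orbT.
have h3 : 0 < Num.min e e' by rewrite lt_min e0.
split; apply: laplace_fin_between a1 b2; lra.
Qed.

Lemma open_lapdom mu : open (lapdom mu).
Proof. exact: open_interior. Qed.

Definition momfun (k : nat) (s x : R) : R := x ^+ k * expR (- (s * x)).
Definition mom mu (k : nat) (s : R) : R := \int[mu]_x momfun k s x.

Lemma measurable_momfun k s :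
  measurable_fun [set: measurableTypeR R] (momfun k s : measurableTypeR R -> R).
Proof.
apply: measurable_funM; last exact: measurable_expN.
exact: measurable_funX.
Qed.

(** One term of the exponential series. *)
Lemma norm_pow_le_exp (e x : R) (k : nat) : 0 < e ->
  `|x| ^+ k <= k`!%:R / e ^+ k * expR (e * `|x|).
Proof.
move=> e0; rewrite -[leLHS]mulr1.
have ek0 : 0 < e ^+ k by rewrite exprn_gt0.
have f0 : 0 < k`!%:R :> R by rewrite ltr0n fact_gt0.
rewrite mulrAC ler_pdivlMr// mulr1 mulrC -exprMn -ler_pdivrMl//.
have ex0 : 0 <= e * `|x| by rewrite mulr_ge0 ?(ltW e0).
case: k ek0 f0 => [|k] ek0 f0.
  by rewrite expr0 mulr1 fact0 invr1 -expR0 ler_expR.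
rewrite mulrC; apply: le_trans (expR_ge1Dxn k ex0).
by rewrite lerDr.
Qed.

Definition momdom (k : nat) (s e x : R) : R :=
  k`!%:R / e ^+ k * (expR (- ((s - 2 * e) * x)) + expR (- ((s + 2 * e) * x))).

(** A bound of the k-th moment integrand that is uniform for |t - s| <= e; it allows
    differentiation under the integral sign. *)
Lemma momfun_dom (k : nat) (s t e x : R) : 0 < e -> `|t - s| <= e ->
  `|momfun k t x| <= momdom k s e x.
Proof.
move=> e0 ts; rewrite /momfun normrM normrX (ger0_norm (expR_ge0 _)).
have c0 : 0 <= k`!%:R / e ^+ k by rewrite divr_ge0// exprn_ge0// ltW.
apply: le_trans (ler_wpM2r (expR_ge0 _) (norm_pow_le_exp x k e0)) _.
rewrite /momdom -[leLHS]mulrA ler_wpM2l// -expRD.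
have h : `|(t - s) * x| <= e * `|x| by rewrite normrM ler_wpM2r.
have := ler_norm (- ((t - s) * x)); rewrite normrN => h2.
have [x0|x0] := leP 0 x.
  rewrite (ger0_norm x0) in h *.
  apply: (@le_trans _ _ (expR (- ((s - 2 * e) * x)))); last by rewrite lerDl expR_ge0.
  by rewrite ler_expR; lra.
rewrite (ltr0_norm x0) in h *.
apply: (@le_trans _ _ (expR (- ((s + 2 * e) * x)))); last by rewrite lerDr expR_ge0.
by rewrite ler_expR; lra.
Qed.

Lemma momdom_ge0 k s e x : 0 < e -> 0 <= momdom k s e x.
Proof.
by move=> e0; rewrite mulr_ge0 ?addr_ge0 ?expR_ge0// divr_ge0// exprn_ge0// ltW.
Qed.

Lemma integrable_momdom mu k s e : 0 < e ->
  (laplace mu (s - 2 * e) < +oo)%E -> (laplace mu (s + 2 * e) < +oo)%E ->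
  mu.-integrable [set: measurableTypeR R] (EFin \o momdom k s e).
Proof.
move=> e0 f1 f2.
have ie t : (laplace mu t < +oo)%E ->
    mu.-integrable [set: measurableTypeR R] (fun x => (expR (- (t * x)))%:E).
  move=> ft; apply/integrableP; split; first exact: measurable_EexpN.
  by under eq_integral => x _ do rewrite /= ger0_norm ?expR_ge0//.
rewrite (_ : _ \o _ = (fun x => (k`!%:R / e ^+ k)%:E *
   ((expR (- ((s - 2 * e) * x)))%:E + (expR (- ((s + 2 * e) * x)))%:E)))%E//.
apply: integrableZl => //; apply: integrableD => //; exact: ie.
Qed.

Lemma lapdom_eps mu s : lapdom mu s -> exists2 e, 0 < e &
  (laplace mu (s - 2 * e) < +oo)%E /\ (laplace mu (s + 2 * e) < +oo)%E.
Proof.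
move=> /lapdomP[e e0 h]; exists (e / 2); first by rewrite divr_gt0.
by rewrite mulrC divfK.
Qed.

Lemma integrable_momfun mu k s : lapdom mu s ->
  mu.-integrable [set: measurableTypeR R] (EFin \o momfun k s).
Proof.
move=> /lapdom_eps[e e0 [f1 f2]].
apply: le_integrable (integrable_momdom k e0 f1 f2) => //.
  by apply/measurable_EFinP; exact: measurable_momfun.
move=> x _ /=; rewrite lee_fin (ger0_norm (momdom_ge0 _ _ _ e0)).
by apply: momfun_dom => //; rewrite subrr normr0 ltW.
Qed.

Lemma momfun_der k (t x : R) : is_derive t 1 (fun u => momfun k u x) (- momfun k.+1 t x).
Proof.
rewrite /momfun; apply: dereq; first by der.
by rewrite exprS; ring.
Qed.

Lemma der_mom mu k (s : R) : lapdom mu s -> is_derive s 1 (mom mu k) (- mom mu k.+1 s).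
Proof.
move=> Ds; have [e e0 [f1 f2]] := lapdom_eps Ds.
have Is : `]s - e, s + e[%classic s by rewrite /= in_itv/=; apply/andP; split; lra.
have domI t : `]s - e, s + e[%classic t -> `|t - s| <= e.
  by rewrite /= in_itv/= => /andP[h1 h2]; rewrite ler_norml; apply/andP; split; lra.
have intf t : `]s - e, s + e[%classic t ->
    mu.-integrable [set: measurableTypeR R] (EFin \o momfun k t).
  move=> ts; apply: le_integrable (integrable_momdom k e0 f1 f2) => //.
    by apply/measurable_EFinP; exact: measurable_momfun.
  move=> x _ /=; rewrite lee_fin (ger0_norm (momdom_ge0 _ _ _ e0)).
  exact: momfun_dom (domI _ ts).
have derf t (y : measurableTypeR R) : `]s - e, s + e[%classic t ->
    [set: measurableTypeR R] y -> derivable (fun u => momfun k u y) t 1.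
  by move=> _ _; have [] := momfun_der k t y.
have d1E t (y : measurableTypeR R) : partial1of2 (momfun k) t y = - momfun k.+1 t y.
  by rewrite partial1of2E; have [_ ->] := momfun_der k t y.
have G0 (y : measurableTypeR R) : 0 <= momdom k.+1 s e y by exact: momdom_ge0.
have Gub t (y : measurableTypeR R) : `]s - e, s + e[%classic t ->
   [set: measurableTypeR R] y -> `|partial1of2 (momfun k) t y| <= momdom k.+1 s e y.
  by move=> ts _; rewrite d1E normrN; exact: momfun_dom (domI _ ts).
have intG := integrable_momdom k.+1 e0 f1 f2.
apply: DeriveDef.
  exact: (derivable_under_integral measurableT Is intf derf G0 intG Gub).
rewrite -derive1E.
rewrite (differentiation_under_integral measurableT Is intf derf G0 intG Gub).
under eq_Rintegral => y _ do rewrite d1E -mulN1r.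
by rewrite RintegralZl ?mulN1r//; exact: integrable_momfun.
Qed.

Lemma laplace_mom mu s : lapdom mu s -> laplace mu s = (mom mu 0 s)%:E.
Proof.
move=> Ds; rewrite /mom /Rintegral fineK; last first.
  exact: integrable_fin_num (integrable_momfun 0 Ds).
by apply: eq_integral => x _; rewrite /momfun expr0 mul1r.
Qed.

Lemma ellE mu s : lapdom mu s -> ell mu s = ln (mom mu 0 s).
Proof. by move=> Ds; rewrite /ell laplace_mom. Qed.

(** The exponential is positive, so a tilt has the same null sets. *)
Lemma laplace_eq0 mu (A : set R) (s : R) : measurable (A : set (measurableTypeR R)) ->
  (\int[mu]_(x in A) (expR (- (s * x)))%:E = 0)%E -> mu A = 0%E.
Proof.
move=> mA h.
have m1 : measurable_fun (A : set (measurableTypeR R)) (fun x => (expR (- (s * x)))%:E).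
  by apply/measurable_funTS; exact: measurable_EexpN.
have : (\int[mu]_(x in A) `|(expR (- (s * x)))%:E| = 0)%E.
  by rewrite -h; apply: eq_integral => x _; rewrite gee0_abs// lee_fin expR_ge0.
move/(ae_eq_integral_abs mu mA m1) => [N [mN muN sub]].
apply/eqP; rewrite eq_le measure_ge0 andbT -muN le_measure ?inE//.
move=> x Ax; apply: sub => /=; move/(_ Ax)/eqP.
by rewrite eqe gt_eqF// expR_gt0.
Qed.

Variable mu : {measure set (measurableTypeR R) -> \bar R}.

(** Integrals of polynomials against a tilt, given by their coefficients. *)
Lemma mom_sum s n (c : nat -> R) : lapdom mu s ->
  mu.-integrable [set: measurableTypeR R]
    (EFin \o (fun x => \sum_(i < n) c i * momfun i s x)) /\
  \int[mu]_x (\sum_(i < n) c i * momfun i s x) = \sum_(i < n) c i * mom mu i s.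
Proof.
move=> Ds; elim: n => [|n [IHi IHe]].
  have -> : (fun x : R => \sum_(i < 0) c i * momfun i s x) = cst 0.
    by apply/funext => x; rewrite big_ord0.
  split; first exact: integrable0.
  by rewrite big_ord0 /Rintegral integral0.
pose g x := c n * momfun n s x.
have ig : mu.-integrable [set: measurableTypeR R] (EFin \o g).
  have -> : EFin \o g = (fun x => (c n)%:E * (EFin \o momfun n s) x)%E by [].
  by apply: integrableZl => //; exact: integrable_momfun.
have E : (fun x : R => \sum_(i < n.+1) c i * momfun i s x) =
    (fun x => \sum_(i < n) c i * momfun i s x + g x).
  by apply/funext => x; rewrite big_ord_recr.
rewrite E; split.
  rewrite (_ : EFin \o _ = (EFin \o (fun x : R => (\sum_(i < n) c i * momfun i s x)%R)) \+ (EFin \o g))%E//.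
  exact: integrableD.
rewrite RintegralD// IHe big_ord_recr/=; congr (_ + _).
by rewrite RintegralZl//; exact: integrable_momfun.
Qed.

Lemma ae_zero_of_integral (f : R -> R) :
  mu.-integrable [set: measurableTypeR R] (EFin \o f) ->
  (forall x, 0 <= f x) -> \int[mu]_x f x = 0 ->
  {ae mu, forall x : measurableTypeR R, f x = 0}.
Proof.
move=> intf f0 h.
have mf : measurable_fun [set: measurableTypeR R] (fun x : measurableTypeR R => (f x)%:E).
  exact: (measurable_int mu intf).
have : (\int[mu]_x `|(f x)%:E| = 0)%E.
  have -> : (\int[mu]_x `|(f x)%:E| = \int[mu]_x (f x)%:E)%E.
    by apply: eq_integral => x _; rewrite gee0_abs// lee_fin.
  rewrite -[LHS]fineK; first by rewrite -/(Rintegral mu setT f) h.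
  exact: (integrable_fin_num measurableT intf).
move/(ae_eq_integral_abs mu measurableT mf).
by apply: filterS => x /(_ Logic.I)[].
Qed.

Hypothesis muM : forall a : R, mu (~` [set a]) != 0%E.

Lemma mom0_gt0 s : lapdom mu s -> 0 < mom mu 0 s.
Proof.
move=> Ds; rewrite lt_neqAle -!lee_fin -!laplace_mom// laplace_ge0 andbT.
rewrite eq_sym -eqe -laplace_mom//.
apply/eqP => /(laplace_eq0 measurableT) mu0.
have /eqP := muM 0; apply; apply/eqP.
rewrite eq_le measure_ge0 andbT -mu0 le_measure ?inE//.
by apply: measurableC.
Qed.

Definition mvar s : R := mom mu 2 s / mom mu 0 s - (mom mu 1 s / mom mu 0 s) ^+ 2.

(** The variance is the integral of (x - m)^2 against the normalised tilt; if it
    vanished, the measure would be concentrated on the point m. *)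
Lemma mvar_gt0 s : lapdom mu s -> 0 < mvar s.
Proof.
move=> Ds; have m0 := mom0_gt0 Ds.
set m := mom mu 1 s / mom mu 0 s.
pose q x : R := (x - m) ^+ 2 * expR (- (s * x)).
pose c : nat -> R := nth 0 [:: m ^+ 2; - 2 * m; 1].
have [iq qI] := mom_sum 3 c Ds.
have qE : (fun x => \sum_(i < 3) c i * momfun i s x) = q.
  by apply/funext => x; rewrite !big_ord_recr big_ord0/= /c/= /q /momfun; ring.
rewrite qE in iq qI.
have {}qI : \int[mu]_x q x = mom mu 0 s * mvar s.
  rewrite qI !big_ord_recr big_ord0/= /c/= /mvar -/m /m.
  by field; rewrite gt_eqF.
have q0 x : 0 <= q x by rewrite mulr_ge0 ?sqr_ge0 ?expR_ge0.
rewrite -(pmulr_rgt0 _ m0) -qI lt_neqAle Rintegral_ge0// andbT eq_sym.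
apply/eqP => /(ae_zero_of_integral iq q0)[N [mN muN sub]].
have /eqP := muM m; apply; apply/eqP.
rewrite eq_le measure_ge0 andbT -muN le_measure ?inE//; first exact: measurableC.
move=> x /= xm; apply: sub => /= /eqP.
rewrite mulf_eq0 sqrf_eq0 subr_eq0 => /orP[/eqP//|].
by rewrite gt_eqF// expR_gt0.
Qed.

Lemma near_lapdom s : lapdom mu s -> \forall t \near s, lapdom mu t.
Proof. by move=> Ds; apply: open_nbhs_nbhs; split => //; exact: open_lapdom. Qed.

Lemma der_ell s : lapdom mu s -> is_derive s 1 (ell mu) (- (mom mu 1 s / mom mu 0 s)).
Proof.
move=> Ds; apply: (@near_eq_is_derive _ _ _ (fun t => ln (mom mu 0 t))).
  by near=> t; rewrite ellE//; near: t; exact: near_lapdom.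
apply: dereq; first by apply: derln; [exact: mom0_gt0|exact: der_mom].
by rewrite mulrN mulrC.
Unshelve. all: by end_near. Qed.

Lemma meanE s : lapdom mu s -> mean mu s = mom mu 1 s / mom mu 0 s.
Proof.
by move=> Ds; rewrite /mean derive1E; have [_ ->] := der_ell Ds; rewrite opprK.
Qed.

Lemma der_mean s : lapdom mu s -> is_derive s 1 (mean mu) (- mvar s).
Proof.
move=> Ds; apply: (@near_eq_is_derive _ _ _ (fun t => mom mu 1 t * (mom mu 0 t)^-1)).
  by near=> t; rewrite meanE//; near: t; exact: near_lapdom.
have m0 := mom0_gt0 Ds.
apply: dereq.
  by apply: derM; [exact: der_mom|apply: derV; [rewrite gt_eqF|exact: der_mom]].
by rewrite /mvar; field; rewrite gt_eqF.
Unshelve. all: by end_near. Qed.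

Lemma ell2E s : lapdom mu s -> (ell mu)^`(2)%classic s = mvar s.
Proof.
move=> Ds; rewrite /derive1n/= derive1E.
have h : is_derive s 1 (ell mu)^`()%classic (mvar s).
  apply: (@near_eq_is_derive _ _ _ (fun t => - mean mu t)).
    by near=> t; rewrite /mean opprK.
  by apply: dereq; [apply: derN; exact: der_mean|rewrite opprK].
by have [_ ->] := h.
Unshelve. all: by end_near. Qed.

Lemma mvar_continuous s : lapdom mu s -> {for s, continuous mvar}.
Proof.
move=> Ds; have m0 := mom0_gt0 Ds.
have c k : {for s, continuous (mom mu k)} by exact: der_continuous (der_mom k Ds).
have m0' : mom mu 0 s != 0 by rewrite gt_eqF.
rewrite /mvar; apply: cvgB.
  by apply: cvgM; [exact: c|apply: cvgV => //; exact: c].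
by rewrite expr2; apply: cvgM; (apply: cvgM; [exact: c|apply: cvgV => //; exact: c]).
Qed.

(** The derivative of the mean is minus the variance. *)
Lemma mean_decr s t : lapdom mu s -> lapdom mu t -> s < t -> mean mu t < mean mu s.
Proof.
move=> Ds Dt st.
have D u : s <= u -> u <= t -> lapdom mu u by move=> su ut; exact: lapdom_between Ds Dt.
have dm u : u \in `]s, t[ -> is_derive u 1 (mean mu) (- mvar u).
  by rewrite in_itv/= => /andP[su ut]; apply: der_mean; apply: D; exact: ltW.
have cm : {within `[s, t], continuous (mean mu)}.
  apply: continuous_in_subspaceT => u; rewrite inE/= in_itv/= => /andP[su ut].
  by apply: der_continuous; apply: der_mean; exact: D.
have [c] := MVT st dm cm; rewrite in_itv/= => /andP[sc ct] h.
rewrite -subr_lt0 h mulNr oppr_lt0; apply: mulr_gt0; last by rewrite subr_gt0.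
by apply: mvar_gt0; apply: D; exact: ltW.
Qed.

Lemma mean_inj s t : lapdom mu s -> lapdom mu t -> mean mu s = mean mu t -> s = t.
Proof.
move=> Ds Dt e; have [/(mean_decr Ds Dt)|/(mean_decr Dt Ds)|//] := ltgtP s t;
  by rewrite e ltxx.
Qed.

Lemma inv_meanK s : lapdom mu s -> inv_mean mu (mean mu s) = s.
Proof.
move=> Ds; rewrite /inv_mean; apply: pinvKV; last by rewrite inE.
by move=> x y /[!inE] Dx Dy; exact: mean_inj.
Qed.

Lemma varfun_mean s : lapdom mu s -> varfun mu (mean mu s) = mvar s.
Proof. by move=> Ds; rewrite /varfun inv_meanK// ell2E. Qed.

End moments.

(** * Tilts and translates *)

Section exp_affine.
Context {R : realType}.
Variables mu nu : {measure set (measurableTypeR R) -> \bar R}.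
Hypothesis muM : forall a : R, mu (~` [set a]) != 0%E.
Hypothesis nuM : forall a : R, nu (~` [set a]) != 0%E.
Variables a c b : R.
Hypothesis rel : forall t, (laplace nu t = (expR (a + c * t))%:E * laplace mu (t + b))%E.

(** The relation between [nu] and [mu] combines a tilt by b, a translation by - c and
    a multiplication by exp a. *)
Lemma laplace_fin_rel t : (laplace nu t < +oo)%E <-> (laplace mu (t + b) < +oo)%E.
Proof.
rewrite rel; case: (laplace mu (t + b)) (laplace_ge0 mu (t + b)) => [r| |] //=.
- by move=> _; rewrite -EFinM !ltry.
- by move=> _; rewrite gt0_muley// lte_fin expR_gt0.
Qed.

Lemma lapdom_rel t : lapdom nu t <-> lapdom mu (t + b).
Proof.
split => /lapdomP[e e0 [h1 h2]]; apply/lapdomP; exists e => //; split.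
- by rewrite addrAC -laplace_fin_rel.
- by rewrite addrAC -laplace_fin_rel.
- by rewrite laplace_fin_rel addrAC.
- by rewrite laplace_fin_rel addrAC.
Qed.

Lemma ell_rel t : lapdom nu t -> ell nu t = a + c * t + ell mu (t + b).
Proof.
move=> Dt; have /lapdom_rel Dt' := Dt.
have m0 := mom0_gt0 nuM Dt; have m0' := mom0_gt0 muM Dt'.
rewrite !ellE//.
have : mom nu 0 t = expR (a + c * t) * mom mu 0 (t + b).
  by apply: EFin_inj; rewrite -laplace_mom// rel laplace_mom.
by move=> ->; rewrite lnM ?posrE ?expR_gt0// expRK.
Qed.

Lemma mean_rel t : lapdom nu t -> mean nu t = mean mu (t + b) - c.
Proof.
move=> Dt; have /lapdom_rel Dt' := Dt.
have h : is_derive t 1 (ell nu) (- mean mu (t + b) + c).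
  apply: (@near_eq_is_derive _ _ _ (fun u => a + c * u + ell mu (u + b))).
    by near=> u; rewrite ell_rel//; near: u; exact: near_lapdom.
  apply: dereq; first apply: derD.
  - by der.
  - apply: (dercomp (h := ell mu)); last by der.
    by rewrite /deriv1; exact: der_ell.
  - by rewrite meanE//; ring.
have [_] := der_ell nuM Dt; have [_ ->] := h.
by rewrite (meanE nuM Dt) => e; apply/eqP; rewrite -eqr_opp -e opprB addrC.
Unshelve. all: by end_near. Qed.

Lemma mvar_rel t : lapdom nu t -> mvar nu t = mvar mu (t + b).
Proof.
move=> Dt; have /lapdom_rel Dt' := Dt.
have h : is_derive t 1 (mean nu) (- mvar mu (t + b)).
  apply: (@near_eq_is_derive _ _ _ (fun u => mean mu (u + b) - c)).
    by near=> u; rewrite mean_rel//; near: u; exact: near_lapdom.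
  apply: dereq; first apply: derD.
  - apply: (dercomp (h := mean mu)); last by der.
    by rewrite /deriv1; exact: der_mean.
  - by der.
  - by ring.
by have [_] := der_mean nuM Dt; have [_ ->] := h; move/oppr_inj.
Unshelve. all: by end_near. Qed.

Lemma lapdom_relB t : lapdom mu t -> lapdom nu (t - b).
Proof. by move=> Dt; apply/lapdom_rel; rewrite subrK. Qed.

Lemma mean_relB t : lapdom mu t -> mean nu (t - b) = mean mu t - c.
Proof.
move=> /lapdom_relB Dt; have := mean_rel Dt.
by rewrite subrK => ->.
Qed.

Lemma mvar_relB t : lapdom mu t -> mvar nu (t - b) = mvar mu t.
Proof.
move=> /lapdom_relB Dt; have := mvar_rel Dt.
by rewrite subrK => ->.
Qed.

Lemma has_varfun_rel D V : c = 0 -> has_varfun mu D V -> has_varfun nu D V.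
Proof.
move=> c0 [md vf].
have mE t : lapdom mu t -> mean nu (t - b) = mean mu t.
  by move=> Dt; rewrite (mean_relB Dt) c0 subr0.
split.
  rewrite -md; apply/seteqP; split => m [t Dt <-].
    have /lapdom_rel Dt' := Dt; exists (t + b); first exact: Dt'.
    by rewrite (mean_rel Dt) c0 subr0.
  by exists (t - b); [exact: lapdom_relB|exact: mE].
move=> m; rewrite -md => -[t Dt <-].
rewrite -vf; last by rewrite -md; exists t.
rewrite (varfun_mean muM Dt) -(mE t Dt).
by rewrite (varfun_mean nuM (lapdom_relB Dt)) (mvar_relB Dt).
Qed.

End exp_affine.

Section tilted_family.
Context {R : realType}.
Implicit Types mu nu : {measure set (measurableTypeR R) -> \bar R}.

(** Rescaling and tilting change the generating measure but not the family. *)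
Lemma tilt_family mu (c b : R) : 0 < c -> calM mu ->
  exists nu, [/\ calM nu, NEF nu = NEF mu &
    forall s, (laplace nu s = (expR (ln c + 0 * s))%:E * laplace mu (s + b))%E].
Proof.
move=> c0 [muM [s0 Ds0]].
have [nu [nuA [nuI rel']]] := laplace_tilt mu b (ltW c0).
have rel s : (laplace nu s = (expR (ln c + 0 * s))%:E * laplace mu (s + b))%E.
  by rewrite mul0r addr0 lnK ?posrE.
have nuM (a : R) : nu (~` [set a]) != 0%E.
  have mA : measurable (~` [set a] : set (measurableTypeR R)) by exact: measurableC.
  apply: contra (muM a) => /eqP; rewrite nuA => h.
  apply/eqP/(laplace_eq0 (s := b) mA).
  have : (c%:E * \int[mu]_(x in ~` [set a]) (expR (- (b * x)))%:E = 0)%E.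
    rewrite -ge0_integralZl ?lee_fin ?(ltW c0)//.
    by apply/measurable_funTS; exact: measurable_EexpN.
  by move/eqP; rewrite mule_eq0 eqe gt_eqF//= => /eqP.
have tE s (A : set R) : lapdom nu s -> measurable (A : set (measurableTypeR R)) ->
    tilt nu s A = tilt mu (s + b) A.
  move=> Ds mA; have /(lapdom_rel rel) Ds' := Ds.
  rewrite /tilt [LHS]integral_mkcond [RHS]integral_mkcond.
  rewrite nuI; last 2 first.
  - apply/(measurable_restrictT _ mA) => //.
    apply: measurable_funTS; apply: measurableT_comp => //.
    by apply: measurableT_comp => //; apply: measurable_funB => //; apply: measurableT_comp.
  - by move=> x; apply: erestrict_ge0 => y _; rewrite lee_fin expR_ge0.
  apply: eq_integral => x _; rewrite !patchE; case: ifP => _; last by rewrite mul0e.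
  rewrite -EFinM; congr EFin; rewrite (ell_rel muM nuM rel Ds).
  have -> : c * expR (- (b * x)) = expR (ln c - b * x) by rewrite expRD lnK ?posrE.
  by rewrite -expRD; congr expR; ring.
exists nu; split => //.
- split => //; exists (s0 - b); apply/(lapdom_rel rel).
  by rewrite subrK.
- apply/seteqP; split => P [s Ds hP].
    exists (s + b); first by apply/(lapdom_rel rel).
    by move=> A mA; rewrite hP// tE.
  have Ds' : lapdom nu (s - b) by apply/(lapdom_rel rel); rewrite subrK.
  exists (s - b); first exact: Ds'.
  by move=> A mA; rewrite (hP A mA) (tE _ _ Ds' mA) subrK.
Qed.

End tilted_family.

(** * The dual family from the reciprocal variance *)

Section duality.
Context {R : realType}.
Implicit Types mu nu : {measure set (measurableTypeR R) -> \bar R}.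

Lemma const_of_deriv0 (T : set R) (f : R -> R) :
  (forall a t b, T a -> T b -> a <= t -> t <= b -> T t) ->
  (forall s, T s -> deriv1 f s 0) -> forall s t, T s -> T t -> f s = f t.
Proof.
move=> cT df.
suff H s t : T s -> T t -> s < t -> f s = f t.
  by move=> s t Ts Tt; have [/(H _ _ Ts Tt)|/(H _ _ Tt Ts)/esym|->] := ltgtP s t.
move=> Ts Tt st.
have d u : u \in `]s, t[ -> is_derive u 1 f 0.
  by rewrite in_itv/= => /andP[su ut]; apply: df; apply: cT Ts Tt _ _; exact: ltW.
have cf : {within `[s, t], continuous f}.
  apply: continuous_in_subspaceT => u; rewrite inE/= in_itv/= => /andP[su ut].
  by apply: der_continuous; apply: df; exact: cT Ts Tt _ _.
have [x _] := MVT st d cf.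
by rewrite mul0r => /eqP; rewrite subr_eq0 => /eqP.
Qed.

(** The logarithm of the transform of a measure on one point is affine, which a
    nonzero second derivative excludes. *)
Lemma not_concentrated nu (D : set R) (L G W : R -> R) :
  open D -> D !=set0 -> (forall s, D s -> laplace nu s = (expR (L s))%:E) ->
  (forall s, D s -> deriv1 L s (G s)) -> (forall s, D s -> deriv1 G s (W s)) ->
  (forall s, D s -> W s != 0) -> forall a : R, nu (~` [set a]) != 0%E.
Proof.
move=> oD [s0 Ds0] lapE dL dG W0 a; apply/eqP => nua.
have lE s : laplace nu s = ((expR (- (s * a)))%:E * nu setT)%E.
  rewrite -integral_cst//; apply: ge0_ae_eq_integral => //.
  - exact: measurable_EexpN.
  - by move=> x _; rewrite lee_fin expR_ge0.
  exists (~` [set a]); split => //; first exact: measurableC.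
  by move=> x /= h xa; apply: h; rewrite xa.
have Kfin : exists K : R, nu setT = K%:E.
  case E : (nu setT) => [r| |]; first by exists r.
    by have := lE s0; rewrite (lapE _ Ds0) E gt0_muley ?lte_fin ?expR_gt0.
  have : (0 <= nu setT)%E by exact: measure_ge0.
  by rewrite E.
have [K KE] := Kfin.
have K0 : 0 < K.
  have := lE s0; rewrite lapE// KE -EFinM => -[h].
  by rewrite -(pmulr_rgt0 _ (expR_gt0 (- (s0 * a)))) -h expR_gt0.
have LE s : D s -> L s = - (s * a) + ln K.
  move=> Ds; have := lE s; rewrite lapE// KE -EFinM => -[h].
  by rewrite -[LHS]expRK h lnM ?posrE ?expR_gt0// expRK.
have nD s : D s -> \forall t \near s, D t.
  by move=> Ds; apply: open_nbhs_nbhs; split.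
have GE s : D s -> G s = - a.
  move=> Ds; have h : is_derive s 1 L (- a).
    apply: (@near_eq_is_derive _ _ _ (fun t : R => - (t * a) + ln K : R)).
      by near=> t; rewrite LE//; near: t; exact: nD.
    by apply: dereq; first (by der); rewrite /=; ring.
  by have [_ <-] := dL s Ds; have [_ ->] := h.
have h : is_derive s0 1 G 0.
  apply: (@near_eq_is_derive R R R (fun t : R => - a)).
  by near=> t; rewrite GE//; near: t; exact: nD.
have /eqP := W0 s0 Ds0; apply.
by have [_ <-] := dG s0 Ds0; have [_ ->] := h.
Unshelve. all: by end_near. Qed.

(** Every point outside [D] is separated from [D] by an end point where [V]
    vanishes, or is itself such an end point. *)
Definition singular_boundary (D : set R) (V : R -> R) : Prop :=
  forall x, ~ D x -> exists e, [/\ forall d, D d -> d <= e <= x \/ x <= e <= d,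
    V e = 0, {for e, continuous V} & closure D e].

Section dual_side.
Variables (nu : {measure set (measurableTypeR R) -> \bar R}) (D : set R) (V L G : R -> R).
Hypotheses (oD : open D) (D0 : D !=set0).
Hypothesis V0 : forall s, D s -> 0 < V s.
Hypothesis lapE : forall s, D s -> laplace nu s = (expR (L s))%:E.
Hypothesis dL : forall s, D s -> deriv1 L s (G s).
Hypothesis dG : forall s, D s -> deriv1 G s (V s)^-1.

Lemma dual_nuM (a : R) : nu (~` [set a]) != 0%E.
Proof.
apply: (not_concentrated oD D0 lapE dL dG) => s Ds.
by rewrite invr_eq0 gt_eqF// V0.
Qed.

Lemma sub_lapdom : D `<=` lapdom nu.
Proof.
move=> s Ds; rewrite /lapdom /interior.
apply: (filterS _ (open_nbhs_nbhs (conj oD Ds))) => t Dt /=.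
by rewrite lapE// ltry.
Qed.

Lemma near_D s : D s -> \forall t \near s, D t.
Proof. by move=> Ds; apply: open_nbhs_nbhs; split. Qed.

Lemma dual_mean s : D s -> mean nu s = - G s.
Proof.
move=> Ds; have h : is_derive s 1 (ell nu) (G s).
  apply: (@near_eq_is_derive _ _ _ L); last exact: dL.
  near=> t; rewrite /ell lapE ?expRK//; near: t; exact: near_D.
by rewrite /mean derive1E; have [_ ->] := h.
Unshelve. all: by end_near. Qed.

Lemma dual_mvar s : D s -> mvar nu s = (V s)^-1.
Proof.
move=> Ds; have h : is_derive s 1 (mean nu) (- (V s)^-1).
  apply: (@near_eq_is_derive _ _ _ (fun t => - G t)).
    near=> t; rewrite dual_mean//; near: t; exact: near_D.
  by apply: derN; exact: dG.
have [_] := der_mean dual_nuM (sub_lapdom Ds); have [_ ->] := h.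
by move/oppr_inj.
Unshelve. all: by end_near. Qed.

(** If the domain were larger than [D], it would by convexity contain an end point e
    of [D]. The variance of [nu] is continuous at e, and V e = 0, so the product of
    the two tends to 0; but this product is 1 on [D]. *)
Lemma dual_lapdom : singular_boundary D V -> lapdom nu = D.
Proof.
move=> bD; apply/seteqP; split; last exact: sub_lapdom.
move=> x Dx; apply: contrapT => /bD[e [be Ve cV clD]].
have [d Dd] := D0.
have De : lapdom nu e.
  have [/andP[h1 h2]|/andP[h1 h2]] := be d Dd.
    exact: lapdom_between h1 h2 (sub_lapdom Dd) Dx.
  exact: lapdom_between h1 h2 Dx (sub_lapdom Dd).
have cW : (mvar nu y * V y) @[y --> e] --> (0 : R).
  rewrite -[X in _ --> X](mulr0 (mvar nu e)) -Ve.
  by apply: cvgM; [exact: (mvar_continuous dual_nuM De)|exact: cV].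
have /clD[y [Dy]] : nbhs e [set y | `|0 - mvar nu y * V y| < 1].
  by move/cvgrPdist_lt : cW; apply.
by rewrite /= dual_mvar// mulVf ?gt_eqF ?V0// sub0r normrN normr1 ltxx.
Qed.

End dual_side.

(** By the chain rule G (mean mu0 s) + s has derivative - V / V + 1 = 0, hence is a
    constant c. The tilt of [mu0] by c then satisfies G (mean s) = - s, and - G is
    the mean of [nu]. *)
Theorem dual_family mu0 nu (D : set R) (V L G : R -> R) :
  calM mu0 -> has_varfun mu0 D V -> open D ->
  (forall s, D s -> laplace nu s = (expR (L s))%:E) ->
  (forall s, D s -> deriv1 L s (G s)) ->
  (forall s, D s -> deriv1 G s (V s)^-1) ->
  singular_boundary D V ->
  exists mu, [/\ calM mu, calM nu, NEF mu = NEF mu0, has_varfun mu D V &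
   [/\ dual_measure mu nu, lapdom nu = D,
      forall s, lapdom mu s <-> exists2 m, D m & s = - G m,
      forall s, lapdom mu s -> D (mean mu s) /\ G (mean mu s) = - s &
      forall m, D m -> mean nu m = - G m /\ varfun nu (- G m) = (V m)^-1]].
Proof.
move=> cM [md vf] oD lapE dL dG bD.
have [muM [s0 Ds0]] := cM.
have Vmean s : lapdom mu0 s -> V (mean mu0 s) = mvar mu0 s.
  by move=> Ds; rewrite -vf ?varfun_mean// -md; exists s.
have Dmean s : lapdom mu0 s -> D (mean mu0 s) by move=> Ds; rewrite -md; exists s.
have D0 : D !=set0 by exists (mean mu0 s0); exact: Dmean.
have V0 m : D m -> 0 < V m.
  by rewrite -md => -[s Ds <-]; rewrite Vmean//; exact: mvar_gt0.
have nuM := dual_nuM oD D0 V0 lapE dL dG.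
have DE := dual_lapdom oD D0 V0 lapE dL dG bD.
pose c := G (mean mu0 s0) + s0.
have cE s : lapdom mu0 s -> G (mean mu0 s) = c - s.
  move=> Ds; suff : G (mean mu0 s) + s = c by move=> <-; rewrite addrK.
  apply: (@const_of_deriv0 (lapdom mu0) (fun s => G (mean mu0 s) + s)) => //.
    by move=> a t b Da Db at_ tb; exact: lapdom_between at_ tb Da Db.
  move=> {s Ds} s Ds; apply: dereq; first apply: derD.
  - apply: (dercomp (h := G)); first exact: dG (Dmean _ Ds).
    by rewrite /deriv1; exact: (der_mean muM Ds).
  - by der.
  - by rewrite Vmean// mulrN mulVf ?gt_eqF ?(mvar_gt0 muM Ds)// addNr.
have [mu [cmu NE rel]] := tilt_family c (@ltr01 R) cM.
have muM' := cmu.1.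
have meanE' s : lapdom mu s -> mean mu s = mean mu0 (s + c).
  by move=> Ds; rewrite (mean_rel muM muM' rel Ds) subr0.
have Gmean s : lapdom mu s -> D (mean mu s) /\ G (mean mu s) = - s.
  move=> Ds; have /(lapdom_rel rel) Ds' := Ds; rewrite meanE'//; split; first exact: Dmean.
  by rewrite cE//; ring.
have calnu : calM nu.
  by split => //; case: D0 => d Dd; exists d; rewrite DE.
exists mu; split; [exact: cmu|exact: calnu|exact: NE|exact: (has_varfun_rel muM muM' rel)|].
split; [|exact: DE| |exact: Gmean|].
- split; first exact: calnu.
  move=> s Ds; have [Dm Gm] := Gmean s Ds.
  rewrite DE; split; first exact: Dm.
  by rewrite (dual_mean oD lapE dL Dm) Gm opprK.
- move=> s; split => [Ds|[m]].
    by have [Dm Gm] := Gmean s Ds; exists (mean mu s); rewrite ?Gm ?opprK.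
  rewrite -md => -[t Dt <-] ->; apply/(lapdom_rel rel).
  by rewrite cE// opprB subrK.
- move=> m Dm; have Dm' : lapdom nu m by rewrite DE.
  have mE := dual_mean oD lapE dL Dm; split; first exact: mE.
  by rewrite -mE varfun_mean// (dual_mvar oD D0 V0 lapE dL dG).
Qed.

End duality.

(** * Exponents built from the functions 1 / (s + u) *)

Section elementary_inequalities.
Context {R : realType}.

Lemma le_of_deriv_le0 (f g : R -> R) a b : a <= b ->
  (forall u, a <= u <= b -> deriv1 f u (g u)) ->
  (forall u, a <= u <= b -> g u <= 0) -> f b <= f a.
Proof.
move=> ab df g0.
have d u : u \in `]a, b[ -> is_derive u 1 f (g u).
  by rewrite in_itv/= => /andP[su ut]; apply: df; rewrite !ltW.
have cf : {within `[a, b], continuous f}.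
  apply: continuous_in_subspaceT => u; rewrite inE/= in_itv/= => uab.
  exact: der_continuous (df _ uab).
have [x] := MVT_segment ab d cf; rewrite in_itv/= => xab h.
by rewrite -subr_le0 h mulr_le0_ge0 ?subr_ge0// g0.
Qed.

Lemma sin_le_id (x : R) : 0 <= x -> sin x <= x.
Proof.
move=> x0.
have : sin x - x <= sin 0 - 0.
  apply: (@le_of_deriv_le0 (fun u => sin u - u) (fun u => cos u - 1) 0 x x0).
    by move=> u _; apply: dereq; first (by der); rewrite /=; ring.
  by move=> u _; rewrite subr_le0 cos_le1.
by rewrite sin0 subrr subr_le0.
Qed.

End elementary_inequalities.

Section densities.
Context {R : realType}.
Implicit Types (f : R -> R).

Lemma half_line_density f : measurable_fun [set: R] f -> (forall x, 0 <= x -> 0 <= f x) ->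
  exists nu : {measure set (measurableTypeR R) -> \bar R},
  forall g : R -> R, measurable_fun [set: R] g -> (forall x, 0 <= g x) ->
   (\int[nu]_x (g x)%:E = \int[@lebesgue_measure R]_(x in `[0%R, +oo[) (g x * f x)%:E)%E.
Proof.
move=> mf f0.
pose F (x : measurableTypeR R) : R := f x * \1_(`[0, +oo[%classic : set R) x.
have mF : measurable_fun [set: measurableTypeR R] F.
  by apply: measurable_funM => //; exact: measurable_indic.
have F0 x : 0 <= F x.
  rewrite /F indicE; have [|_] := boolP (x \in _); last by rewrite mulr0.
  by rewrite inE/= in_itv/= andbT mulr1; exact: f0.
have [nu [_ nuI]] := density_measure (@lebesgue_measure R) mF F0.
exists nu => g mg g0.
rewrite (nuI (fun x => (g x)%:E)); last 2 first.
- exact/measurable_EFinP.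
- by move=> x; rewrite lee_fin.
rewrite [RHS]integral_mkcond; apply: eq_integral => x _.
rewrite patchE /F indicE; case: ifP => _; first by rewrite mulr1 EFinM.
by rewrite mulr0 mule0.
Qed.

Lemma integral_half_line f (A : R -> R) (l : R) :
  (forall x, 0 <= x -> 0 <= f x) -> continuous f ->
  (forall x, deriv1 A x (f x)) -> A x @[x --> +oo] --> l ->
  (\int[@lebesgue_measure R]_(x in `[0%R, +oo[) (f x)%:E = (l - A 0)%:E)%E.
Proof.
move=> f0 cf dA cA; rewrite EFinB.
have cA0 : {for 0, continuous A} by exact: der_continuous (dA 0).
apply: ge0_continuous_FTC2y => //.
- exact: continuous_subspaceT.
- by move=> x _; have [] := dA x.
- exact: cvg_at_right_filter.
- by move=> x _; rewrite derive1E; have [_ ->] := dA x.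
Qed.

Lemma cvg_expN_pinfty (s : R) : 0 < s -> expR (- (s * x)) @[x --> +oo] --> (0 : R).
Proof.
move=> s0; apply: (cvg_comp (fun x => s * x) (fun y => expR (- y))); last exact: cvgr_expR.
by apply: gt0_cvgMry => //; exact: cvg_id.
Qed.

Lemma integral_expN (s : R) : 0 < s ->
  (\int[@lebesgue_measure R]_(x in `[0%R, +oo[) (expR (- (s * x)))%:E = (s^-1)%:E)%E.
Proof.
move=> s0.
rewrite (@integral_half_line _ (fun x => - (s^-1 * expR (- (s * x)))) 0).
- by rewrite mulr0 oppr0 expR0 mulr1 sub0r opprK.
- by move=> x _; rewrite expR_ge0.
- move=> x; apply: (@der_continuous _ _ _ (expR (- (s * x)) * - (s * 1))).
  by apply: dereq; first (by der); rewrite /=; ring.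
- by move=> x; apply: dereq; first (by der); rewrite /=; field; rewrite gt_eqF.
- rewrite -[X in _ --> X]oppr0; apply: cvgN.
  rewrite -[X in _ --> X](mulr0 s^-1); apply: cvgM; first exact: cvg_cst.
  exact: cvg_expN_pinfty.
Qed.

Lemma isLap_inv : isLap (fun s : R => s^-1).
Proof.
have [|nu nuI] := @half_line_density (fun=> 1) (measurable_cst _).
  by move=> x _.
exists nu => s s0; rewrite /laplace nuI; last 2 first.
- exact: (measurable_expN s).
- by move=> x; rewrite expR_ge0.
by rewrite -integral_expN//; apply: eq_integral => x _; rewrite mulr1.
Qed.

End densities.

Section generators.
Context {R : realType}.

Lemma isLap_shift_inv (u : R) : 0 <= u -> isLap (fun s => (s + u)^-1).
Proof.
move=> u0; apply: isLap_ext (isLap_tilt ler01 u0 isLap_inv) => s _.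
by rewrite mul1r.
Qed.

(** The integral of 1 / (s + u) over 0 <= u <= c. *)
Lemma isID_lnB (c : R) : 0 < c -> isID (fun s => ln (s + c) - ln s).
Proof.
move=> c0.
have := @isID_integral R (fun u s => ln (s + u)) (fun u s => (s + u)^-1) 0 c c0.
move=> h; apply: isID_ext (h _ _ _) => [s _|u /andP[u0 _]|s u s0 /andP[u0 _]|s s0].
- by rewrite addr0.
- by apply: isID_Lap; exact: isLap_shift_inv.
- apply: dereq; first by der; lra.
  by rewrite add0r mulr1.
- right => u v u0 uv vc; rewrite lef_pV2 ?posrE; lra.
Qed.

(** Up to the constant ln c, the limit of ln (s + c) - ln s as c tends to + oo. *)
Lemma isID_Nln : isID (fun s : R => - ln s).
Proof.
apply: (@isID_limit _ (fun n s => (ln (s + n.+1%:R) - ln s) + (0 * s + - ln n.+1%:R))).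
  by move=> n; apply: isIDD; [exact: isID_lnB|exact: isID_affine].
move=> s s0.
apply: (@squeeze_cvgr _ _ _ _ (cst (- ln s)) (fun n => - ln s + s * mesh n)).
- near=> n; have n0 : 0 < n.+1%:R :> R by rewrite ltr0n.
  have -> : ln (s + n.+1%:R) = ln n.+1%:R + ln (1 + s / n.+1%:R).
    rewrite -lnM ?posrE//; last by rewrite addr_gt0// divr_gt0.
    by congr ln; field; rewrite gt_eqF.
  have h1 : 0 <= ln (1 + s / n.+1%:R).
    by apply: ln_ge0; rewrite lerDl divr_ge0 ?ltW.
  have h2 : ln (1 + s / n.+1%:R) <= s * mesh n.
    by apply: le_ln1Dx; apply: lt_trans (_ : 0 < _); rewrite ?divr_gt0// ltrN10.
  by rewrite /cst; apply/andP; split; lra.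
- exact: cvg_cst.
- rewrite -[X in _ --> X]addr0; apply: cvgD; first exact: cvg_cst.
  rewrite -[X in _ --> X](mulr0 s); apply: cvgM; [exact: cvg_cst|exact: cvg_mesh].
Unshelve. all: by end_near. Qed.

(** Up to a constant, the integral of - ln (s + u) over 0 <= u <= c. *)
Lemma isID_negbin (c : R) : 0 < c -> isID (fun s => s * ln s - (s + c) * ln (s + c)).
Proof.
move=> c0.
have := @isID_integral R (fun u s => - ((s + u) * ln (s + u) - u)) (fun u s => - ln (s + u)) 0 c c0.
move=> h; apply: (@isID_ext _ (fun s => - ((s + c) * ln (s + c) - c) - - ((s + 0) * ln (s + 0) - 0)
    + (0 * s + - c))).
  by move=> s _; rewrite addr0; ring.
apply: isIDD; last exact: isID_affine.
apply: h => [u /andP[u0 _]|s u s0 /andP[u0 _]|s s0].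
- exact: isID_tilt isID_Nln.
- apply: dereq; first by der; lra.
  by rewrite /=; field; lra.
- by right => u v u0 uv vc; rewrite lerN2 ler_ln ?posrE; lra.
Qed.

(** The limit of the previous exponents as c tends to + oo, after the addition of
    the affine function (ln c + 1) s + c ln c. The limit uses
    s <= (s + c) ln (1 + s / c) <= s + s^2 / c. *)
Lemma isID_landau : isID (fun s : R => s * ln s).
Proof.
apply: (@isID_limit _ (fun n s => (s * ln s - (s + n.+1%:R) * ln (s + n.+1%:R)) +
   ((ln n.+1%:R + 1) * s + n.+1%:R * ln n.+1%:R))).
  by move=> n; apply: isIDD; [exact: isID_negbin|exact: isID_affine].
move=> s s0.
apply: (@squeeze_cvgr _ _ _ _ (fun n => s * ln s - s ^+ 2 * mesh n) (cst (s * ln s))).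
- near=> n; have n0 : 0 < n.+1%:R :> R by rewrite ltr0n.
  set N : R := n.+1%:R; have N0 : 0 < N by exact: n0.
  have q0 : 0 < s / N by rewrite divr_gt0.
  have -> : ln (s + N) = ln N + ln (1 + s / N).
    rewrite -lnM ?posrE//; last by rewrite addr_gt0.
    by congr ln; field; rewrite gt_eqF.
  have h2 : (s + N) * ln (1 + s / N) <= s + s ^+ 2 * mesh n.
    have -> : s + s ^+ 2 * mesh n = (s + N) * (s / N).
      by rewrite /mesh -/N; field; rewrite gt_eqF.
    by apply: ler_wpM2l; [lra|apply: le_ln1Dx; apply: lt_trans q0; rewrite ltrN10].
  have h1 : s <= (s + N) * ln (1 + s / N).
    have -> : ln (1 + s / N) = - ln (1 - s / (s + N)).
      rewrite -lnV; first by congr ln; field; lra.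
      rewrite posrE subr_gt0 ltr_pdivrMr ?addr_gt0// mul1r.
      by rewrite ltrDl.
    have h : ln (1 + - (s / (s + N))) <= - (s / (s + N)).
      apply: le_ln1Dx; rewrite ltrN2 ltr_pdivrMr ?addr_gt0// mul1r.
      by rewrite ltrDl.
    rewrite -ler_pdivrMl ?addr_gt0//; lra.
  by rewrite /cst; apply/andP; split; lra.
- rewrite -[X in _ --> X]subr0; apply: cvgB; first exact: cvg_cst.
  rewrite -[X in _ --> X](mulr0 (s ^+ 2)); apply: cvgM; [exact: cvg_cst|exact: cvg_mesh].
- exact: cvg_cst.
Unshelve. all: by end_near. Qed.

(** Up to a constant, the integral of u / (s + u) over 0 <= u <= c. *)
Lemma isID_abel (c : R) : 0 < c -> isID (fun s => s * ln s - s * ln (s + c)).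
Proof.
move=> c0.
have := @isID_integral R (fun u s => u - s * ln (s + u)) (fun u s => u * (s + u)^-1) 0 c c0.
move=> h; apply: (@isID_ext _ (fun s => (c - s * ln (s + c)) - (0 - s * ln (s + 0)) + (0 * s + - c))).
  by move=> s _; rewrite addr0; ring.
apply: isIDD; last exact: isID_affine.
apply: h => [u /andP[u0 _]|s u s0 /andP[u0 _]|s s0].
- by apply: isID_Lap; apply: isLapZ => //; exact: isLap_shift_inv.
- apply: dereq; first by der; lra.
  by rewrite /=; field; lra.
- left => u v u0 uv vc.
  rewrite ler_pdivrMr; last lra.
  rewrite mulrAC ler_pdivlMr; last lra.
  rewrite -subr_ge0 (_ : _ - _ = s * (v - u)); last by ring.
  by apply: mulr_ge0; lra.
Qed.

(** Up to a constant, the integral of (1 - u) / (s + u) over c <= u <= 1. *)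
Lemma isID_kendall (c : R) : 0 <= c -> c < 1 ->
  isID (fun s => (s + 1) * ln (s + 1) - (s + 1) * ln (s + c)).
Proof.
move=> c0 c1.
have := @isID_integral R (fun u s => (s + 1) * ln (s + u) - u) (fun u s => (1 - u) * (s + u)^-1) c 1 c1.
move=> h; apply: (@isID_ext _ (fun s => ((s + 1) * ln (s + 1) - 1) - ((s + 1) * ln (s + c) - c)
    + (0 * s + (1 - c)))).
  by move=> s _; ring.
apply: isIDD; last exact: isID_affine.
apply: h => [u /andP[u0 u1]|s u s0 /andP[u0 _]|s s0].
- apply: isID_Lap; apply: isLapZ; first by rewrite subr_ge0.
  by apply: isLap_shift_inv; lra.
- apply: dereq; first by der; lra.
  by rewrite /=; field; lra.
- right => u v u0 uv vc.
  rewrite ler_pdivrMr; last lra.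
  rewrite mulrAC ler_pdivlMr; last lra.
  rewrite -subr_ge0 (_ : _ - _ = (s + 1) * (v - u)); last by ring.
  by apply: mulr_ge0; lra.
Qed.

(** Up to an affine function, the sum of the Abel exponent and of 1 / (r - 1) times
    the Kendall-Ressel exponent, both at c = 1 / r. *)
Lemma isID_takacs (r : R) : 1 < r ->
  isID (fun s => s * ln s + (s + 1) / (r - 1) * ln (s + 1)
     - (r * s + 1) / (r - 1) * ln (r * s + 1)).
Proof.
move=> r1; have r0 : 0 < r by lra.
have c0 : 0 < r^-1 by rewrite invr_gt0.
have c1 : r^-1 < 1 by rewrite invf_lt1.
apply: (@isID_ext _ (fun s => ((s * ln s - s * ln (s + r^-1)) +
   (r - 1)^-1 * ((s + 1) * ln (s + 1) - (s + 1) * ln (s + r^-1))) +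
   ((- (r / (r - 1) * ln r)) * s + - ((r - 1)^-1 * ln r)))).
  move=> s s0.
  have -> : ln (r * s + 1) = ln r + ln (s + r^-1).
    rewrite -lnM ?posrE//; last by rewrite addr_gt0.
    by congr ln; field; rewrite gt_eqF.
  by rewrite /=; field; lra.
apply: isIDD; last exact: isID_affine.
apply: isIDD; first exact: isID_abel.
apply: isIDZ; first by rewrite invr_ge0; lra.
by apply: isID_kendall => //; rewrite ltW.
Qed.

End generators.

(** * The arcsine exponents *)

Section second_derivative.
Context {R : realType}.

(** The second derivative of a Laplace transform is the second moment of the tilt,
    so [L] and the transform of [kappa] differ by an affine function. *)
Lemma isID_mom2 (kappa : {measure set (measurableTypeR R) -> \bar R}) (L G : R -> R) :
  (forall s, 0 < s -> (laplace kappa s < +oo)%E) ->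
  (forall s, 0 < s -> deriv1 L s (G s)) ->
  (forall s, 0 < s -> deriv1 G s (mom kappa 2 s)) -> isID L.
Proof.
move=> fin dL dG.
have Dk s : 0 < s -> lapdom kappa s.
  move=> s0; apply/lapdomP; exists (s / 2); first by rewrite divr_gt0.
  by split; apply: fin; lra.
have conv (a t b : R) : 0 < a -> 0 < b -> a <= t -> t <= b -> 0 < t.
  by move=> a0 b0 at_ tb; lra.
pose al : R := - mom kappa 1 1 - G 1.
have alE s : 0 < s -> - mom kappa 1 s - G s = al.
  move=> s0; apply: (@const_of_deriv0 _ (fun s => 0 < s) (fun s => - mom kappa 1 s - G s)) => //.
  move=> {}s {}s0; apply: dereq.
    apply: derD; apply: derN; [exact: (der_mom 1 (Dk _ s0))|exact: dG].
  by rewrite opprK subrr.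
pose be : R := mom kappa 0 1 - L 1 - al * 1.
have beE s : 0 < s -> mom kappa 0 s - L s - al * s = be.
  move=> s0; apply: (@const_of_deriv0 _ (fun s => 0 < s) (fun s => mom kappa 0 s - L s - al * s)) => //.
  move=> {}s {}s0; apply: dereq.
    apply: derD; last by der.
    apply: derD; last by apply: derN; exact: dL.
    exact: (der_mom 0 (Dk _ s0)).
  by rewrite /= -(alE _ s0); ring.
apply: (@isID_ext _ (fun s => mom kappa 0 s + (- al * s + - be))).
  by move=> s s0; rewrite -(beE _ s0); ring.
apply: isIDD; last exact: isID_affine.
apply: isID_Lap; exists kappa => s s0; exact: laplace_mom (Dk _ s0).
Qed.

End second_derivative.

Section arcsine.
Context {R : realType}.
Variables c d : R.
Hypotheses (c0 : 0 <= c) (d0 : 0 < d) (cd : c ^+ 2 + d ^+ 2 = 1).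

(** The integral of exp (- c t) sin (d t) / d over 0 <= t <= x, whose Laplace
    transform is 1 / (s ((s + c)^2 + d^2)). *)
Definition asin_h (x : R) : R :=
  1 - expR (- (c * x)) * (cos (d * x) + c / d * sin (d * x)).

(** From cos <= 1 and sin y <= y the subtracted term is at most
    exp (- c x) (1 + c x) <= 1. *)
Lemma asin_h_ge0 x : 0 <= x -> 0 <= asin_h x.
Proof.
move=> x0; rewrite /asin_h subr_ge0 expRN ler_pdivrMl ?expR_gt0// mulr1.
apply: le_trans (expR_ge1Dx _); apply: lerD; first exact: cos_le1.
have -> : c * x = c / d * (d * x) by field; rewrite gt_eqF.
apply: ler_wpM2l; first by rewrite divr_ge0// ltW.
by apply: sin_le_id; rewrite mulr_ge0// ltW.
Qed.

Lemma asin_h_der x : deriv1 asin_h x (expR (- (c * x)) * sin (d * x) / d).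
Proof.
rewrite /asin_h; apply: dereq; first by der.
rewrite /=.
transitivity (expR (- (c * x)) * sin (d * x) / d * (c ^+ 2 + d ^+ 2)); last by rewrite cd mulr1.
by field; rewrite gt_eqF.
Qed.

(** The derivative of [asin_h] is at most x. *)
Lemma asin_h_le x : 0 <= x -> asin_h x <= x ^+ 2 / 2.
Proof.
move=> x0.
have : asin_h x - x ^+ 2 / 2 <= asin_h 0 - 0 ^+ 2 / 2.
  apply: (@le_of_deriv_le0 _ (fun u => asin_h u - u ^+ 2 / 2)
     (fun u => expR (- (c * u)) * sin (d * u) / d - u) _ _ x0).
    move=> u _; apply: dereq.
      apply: derD; first exact: asin_h_der.
      by der.
    by rewrite /=; field; rewrite gt_eqF.
  move=> u /andP[u0 _]; rewrite subr_le0 ler_pdivrMr// [u * d]mulrC.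
  have [sn|sp] := leP (sin (d * u)) 0.
    by apply: (@le_trans _ _ 0); rewrite ?mulr_ge0 ?(ltW d0)// mulr_ge0_le0 ?expR_ge0.
  apply: (@le_trans _ _ (sin (d * u))); last first.
    by apply: sin_le_id; rewrite mulr_ge0// ltW.
  rewrite ler_piMl ?(ltW sp)// -expR0 ler_expR oppr_le0.
  by rewrite mulr_ge0.
by rewrite {2}/asin_h !mulr0 oppr0 expR0 cos0 sin0; lra.
Qed.

Lemma asin_h_continuous : continuous asin_h.
Proof. by move=> x; exact: der_continuous (asin_h_der x). Qed.

Definition asin_q (s : R) : R := s * (1 + 2 * s * c + s ^+ 2).

(** The integrand has an antiderivative of the same form, A, whose coefficients
    solve a linear system with determinant (s + c)^2 + d^2. *)
Lemma integral_asin_h (s : R) : 0 < s ->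
  (\int[@lebesgue_measure R]_(x in `[0%R, +oo[) (expR (- (s * x)) * asin_h x)%:E
    = ((asin_q s)^-1)%:E)%E.
Proof.
move=> s0; set g := s + c; pose Q := g ^+ 2 + d ^+ 2.
have Q0 : 0 < Q by rewrite ltr_pwDr ?sqr_ge0 ?exprn_gt0.
pose al := - (g + c) / Q; pose be := (d ^+ 2 - g * c) / (d * Q).
pose A x := - (s^-1 * expR (- (s * x)))
   - expR (- (g * x)) * (al * cos (d * x) + be * sin (d * x)).
have nz : [/\ s != 0, d != 0 & Q != 0] by rewrite !gt_eqF.
have [ns nd nQ] := nz.
rewrite (@integral_half_line _ _ A 0).
- rewrite /A !mulr0 oppr0 expR0 cos0 sin0 /al /g; congr EFin.
  have QE : Q = 1 + 2 * s * c + s ^+ 2 by rewrite /Q /g; have := cd; lra.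
  rewrite /asin_q -QE.
  transitivity ((Q - s * (s + 2 * c)) / (s * Q)); last first.
    by rewrite QE (_ : _ - _ = 1) ?mul1r//; ring.
  by field; rewrite ns nQ.
- by move=> x x0; rewrite mulr_ge0 ?expR_ge0// asin_h_ge0.
- move=> x; apply: cvgM; last exact: asin_h_continuous.
  apply: (@der_continuous _ (fun x => expR (- (s * x))) _ (expR (- (s * x)) * - (s * 1))).
  by apply: dereq; first (by der); rewrite /=; ring.
- move=> x; rewrite /A; apply: dereq; first by der.
  rewrite /=.
  have E : expR (- (g * x)) = expR (- (s * x)) * expR (- (c * x)).
    rewrite -expRD /g; congr expR; ring.
  have e1 : g * al - d * be = - 1.
    transitivity (- ((g ^+ 2 + d ^+ 2) / Q)); last by rewrite -/Q divff.
    by rewrite /al /be; field; rewrite nd nQ.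
  have e2 : g * be + d * al = - (c / d).
    transitivity (- (c / d * ((g ^+ 2 + d ^+ 2) / Q))); last by rewrite -/Q divff ?mulr1.
    by rewrite /al /be; field; rewrite nd nQ.
  transitivity (expR (- (s * x)) + expR (- (g * x)) *
    ((g * al - d * be) * cos (d * x) + (g * be + d * al) * sin (d * x))).
    by field.
  by rewrite e1 e2 E /asin_h; ring.
- have cE : (`|al| + `|be|) * expR (- (g * x)) @[x --> +oo] --> (0 : R).
    rewrite -[X in _ --> X](mulr0 (`|al| + `|be|)); apply: cvgM; first exact: cvg_cst.
    by apply: cvg_expN_pinfty; rewrite ltr_pwDl.
  rewrite /A -[X in _ --> X]subr0; apply: cvgB.
    rewrite -[X in _ --> X]oppr0; apply: cvgN.
    rewrite -[X in _ --> X](mulr0 s^-1); apply: cvgM; first exact: cvg_cst.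
    exact: cvg_expN_pinfty.
  apply: norm_cvg0; apply: (squeeze_cvgr _ (cvg_cst 0) cE).
  near=> x; rewrite normr_ge0/= normrM ger0_norm ?expR_ge0// mulrC.
  rewrite ler_wpM2r ?expR_ge0//.
  apply: le_trans (ler_normD _ _) _; rewrite !normrM.
  by apply: lerD; rewrite ler_piMr// ?cos_max ?sin_max.
Unshelve. all: by end_near. Qed.

(** The power with exponent - 2 makes the quotient by x^2 measurable at once; it
    vanishes at 0. *)
Definition asin_k (x : R) : R := asin_h x * x `^ (- 2).

Lemma sqr_powRN2 (x : R) : 0 < x -> x ^+ 2 * x `^ (- 2) = 1.
Proof.
move=> x0; rewrite -powR_mulrn ?(ltW x0)// -powRD; last by apply/implyP => _; rewrite gt_eqF.
by rewrite (_ : 2%:R + - 2 = 0) ?powRr0// subrr.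
Qed.

Lemma asin_kE x : 0 <= x -> x ^+ 2 * asin_k x = asin_h x.
Proof.
rewrite le_eqVlt => /predU1P[<-|x0].
  by rewrite expr0n/= mul0r /asin_h !mulr0 oppr0 expR0 cos0 sin0; ring.
by rewrite /asin_k mulrCA sqr_powRN2// mulr1.
Qed.

Lemma asin_k_ge0 x : 0 <= x -> 0 <= asin_k x.
Proof. by move=> x0; rewrite mulr_ge0 ?powR_ge0// asin_h_ge0. Qed.

Lemma asin_k_le x : 0 <= x -> asin_k x <= 2^-1.
Proof.
rewrite le_eqVlt => /predU1P[<-|x0].
  by rewrite /asin_k powR0 ?mulr0// oppr_eq0.
have x2 : 0 < x ^+ 2 by rewrite exprn_gt0.
by rewrite -(ler_pM2l x2) (asin_kE (ltW x0)) asin_h_le ?(ltW x0).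
Qed.

(** The measure with density [asin_k] has finite transform because the density is
    bounded, and the second moment of its tilt is the transform of [asin_h]. *)
Lemma isID_arcsine (L G : R -> R) :
  (forall s, 0 < s -> deriv1 L s (G s)) ->
  (forall s, 0 < s -> deriv1 G s (asin_q s)^-1) -> isID L.
Proof.
move=> dL dG.
have mh : measurable_fun [set: R] asin_h.
  by apply: continuous_measurable_fun; exact: asin_h_continuous.
have mk : measurable_fun [set: R] asin_k.
  by apply: measurable_funM => //; exact: measurable_powR.
have [kappa kI] := half_line_density mk asin_k_ge0.
have fin s : 0 < s -> (laplace kappa s < +oo)%E.
  move=> s0; rewrite /laplace kI; last 2 first.
  - exact: (measurable_expN s).
  - by move=> x; rewrite expR_ge0.
  apply: (@le_lt_trans _ _ (\int[@lebesgue_measure R]_(x in `[0%R, +oo[) (expR (- (s * x)))%:E)%E).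
    apply: ge0_le_integral => //.
    - move=> x; rewrite /= in_itv/= andbT => x0.
      by rewrite lee_fin mulr_ge0 ?expR_ge0// asin_k_ge0.
    - apply/measurable_funTS/measurable_EFinP/measurable_funM => //.
      exact: (measurable_expN s).
    - by apply: measurable_funTS; exact: (measurable_EexpN s).
    - move=> x; rewrite /= in_itv/= andbT => x0; rewrite lee_fin ler_piMr ?expR_ge0//.
      by apply: le_trans (asin_k_le x0) _; rewrite invf_le1// ler1n.
  by rewrite integral_expN// ltry.
apply: (isID_mom2 fin dL) => s s0.
suff -> : mom kappa 2 s = (asin_q s)^-1 by exact: dG.
apply: EFin_inj; rewrite -integral_asin_h//.
rewrite /mom /Rintegral fineK; last first.
  apply: (integrable_fin_num measurableT); apply: integrable_momfun.
  apply/lapdomP; exists (s / 2); first by rewrite divr_gt0.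
  by split; apply: fin; lra.
rewrite kI; last 2 first.
- exact: measurable_momfun.
- by move=> x; rewrite mulr_ge0 ?sqr_ge0 ?expR_ge0.
apply: eq_integral => x; rewrite inE/= in_itv/= andbT => x0.
by rewrite /momfun -(asin_kE x0); congr EFin; ring.
Qed.

End arcsine.

(** * Transforms on a bounded interval and on the line *)

Section two_sided.
Context {R : realType}.

(** Two copies of the measure with exponent s ln s are convolved, one of them after
    the reflection x |-> - x and a tilt by N, which turn s into N - s. *)
Lemma laplace_binomial_dual (N : R) : 0 < N ->
  exists nu : {measure set (measurableTypeR R) -> \bar R}, forall s, 0 < s -> s < N ->
    laplace nu s = (expR (s * ln s + (N - s) * ln (N - s)))%:E.
Proof.
move=> N0; have [nu1 h1] := isID_landau (@ler01 R).
have [rho h2] := laplace_affine nu1 (-1) 0.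
have [nu2 [_ [_ h3]]] := laplace_tilt rho (- N) (@ler01 R).
have h4 s : s < N -> laplace nu2 s = (expR ((N - s) * ln (N - s)))%:E.
  move=> sN; rewrite h3 h2 mulr0 oppr0 expR0 !mul1e.
  rewrite (_ : -1 * (s - N) = N - s); last by ring.
  by rewrite h1 ?subr_gt0// mul1r.
have [||nu h] := @laplace_convolution _ nu1 nu2.
- by exists 1; rewrite h1// ltry.
- by exists 0; rewrite h4// ltry.
exists nu => s s0 sN; rewrite h h1// h4// -EFinM -expRD mul1r.
by [].
Qed.

(** Completing the square. *)
Lemma laplace_gaussian (sg : R) : sg != 0 ->
  exists nu : {measure set (measurableTypeR R) -> \bar R}, forall s,
    laplace nu s = (expR (2^-1 * sg ^+ 2 * s ^+ 2))%:E.
Proof.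
move=> sg0.
have mpdf : measurable_fun [set: measurableTypeR R] (normal_pdf 0 sg : measurableTypeR R -> R).
  exact: measurable_normal_pdf.
have [nu [_ nuI]] := density_measure (@lebesgue_measure R) mpdf (normal_pdf_ge0 0 sg).
exists nu => s; rewrite /laplace nuI; last 2 first.
- exact: measurable_EexpN.
- by move=> x; rewrite lee_fin expR_ge0.
transitivity (\int[@lebesgue_measure R]_x ((expR (2^-1 * sg ^+ 2 * s ^+ 2))%:E *
    (normal_pdf (- (sg ^+ 2 * s)) sg x)%:E))%E.
  apply: eq_integral => x _; rewrite -!EFinM; congr EFin.
  rewrite !normal_pdfE// mulrCA [RHS]mulrCA -!expRD; congr (_ * expR _).
  by field.
have mE : measurable_fun [set: measurableTypeR R]
    (fun x : measurableTypeR R => (normal_pdf (- (sg ^+ 2 * s)) sg x)%:E).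
  by apply/measurable_EFinP; exact: measurable_normal_pdf.
have pE (x : measurableTypeR R) : [set: measurableTypeR R] x ->
    (0 <= (normal_pdf (- (sg ^+ 2 * s)) sg x)%:E)%E.
  by move=> _; rewrite lee_fin normal_pdf_ge0.
rewrite (ge0_integralZl _ measurableT mE pE) ?lee_fin ?expR_ge0//.
by rewrite integral_normal_pdf mule1.
Qed.

End two_sided.

(** * Boundary of the domain of the means *)

Section boundaries.
Context {R : realType}.

Lemma closure_itvoy (b : R) : closure `]b, +oo[%classic b.
Proof.
move=> A /nbhs_ballP[e /= e0 sub]; exists (b + e / 2); split.
  by rewrite /= in_itv/= andbT ltrDl divr_gt0.
apply: sub; rewrite /ball/= opprD addNKr normrN gtr0_norm ?divr_gt0//.
by rewrite ltr_pdivrMr// ltr_pMr// ltr1n.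
Qed.

Lemma singular_boundary_oy (V : R -> R) : V 0 = 0 -> {for 0, continuous V} ->
  singular_boundary `]0, +oo[%classic V.
Proof.
move=> V0 cV x /=; rewrite in_itv/= andbT => /negP; rewrite -leNgt => x0.
exists 0; split => //; last exact: closure_itvoy.
by move=> d; rewrite /= in_itv/= andbT => d0; right; rewrite x0 ltW.
Qed.

Lemma closure_itvoo (a b : R) : a < b ->
  closure `]a, b[%classic a /\ closure `]a, b[%classic b.
Proof.
move=> ab.
have H (e : R) : 0 < e -> exists2 t, 0 < t & t < e /\ t < b - a.
  move=> e0; exists (Num.min e (b - a) / 2).
    by rewrite divr_gt0// lt_min e0 subr_gt0.
  have m0 : 0 < Num.min e (b - a) by rewrite lt_min e0 subr_gt0.
  have h : Num.min e (b - a) / 2 < Num.min e (b - a).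
    by rewrite ltr_pdivrMr// ltr_pMr// ltr1n.
  by split; apply: lt_le_trans h _; rewrite ge_min lexx ?orbT.
split; move=> A /nbhs_ballP[e /= e0 sub]; have [t t0 [te tb]] := H e e0.
  exists (a + t); split; first by rewrite /= in_itv/=; lra.
  by apply: sub; rewrite /ball/= opprD addNKr normrN gtr0_norm.
exists (b - t); split; first by rewrite /= in_itv/=; lra.
by apply: sub; rewrite /ball/= (_ : b - (b - t) = t) ?gtr0_norm//; ring.
Qed.

Lemma singular_boundary_oo (b : R) (V : R -> R) : 0 < b -> V 0 = 0 -> V b = 0 ->
  continuous V -> singular_boundary `]0, b[%classic V.
Proof.
move=> b0 V0 Vb cV x /=; rewrite in_itv/= => /negP; rewrite negb_and -!leNgt => /orP[x0|bx].
  exists 0; split => //; [|exact: cV|exact: (closure_itvoo b0).1].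
  by move=> d; rewrite /= in_itv/= => /andP[d0 _]; right; rewrite x0 ltW.
exists b; split => //; [|exact: cV|exact: (closure_itvoo b0).2].
by move=> d; rewrite /= in_itv/= => /andP[_ d0]; left; rewrite bx ltW.
Qed.

Lemma singular_boundaryT (V : R -> R) : singular_boundary [set: R] V.
Proof. by move=> x /(_ Logic.I). Qed.

End boundaries.

(** * Translated families *)

Section hyperbolic.
Context {R : realType}.
Implicit Types mu nu : {measure set (measurableTypeR R) -> \bar R}.

Lemma laplace_of_tilt mu (P : probability (measurableTypeR R) R) s t : lapdom mu s ->
  (forall A : set (measurableTypeR R), measurable A -> P A = tilt mu s A) ->
  (laplace P t = (expR (- ell mu s))%:E * laplace mu (t + s))%E.
Proof.
move=> Ds hP.
have [nu [nuA [_ rel]]] := laplace_tilt mu s (expR_ge0 (- ell mu s)).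
rewrite -rel; apply: eq_measure_integral => A mA _.
transitivity (tilt mu s A); first exact: hP.
rewrite nuA; apply: eq_integral => x _.
by rewrite -expRD; congr (expR _)%:E; ring.
Qed.

Lemma laplace_of_translate (P Q : probability (measurableTypeR R) R) (b t : R) :
  (forall A : set (measurableTypeR R), measurable A -> Q A = P [set x | A (x + b)]) ->
  (laplace Q t = (expR (- (t * b)))%:E * laplace P t)%E.
Proof.
move=> hQ.
pose tr (x : measurableTypeR R) : measurableTypeR R := x + b.
have mp : measurable_fun [set: measurableTypeR R] tr by exact: measurable_funD.
transitivity (\int[pushforward P tr]_y (expR (- (t * y)))%:E)%E.
  by apply: eq_measure_integral => A mA _; exact: hQ.
rewrite laplace_pushforward// /laplace -ge0_integralZl//; last exact: measurable_EexpN.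
by apply: eq_integral => x _; rewrite -EFinM -expRD; congr (expR _)%:E; rewrite /tr; ring.
Qed.

Lemma probability_of d (T : measurableType d) (m : {measure set T -> \bar R}) :
  m setT = 1%E -> exists P : probability T R, forall A, P A = m A.
Proof.
case: m => m cm mT.
pose H := Measure_isProbability.Build _ _ _ (Measure.Pack cm) mT.
pose P : probability T R := HB.pack m cm H.
by exists P.
Qed.

(** A tilt of total mass 1 is packaged as a probability. *)
Lemma NEF_nonempty mu : calM mu -> NEF mu !=set0.
Proof.
move=> [muM [s Ds]].
have [nu [nuA _]] := laplace_tilt mu s (expR_ge0 (- ell mu s)).
have nuE A : nu A = tilt mu s A.
  rewrite nuA; apply: eq_integral => x _.
  by rewrite -expRD; congr (expR _)%:E; ring.
have nu1 : nu setT = 1%E.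
  rewrite nuA.
  transitivity ((expR (- ell mu s))%:E * laplace mu s)%E.
    rewrite /laplace -ge0_integralZl ?lee_fin ?expR_ge0//.
    exact: measurable_EexpN.
  have m0 := mom0_gt0 muM Ds.
  by rewrite laplace_mom// ellE// -EFinM expRN lnK ?posrE// mulVf// gt_eqF.
have [P PE] := probability_of nu1.
by exists P, s => // A mA; rewrite PE nuE.
Qed.

(** A common member of the two families is on the one side a tilt of [nu], on the
    other a translate of a tilt of [mu]; comparing the two expressions of its
    transform gives the relation. *)
Lemma laplace_same_TEF mu nu : calM nu -> (TEF (NEF nu) `<=` TEF (NEF mu)) ->
  exists a c b, forall t, (laplace nu t = (expR (a + c * t))%:E * laplace mu (t + b))%E.
Proof.
move=> cn sub; have [P NP] := NEF_nonempty cn.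
have [s Ds hP] := NP.
have [Q [s' Ds' hQ] [b hb]] : TEF (NEF mu) P.
  by apply: sub; exists P => //; exists 0 => A mA; congr (P _); apply/seteqP; split => x /=; rewrite addr0.
exists (ell nu s - ell mu s' + s * b), (- b), (s' - s) => t.
have := laplace_of_tilt (t - s) Ds hP; rewrite subrK => E1.
have := laplace_of_tilt (t - s) Ds' hQ => E2.
have := laplace_of_translate (t - s) hb => E3.
have E4 : (laplace nu t = (expR (ell nu s))%:E * laplace P (t - s))%E.
  by rewrite E1 muleA -EFinM -expRD subrr expR0 mul1e.
rewrite E4 E3 E2 !muleA -!EFinM -!expRD.
congr ((expR _)%:E * laplace mu _)%E; ring.
Qed.

End hyperbolic.

(** * The hyperbolic family *)

Section poly_moments.
Context {R : realType}.
Variable mu : {measure set (measurableTypeR R) -> \bar R}.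

Lemma deriv_uniq (f g : R -> R) s a b : (forall t, f t = g t) ->
  deriv1 f s a -> deriv1 g s b -> a = b.
Proof. by move=> /funext <- [_ <-] [_ <-]. Qed.

(** Write f k for the k-th moment of the tilt and E = f 2 f 0 - f 1 ^ 2, so that
    (1 + s^2) E = f 0 ^ 2. This equation and its first two derivatives at s = 0 give
    f 2, f 3 and f 4; the law at s = 0, of mean m, has variance 1 and centred fourth
    moment 1, so ((x - m)^2 - 1)^2 has integral 0. Hence (x - m)^2 = 1 almost
    everywhere, f 2 is a combination of f 1 and f 0 for every s, and the equations
    at s = 1 contradict each other. *)
Lemma no_cauchy_variance : (forall a : R, mu (~` [set a]) != 0%E) ->
  (forall s, lapdom mu s) -> ~ (forall s, mvar mu s * (1 + s ^+ 2) = 1).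
Proof.
move=> muM dom hv.
have [f fE] : exists f : nat -> R -> R, f = mom mu by exists (mom mu).
have df k s : deriv1 (f k) s (- f k.+1 s) by rewrite fE; exact: der_mom.
have f0 s : 0 < f 0%N s by rewrite fE; exact: mom0_gt0.
have [E Edef] : exists E : R -> R, E = fun s => f 2%N s * f 0%N s - f 1%N s * f 1%N s.
  by exists (fun s => f 2%N s * f 0%N s - f 1%N s * f 1%N s).
have dE s : deriv1 E s (- f 3%N s * f 0%N s + f 1%N s * f 2%N s).
  rewrite Edef; apply: dereq; first by apply: derD; [|apply: derN]; apply: derM; exact: df.
  by rewrite /=; ring.
have ddE s : deriv1 (fun s => - f 3%N s * f 0%N s + f 1%N s * f 2%N s) s (f 4%N s * f 0%N s - f 2%N s ^+ 2).
  apply: dereq.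
    by apply: derD; apply: derM; do ?[apply: derN]; exact: df.
  by rewrite /=; ring.
have id0 s : (1 + s ^+ 2) * E s = f 0%N s ^+ 2.
  have := hv s; rewrite /mvar -fE => h.
  transitivity (f 0%N s ^+ 2 * ((f 2%N s / f 0%N s - (f 1%N s / f 0%N s) ^+ 2) * (1 + s ^+ 2))).
    by rewrite Edef; field; rewrite gt_eqF//; exact: f0.
  by rewrite h mulr1.
have id1 s : 2 * s * E s + (1 + s ^+ 2) * (- f 3%N s * f 0%N s + f 1%N s * f 2%N s) = - 2 * f 0%N s * f 1%N s.
  apply: (deriv_uniq (s := s) id0).
    apply: dereq; first by apply: derM; [der|exact: dE].
    by rewrite /=; ring.
  apply: dereq; first by apply: derX; exact: df.
  by rewrite /=; ring.
have id2 s : 2 * E s + 4 * s * (- f 3%N s * f 0%N s + f 1%N s * f 2%N s) +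
    (1 + s ^+ 2) * (f 4%N s * f 0%N s - f 2%N s ^+ 2) = 2 * f 1%N s ^+ 2 + 2 * f 0%N s * f 2%N s.
  apply: (deriv_uniq (s := s) id1).
    apply: dereq.
      apply: derD; apply: derM; first by der.
      - exact: dE.
      - by der.
      - exact: ddE.
    by rewrite /=; ring.
  apply: dereq.
    apply: derM; last exact: df.
    by apply: derM; [exact: dercst|exact: df].
  by rewrite /=; ring.
pose m := f 1%N 0 / f 0%N 0.
have f1E : f 1%N 0 = m * f 0%N 0 by rewrite /m divfK// gt_eqF.
have nz : f 0%N 0 != 0 by rewrite gt_eqF.
have f2E : f 2%N 0 = (1 + m ^+ 2) * f 0%N 0.
  have := id0 0; rewrite expr0n/= addr0 mul1r Edef f1E => h.
  by apply: (mulIf nz); rewrite -[LHS](subrK (m * f 0%N 0 * (m * f 0%N 0))) h; ring.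
have f3E : f 3%N 0 = (m ^+ 3 + 3 * m) * f 0%N 0.
  have := id1 0; rewrite expr0n/= addr0 mulr0 mul0r add0r mul1r f1E f2E => h.
  apply: (mulIf nz); apply: oppr_inj.
  rewrite -mulNr -[LHS](addrK (m * f 0%N 0 * ((1 + m ^+ 2) * f 0%N 0))) h; ring.
have f4E : f 4%N 0 = (m ^+ 4 + 6 * m ^+ 2 + 1) * f 0%N 0.
  have := id2 0; rewrite expr0n/= addr0 mulr0 mul0r addr0 mul1r Edef f1E f2E => h.
  apply: (mulIf nz).
  have := h; set X := f 4%N 0 * f 0%N 0; move=> h'.
  by rewrite -[LHS](subrK (((1 + m ^+ 2) * f 0%N 0) ^+ 2)) -[X in X + _](addKr
     (2 * ((1 + m ^+ 2) * f 0%N 0 * f 0%N 0 - m * f 0%N 0 * (m * f 0%N 0)))) h'; ring.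
(* [cq] and [c2] below list the coefficients of ((x - m)^2 - 1)^2 and
   (x - m)^2 - 1. *)
pose q x : R := ((x - m) ^+ 2 - 1) ^+ 2 * expR (- (0 * x)).
pose cq : nat -> R := nth 0 [:: (m ^+ 2 - 1) ^+ 2; - 4 * m ^+ 3 + 4 * m; 6 * m ^+ 2 - 2; - 4 * m; 1].
have [iq eq_] := mom_sum 5 cq (dom 0); rewrite -fE in eq_.
have qE : q = (fun x => \sum_(i < 5) cq i * momfun i 0 x).
  apply/funext => x; rewrite !big_ord_recr big_ord0/= /cq/= /q /momfun; ring.
have q0 x : 0 <= q x by rewrite mulr_ge0 ?sqr_ge0 ?expR_ge0.
have qI : \int[mu]_x q x = 0.
  rewrite qE eq_ !big_ord_recr big_ord0/= /cq/=.
  rewrite f4E f3E f2E f1E; ring.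
rewrite -qE in iq.
have ae := ae_zero_of_integral iq q0 qI.
have rel s : f 2%N s = 2 * m * f 1%N s + (1 - m ^+ 2) * f 0%N s.
  pose c2 : nat -> R := nth 0 [:: m ^+ 2 - 1; - 2 * m; 1].
  have [i2 e2] := mom_sum 3 c2 (dom s); rewrite -fE in e2.
  have : \int[mu]_x (\sum_(i < 3) c2 i * momfun i s x) = 0.
    rewrite /Rintegral; suff -> : (\int[mu]_x (\sum_(i < 3) c2 i * momfun i s x)%R%:E = 0)%E by [].
    rewrite -(integral0 mu setT); apply: ae_eq_integral => //.
      exact: (measurable_int mu i2).
    apply: filterS ae => x qx _ /=; congr EFin.
    have px : (x - m) ^+ 2 - 1 = 0.
      move/eqP : qx; rewrite /q mulf_eq0 sqrf_eq0 => /orP[/eqP//|].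
      by rewrite gt_eqF// expR_gt0.
    rewrite !big_ord_recr big_ord0/= /c2/= /momfun.
    transitivity (((x - m) ^+ 2 - 1) * expR (- (s * x))); first by ring.
    by rewrite px mul0r.
  rewrite e2 !big_ord_recr big_ord0/= /c2/= => h.
  by rewrite -[LHS]subr0 -h; ring.
have EE s : E s = f 0%N s ^+ 2 - (f 1%N s - m * f 0%N s) ^+ 2.
  by rewrite Edef rel; ring.
(* With g = f 1 - m f 0 one has E = f 0 ^ 2 - g ^ 2 and f 0 * g = - s E; at s = 1,
   where f 0 ^ 2 = 2 E, this gives g ^ 2 = E and E ^ 2 = 2 E ^ 2. *)
have g1 : f 0%N 1 * (f 1%N 1 - m * f 0%N 1) = - E 1.
  have : - f 3%N 1 * f 0%N 1 + f 1%N 1 * f 2%N 1 = - 2 * m * E 1.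
    apply: (deriv_uniq EE (dE 1)).
    apply: dereq.
      apply: derD; first by apply: derX; exact: df.
      apply: derN; apply: derX; apply: derD; first exact: df.
      by apply: derN; apply: derM; [exact: dercst|exact: df].
    by rewrite /= EE rel; ring.
  have := id1 1; have := id0 1; rewrite expr1n => h0 h1 h2.
  move: h1; rewrite h2 => h1.
  have : - 2 * f 0%N 1 * f 1%N 1 = 2 * E 1 - 2 * m * f 0%N 1 ^+ 2 by rewrite -h1 -h0; ring.
  by lra.
have E0 : 0 < E 1.
  have := id0 1; rewrite expr1n => h.
  have : 0 < (1 + 1) * E 1 by rewrite h exprn_gt0.
  by rewrite pmulr_rgt0.
have h0 := id0 1; rewrite expr1n in h0.
have h1 := EE 1.
have : E 1 ^+ 2 = 2 * E 1 ^+ 2.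
  rewrite -[LHS]sqrrN -g1 exprMn -h0.
  have -> : (f 1%N 1 - m * f 0%N 1) ^+ 2 = E 1 by lra.
  ring.
have : 0 < E 1 ^+ 2 by rewrite exprn_gt0.
lra.
Qed.

End poly_moments.

Section no_dual.
Context {R : realType}.

(** The means of a generating measure fill the line, so the transform of a dual
    measure is finite everywhere, and the chain rule applied to the duality relation
    gives its variance as the reciprocal of (m + c)^2 + 1; a tilt by - c recentres
    it. *)
Theorem hyperbolic_no_dual (mu0 : {measure set (measurableTypeR R) -> \bar R}) :
  calM mu0 -> has_varfun mu0 setT (fun m => m ^+ 2 + 1) -> ~ has_dual (TEF (NEF mu0)).
Proof.
move=> cM [md vf] [mu [mus [[cmu TE] [cms dual]]]].
have sub : TEF (NEF mu) `<=` TEF (NEF mu0) by rewrite TE.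
have [a [c [b rel]]] := laplace_same_TEF cmu sub.
have muM0 := cM.1; have muM := cmu.1; have musM := cms.1.
have onto m : exists2 t, lapdom mu t & mean mu t = m.
  have : meandom mu0 (m + c) by rewrite md.
  move=> [t Dt tm]; exists (t - b); first exact: (lapdom_relB rel).
  by rewrite (mean_relB muM0 muM rel Dt) tm addrK.
have var_mu t : lapdom mu t -> mvar mu t = (mean mu t + c) ^+ 2 + 1.
  move=> Dt; have /(lapdom_rel rel) Dt' := Dt.
  rewrite (mvar_rel muM0 muM rel Dt) (mean_rel muM0 muM rel Dt) subrK.
  by rewrite -(varfun_mean muM0 Dt') vf.
have dom m : lapdom mus m.
  by have [t Dt <-] := onto m; have [] := dual t Dt.
have var_mus m : mvar mus m * ((m + c) ^+ 2 + 1) = 1.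
  have [t Dt tm] := onto m.
  rewrite -tm -(var_mu t Dt).
  have h1 : is_derive t 1 (fun u => mean mus (mean mu u)) (- mvar mus (mean mu t) * - mvar mu t).
    apply: (dercomp (h := mean mus)).
      by rewrite /deriv1; exact: (der_mean musM (dom _)).
    by rewrite /deriv1; exact: (der_mean muM Dt).
  have h2 : is_derive t 1 (fun u => mean mus (mean mu u)) 1.
    apply: (@near_eq_is_derive R R R (fun u => u)).
      near=> u; have Du : lapdom mu u by near: u; exact: near_lapdom.
      by have [_ ->] := dual u Du.
  have [_ <-] := h2; have [_ ->] := h1.
  by rewrite mulrNN.
have [nu [cnu _ rel2]] := tilt_family (- c) (@ltr01 R) cms.
have Dnu s : lapdom nu s by apply/(lapdom_rel rel2); exact: dom.
apply: (no_cauchy_variance cnu.1 Dnu) => s.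
rewrite (mvar_rel musM cnu.1 rel2 (Dnu s)).
by rewrite -[RHS](var_mus (s - c)) subrK [s ^+ 2 + 1]addrC.
Unshelve. all: by end_near. Qed.

End no_dual.

(** * Duality with explicit transforms *)

Section cases.
Context {R : realType}.
Implicit Types mu nu : {measure set (measurableTypeR R) -> \bar R}.

Lemma dual_pairP mu0 mu nu : calM mu -> calM nu -> NEF mu = NEF mu0 -> dual_measure mu nu ->
  dual_pair (NEF mu0) mu nu /\ has_dual (TEF (NEF mu0)).
Proof.
move=> cmu cnu NE dm.
have gen : generates mu (TEF (NEF mu0)) by split; [exact: cmu|rewrite NE].
split; last by exists mu, nu; split; [exact: gen|exact: dm].
split; [exact: cmu|exact: cnu|exact: NE|by rewrite NE|].
by exists mu, nu; split; [exact: gen|exact: dm|].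
Qed.

Variables (mu0 nu : {measure set (measurableTypeR R) -> \bar R}).
Variables (D : set R) (V L G : R -> R).
Hypothesis cM : calM mu0.
Hypothesis vM : has_varfun mu0 D V.
Hypothesis oD : open D.
Hypothesis lapE : forall s, D s -> laplace nu s = (expR (L s))%:E.
Hypothesis dL : forall s, D s -> deriv1 L s (G s).
Hypothesis dG : forall s, D s -> deriv1 G s (V s)^-1.
Hypothesis bD : singular_boundary D V.

Lemma dual_case : has_dual (TEF (NEF mu0)) /\
  exists mu, [/\ dual_pair (NEF mu0) mu nu, dual_measure mu nu, has_varfun mu D V &
    has_laplace nu D (fun s => expR (L s))].
Proof.
have [mu [cmu cnu NE vmu [dm lD _ _ _]]] := dual_family cM vM oD lapE dL dG bD.
have [dp hd] := dual_pairP cmu cnu NE dm.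
split; first exact: hd.
by exists mu; split; [exact: dp|exact: dm|exact: vmu|split; [exact: lD|exact: lapE]].
Qed.

(** When [k] solves G (k s) = - s it is the mean of the measure constructed by
    duality, so the logarithm of its transform differs by a constant from the
    antiderivative [b] of - k; a rescaling makes them equal. *)
Lemma dual_case_explicit (S : set R) (b k W : R -> R) :
  (forall m, D m -> S (- G m)) ->
  (forall s, S s -> [/\ deriv1 b s (- k s), D (k s) & G (k s) = - s]) ->
  (forall x, D x -> W (- G x) = (V x)^-1) ->
  has_dual (TEF (NEF mu0)) /\
  exists mu, [/\ dual_pair (NEF mu0) mu nu, has_varfun mu D V,
    has_laplace mu S (fun s => expR (b s)),
    forall m, meandom nu m -> varfun nu m = W m &
    has_laplace nu D (fun s => expR (L s))].
Proof.
move=> GS hb hW.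
have [mu [cmu cnu NE vmu [dm lD domE Gmean hv]]] := dual_family cM vM oD lapE dL dG bD.
have muM := cmu.1; have [muD _] := vmu.
have SE : lapdom mu = S.
  apply/seteqP; split => s.
    by move/domE => [m Dm ->]; exact: GS.
  by move=> /hb[_ Dk Gk]; apply/domE; exists (k s); rewrite ?Gk ?opprK.
have mk s : lapdom mu s -> mean mu s = k s.
  rewrite SE => /hb[_ Dk Gk].
  have : meandom mu (k s) by rewrite muD.
  move=> [t Dt tk]; have [_] := Gmean t Dt.
  by rewrite tk Gk => /oppr_inj e; rewrite -tk e.
have [s0 Ds0] := cmu.2.
pose K := ell mu s0 - b s0.
have KE s : lapdom mu s -> ell mu s - b s = K.
  move=> Ds; apply: (@const_of_deriv0 _ (lapdom mu) (fun s => ell mu s - b s)) => //.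
    by move=> a t c Da Dc at_ tc; exact: lapdom_between at_ tc Da Dc.
  move=> {s Ds} s Ds.
  have [db _ _] : [/\ deriv1 b s (- k s), D (k s) & G (k s) = - s] by apply: hb; rewrite -SE.
  apply: dereq.
    by apply: derD; [exact: (der_ell muM Ds)|apply: derN; exact: db].
  by rewrite -(meanE muM Ds) mk// subrr.
have [mu2 [cmu2 NE2 rel]] := tilt_family 0 (expR_gt0 (- K)) cmu.
have mu2M := cmu2.1.
have dom2 s : lapdom mu2 s <-> lapdom mu s.
  by have := lapdom_rel rel s; rewrite addr0.
have mean2 s : lapdom mu2 s -> mean mu2 s = mean mu s.
  by move=> Ds; have := mean_rel muM mu2M rel Ds; rewrite addr0 subr0.
have dm2 : dual_measure mu2 nu.
  split; first exact: cnu.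
  by move=> s Ds; rewrite (mean2 s Ds); apply: dm.2; apply/dom2.
have [dp hd] := dual_pairP cmu2 cnu (etrans NE2 NE) dm2.
split; first exact: hd.
exists mu2; split; [exact: dp|exact: (has_varfun_rel muM mu2M rel)| | |].
- split.
    by rewrite -SE; apply/seteqP; split => s /dom2.
  move=> s Ss; have Ds : lapdom mu s by rewrite SE.
  rewrite rel addr0 laplace_mom// -EFinM expRK mul0r addr0.
  rewrite -[mom mu 0 s]lnK ?posrE ?mom0_gt0// -ellE// -expRD.
  by congr (expR _)%:E; rewrite -(KE s Ds); ring.
- move=> m [x]; rewrite lD => Dx <-.
  by have [-> ->] := hv x Dx; rewrite hW.
- by split; [exact: lD|exact: lapE].
Qed.

End cases.

Section powers.
Context {R : realType}.

Lemma powR_expln (x y : R) : 0 < x -> x `^ y = expR (y * ln x).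
Proof. by move=> x0; rewrite /powR gt_eqF. Qed.

Lemma has_laplace_eq (nu : {measure set (measurableTypeR R) -> \bar R}) D (B C : R -> R) :
  (forall s, D s -> B s = C s) -> has_laplace nu D B -> has_laplace nu D C.
Proof. by move=> BC [h1 h2]; split => // s Ds; rewrite h2// BC. Qed.

Lemma oy_gt0 (s : R) : `]0, +oo[%classic s -> 0 < s.
Proof. by rewrite /= in_itv/= andbT. Qed.

Lemma gt0_oy (s : R) : 0 < s -> `]0, +oo[%classic s.
Proof. by rewrite /= in_itv/= andbT. Qed.

Lemma oo_gt0 (s b : R) : `]0, b[%classic s -> 0 < s /\ s < b.
Proof. by rewrite /= in_itv/= => /andP[]. Qed.

Lemma gt0_oo (s b : R) : 0 < s -> s < b -> `]0, b[%classic s.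
Proof. by move=> s0 sb; rewrite /= in_itv/= s0. Qed.

Lemma cosh_sqr (x : R) : 4 * cosh (x / 2) ^+ 2 = expR x + expR (- x) + 2.
Proof.
have e1 : expR x = expR (x / 2) ^+ 2 by rewrite expr2 -expRD -splitr.
have e2 : expR (- x) = expR (- (x / 2)) ^+ 2.
  by rewrite expr2 -expRD; congr expR; field.
have e3 : expR (x / 2) * expR (- (x / 2)) = 1 by rewrite -expRD subrr expR0.
rewrite e1 e2 /cosh.
transitivity (expR (x / 2) ^+ 2 + expR (- (x / 2)) ^+ 2 + 2 * (expR (x / 2) * expR (- (x / 2)))).
  by field.
by rewrite e3 mulr1.
Qed.

Lemma sinh_sqr (x : R) : 4 * sinh (x / 2) ^+ 2 = expR x + expR (- x) - 2.
Proof.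
have e1 : expR x = expR (x / 2) ^+ 2 by rewrite expr2 -expRD -splitr.
have e2 : expR (- x) = expR (- (x / 2)) ^+ 2.
  by rewrite expr2 -expRD; congr expR; field.
have e3 : expR (x / 2) * expR (- (x / 2)) = 1 by rewrite -expRD subrr expR0.
rewrite e1 e2 /sinh.
transitivity (expR (x / 2) ^+ 2 + expR (- (x / 2)) ^+ 2 - 2 * (expR (x / 2) * expR (- (x / 2)))).
  by field.
by rewrite e3 mulr1.
Qed.

End powers.

(** * The individual families *)

Section families.
Context {R : realType}.
Variable mu0 : {measure set (measurableTypeR R) -> \bar R}.
Hypothesis cM : calM mu0.
Local Notation F := (NEF mu0).

Ltac continuous_poly := apply: der_continuous; der.

Lemma isID_measure (L : R -> R) : isID L ->
  exists nu : {measure set (measurableTypeR R) -> \bar R},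
    forall s, `]0, +oo[%classic s -> laplace nu s = (expR (L s))%:E.
Proof.
move=> h; have [nu hn] := h 1 ler01.
by exists nu => s /oy_gt0 s0; rewrite hn// mul1r.
Qed.

Lemma open_oy : open (`]0, +oo[%classic : set R).
Proof. exact: interval_open. Qed.

Lemma open_oo (b : R) : open (`]0, b[%classic : set R).
Proof. exact: interval_open. Qed.

Lemma poisson_case : has_varfun mu0 `]0, +oo[ (fun m => m) ->
    has_dual (TEF F) /\
    exists mu nu, [/\ dual_pair F mu nu,
      has_varfun mu `]0, +oo[ (fun m => m),
      has_laplace mu setT (fun s => expR (expR (- s))),
      forall m, meandom nu m -> varfun nu m = expR m &
      has_laplace nu `]0, +oo[ (fun s => expR (- s) * s `^ s)].
Proof.
move=> vM.
have [|nu lapE] := @isID_measure (fun s => s * ln s + (-1 * s + 0)).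
  by apply: isIDD; [exact: isID_landau|exact: isID_affine].
have [||||||hd [mu [h1 h2 h3 h4 h5]]] := @dual_case_explicit _ mu0 nu _ _ _ (fun s => ln s) cM vM
   open_oy lapE _ _ _ setT (fun s => expR (- s)) (fun s => expR (- s)) (fun m => expR m).
- move=> s /oy_gt0 s0; rewrite /deriv1; apply: dereq; first by der.
  by rewrite /=; field; rewrite gt_eqF.
- move=> s /oy_gt0 s0; rewrite /deriv1; apply: dereq; first by der.
  by rewrite /= mulr1.
- apply: singular_boundary_oy => //; continuous_poly.
- by [].
- move=> s _; split; first by rewrite /deriv1; apply: dereq; [der|rewrite /=; ring].
    by apply: gt0_oy; exact: expR_gt0.
  by rewrite expRK.
- by move=> x /oy_gt0 x0; rewrite expRN lnK ?posrE.
split => //; exists mu, nu; split => //.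
apply: has_laplace_eq h5 => s /oy_gt0 s0.
by rewrite powR_expln// -expRD; congr expR; ring.
Qed.

Lemma binomial_case (N : nat) : (0 < N)%N ->
    has_varfun mu0 `]0, N%:R[ (fun m => m - m ^+ 2 / N%:R) ->
    has_dual (TEF F) /\
    exists mu nu, [/\ dual_pair F mu nu,
      has_varfun mu `]0, N%:R[ (fun m => m - m ^+ 2 / N%:R),
      has_laplace mu setT (fun s => (1 + expR (- s)) ^+ N),
      forall m, meandom nu m ->
        varfun nu m = 4 / N%:R * cosh (m / 2) ^+ 2 &
      has_laplace nu `]0, N%:R[
        (fun s => s `^ s * (N%:R - s) `^ (N%:R - s))].
Proof.
move=> N_gt0 vM; have N0 : 0 < N%:R :> R by rewrite ltr0n.
have VE (s : R) : s - s ^+ 2 / N%:R = s * (N%:R - s) / N%:R by field; rewrite gt_eqF.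
have [nu nuE] := laplace_binomial_dual N0.
have lapE s : `]0, N%:R[%classic s ->
    laplace nu s = (expR (s * ln s + (N%:R - s) * ln (N%:R - s)))%:E.
  by move=> /oo_gt0[s0 sN]; exact: nuE.
have [||||||hd [mu [h1 h2 h3 h4 h5]]] := @dual_case_explicit _ mu0 nu _ _ _
   (fun s => ln s - ln (N%:R - s)) cM vM
   (@open_oo N%:R) lapE _ _ _ setT (fun s => N%:R * ln (1 + expR (- s)))
   (fun s => N%:R * (expR (- s) / (1 + expR (- s))))
   (fun m => 4 / N%:R * cosh (m / 2) ^+ 2).
- move=> s /oo_gt0[s0 sN]; rewrite /deriv1; apply: dereq; first by der; lra.
  by rewrite /=; field; lra.
- move=> s /oo_gt0[s0 sN]; rewrite VE /deriv1; apply: dereq; first by der; lra.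
  by rewrite /=; field; lra.
- apply: singular_boundary_oo => //.
  + by ring.
  + by field; rewrite gt_eqF.
  + by move=> x; continuous_poly.
- by [].
- move=> s _; have e0 := expR_gt0 (- s).
  have p0 : 0 < 1 + expR (- s) by rewrite addr_gt0.
  split.
  + rewrite /deriv1; apply: dereq; first by der.
    by rewrite /=; field; rewrite gt_eqF.
  + apply: gt0_oo; first by rewrite mulr_gt0// divr_gt0.
    by rewrite gtr_pMr// ltr_pdivrMr// mul1r ltrDr.
  + rewrite -ln_div ?posrE; last 2 first.
    * by rewrite mulr_gt0// divr_gt0.
    * by rewrite subr_gt0 gtr_pMr// ltr_pdivrMr// mul1r ltrDr.
    rewrite (_ : _ / _ = expR (- s)) ?expRK//; field.
    by rewrite !gt_eqF//= ?mulr1 (_ : _ - _ = N%:R) ?gt_eqF//; ring.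
- move=> x /oo_gt0[x0 xN].
  rewrite VE mulrAC cosh_sqr opprK expRN -ln_div ?posrE ?subr_gt0//.
  by rewrite lnK ?posrE ?divr_gt0 ?subr_gt0//; field; lra.
split => //; exists mu, nu; split => //.
- apply: has_laplace_eq h3 => s _.
  by rewrite mulrC expRM_natr lnK// posrE addr_gt0// expR_gt0.
- apply: has_laplace_eq h5 => s /oo_gt0[s0 sN].
  by rewrite !powR_expln ?subr_gt0// -expRD.
Qed.

Lemma negbin_case : has_varfun mu0 `]0, +oo[ (fun m => m + m ^+ 2) ->
    has_dual (TEF F) /\
    exists mu nu, [/\ dual_pair F mu nu,
      has_varfun mu `]0, +oo[ (fun m => m + m ^+ 2),
      has_laplace mu `]0, +oo[ (fun s => (1 - expR (- s))^-1),
      forall m, meandom nu m -> varfun nu m = 4 * sinh (m / 2) ^+ 2 &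
      has_laplace nu `]0, +oo[ (fun s => s `^ s * (1 + s) `^ (- 1 - s))].
Proof.
move=> vM.
have [nu lapE] := isID_measure (isID_negbin (@ltr01 R)).
have [||||||hd [mu [h1 h2 h3 h4 h5]]] := @dual_case_explicit _ mu0 nu _ _ _
   (fun s => ln s - ln (s + 1)) cM vM
   open_oy lapE _ _ _ `]0, +oo[%classic (fun s => - ln (1 - expR (- s)))
   (fun s => expR (- s) / (1 - expR (- s))) (fun m => 4 * sinh (m / 2) ^+ 2).
- move=> s /oy_gt0 s0; rewrite /deriv1; apply: dereq; first by der; lra.
  by rewrite /=; field; lra.
- move=> s /oy_gt0 s0; rewrite /deriv1; apply: dereq; first by der; lra.
  by rewrite /=; field; rewrite !gt_eqF//; nra.
- by apply: singular_boundary_oy; [ring|continuous_poly].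
- move=> m /oy_gt0 m0; apply: gt0_oy; rewrite opprB subr_gt0 ltr_ln ?posrE; lra.
- move=> s /oy_gt0 s0; have e0 := expR_gt0 (- s).
  have p0 : 0 < 1 - expR (- s) by rewrite subr_gt0 -expR0 ltr_expR oppr_lt0.
  split.
  + rewrite /deriv1; apply: dereq; first by der.
    by rewrite /=; field; rewrite gt_eqF.
  + by apply: gt0_oy; rewrite divr_gt0.
  + have k0 : 0 < expR (- s) / (1 - expR (- s)) by rewrite divr_gt0.
    rewrite -ln_div ?posrE// ?addr_gt0//.
    rewrite (_ : _ / (_ + 1) = expR (- s)) ?expRK//; field.
    rewrite (gt_eqF p0)//= (_ : _ + _ = 1) ?oner_eq0//; ring.
- move=> x /oy_gt0 x0; have x1 : 0 < x + 1 by lra.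
  rewrite sinh_sqr opprK expRN -ln_div ?posrE//.
  by rewrite lnK ?posrE ?divr_gt0//; field; rewrite !gt_eqF//; nra.
split => //; exists mu, nu; split => //.
- apply: has_laplace_eq h3 => s /oy_gt0 s0.
  by rewrite expRN lnK// posrE subr_gt0 -expR0 ltr_expR oppr_lt0.
- apply: has_laplace_eq h5 => s /oy_gt0 s0.
  rewrite !powR_expln ?addr_gt0// -expRD [1 + s]addrC; congr expR; ring.
Qed.

Lemma gamma_case (lambda : R) : 0 < lambda ->
    has_varfun mu0 `]0, +oo[ (fun m => m ^+ 2 / lambda) ->
    has_dual (TEF F) /\
    exists mu nu, [/\ dual_pair F mu nu,
      has_varfun mu `]0, +oo[ (fun m => m ^+ 2 / lambda),
      has_laplace mu `]0, +oo[ (fun s => s `^ (- lambda)),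
      forall m, meandom nu m -> varfun nu m = m ^+ 2 / lambda &
      has_laplace nu `]0, +oo[ (fun s => s `^ (- lambda))].
Proof.
move=> l0 vM.
have [nu lapE] := isID_measure (isIDZ (ltW l0) (@isID_Nln R)).
have [||||||hd [mu [h1 h2 h3 h4 h5]]] := @dual_case_explicit _ mu0 nu _ _ _
   (fun s => - (lambda / s)) cM vM
   open_oy lapE _ _ _ `]0, +oo[%classic (fun s => lambda * - ln s)
   (fun s => lambda / s) (fun m => m ^+ 2 / lambda).
- move=> s /oy_gt0 s0; rewrite /deriv1; apply: dereq; first by der; lra.
  by rewrite /=; field; lra.
- move=> s /oy_gt0 s0; rewrite /deriv1; apply: dereq; first by der; lra.
  by rewrite /=; field; rewrite !gt_eqF.
- by apply: singular_boundary_oy; [ring|continuous_poly].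
- by move=> m /oy_gt0 m0; apply: gt0_oy; rewrite opprK divr_gt0.
- move=> s /oy_gt0 s0; split.
  + rewrite /deriv1; apply: dereq; first by der; lra.
    by rewrite /=; field; rewrite gt_eqF.
  + by apply: gt0_oy; rewrite divr_gt0.
  + by field; rewrite !gt_eqF.
- by move=> x /oy_gt0 x0; field; rewrite !gt_eqF.
have E s : `]0, +oo[%classic s -> expR (lambda * - ln s) = s `^ (- lambda).
  by move=> /oy_gt0 s0; rewrite powR_expln//; congr expR; ring.
split => //; exists mu, nu; split => //.
- exact: has_laplace_eq E h3.
- exact: has_laplace_eq E h5.
Qed.

Lemma gaussian_case (sigma : R) : 0 < sigma ->
    has_varfun mu0 setT (fun=> sigma ^+ 2) ->
    has_dual (TEF F) /\
    exists mu nu, [/\ dual_pair F mu nu,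
      has_varfun mu setT (fun=> sigma ^+ 2),
      has_laplace mu setT (fun s => expR (2^-1 * sigma ^+ 2 * s ^+ 2)),
      forall m, meandom nu m -> varfun nu m = sigma ^- 2 &
      has_laplace nu setT (fun s => expR (2^-1 * sigma ^- 2 * s ^+ 2))].
Proof.
move=> s0 vM; have sn : sigma != 0 by rewrite gt_eqF.
have [|nu nuE] := @laplace_gaussian _ (sigma^-1); first by rewrite invr_eq0.
have lapE s : [set: R] s -> laplace nu s = (expR (2^-1 * sigma ^- 2 * s ^+ 2))%:E.
  by move=> _; rewrite nuE exprVn.
have [|||||hd [mu [h1 h2 h3 h4 h5]]] := @dual_case_explicit _ mu0 nu _ _ _
   (fun s => sigma ^- 2 * s) cM vM openT lapE _ _ (singular_boundaryT _)
   setT (fun s => 2^-1 * sigma ^+ 2 * s ^+ 2)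
   (fun s => - (sigma ^+ 2 * s)) (fun m => sigma ^- 2).
- move=> s _; rewrite /deriv1; apply: dereq; first by der.
  by rewrite /=; field.
- move=> s _; rewrite /deriv1; apply: dereq; first by der.
  by rewrite /=; field.
- by [].
- move=> s _; split => //.
  + by rewrite /deriv1; apply: dereq; [der|rewrite /=; field].
  + by field.
- by [].
by split => //; exists mu, nu; split.
Qed.

Lemma abel_case : has_varfun mu0 `]0, +oo[ (fun m => m * (1 + m) ^+ 2) ->
    has_dual (TEF F) /\
    exists mu nu, [/\ dual_pair F mu nu,
      has_varfun mu `]0, +oo[ (fun m => m * (1 + m) ^+ 2) &
      has_laplace nu `]0, +oo[ (fun s => s `^ s / (s + 1) `^ s)].
Proof.
move=> vM.
have [nu lapE] := isID_measure (isID_abel (@ltr01 R)).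
have [|||hd [mu [h1 h2 h3 h4]]] := @dual_case _ mu0 nu _ _ _
   (fun s => ln s + 1 - ln (s + 1) - s / (s + 1)) cM vM open_oy lapE.
- move=> s /oy_gt0 s0; rewrite /deriv1; apply: dereq; first by der; lra.
  by rewrite /=; field; lra.
- move=> s /oy_gt0 s0; rewrite /deriv1; apply: dereq; first by der; lra.
  by rewrite /=; field; lra.
- by apply: singular_boundary_oy; [rewrite mul0r|continuous_poly].
split => //; exists mu, nu; split => //.
apply: has_laplace_eq h4 => s /oy_gt0 s0.
by rewrite !powR_expln ?addr_gt0// -expRN -expRD.
Qed.

Lemma takacs_case (r : R) : 1 < r ->
    has_varfun mu0 `]0, +oo[ (fun m => m * (1 + m) * (1 + r * m)) ->
    has_dual (TEF F) /\
    exists mu nu, [/\ dual_pair F mu nu,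
      has_varfun mu `]0, +oo[ (fun m => m * (1 + m) * (1 + r * m)) &
      has_laplace nu `]0, +oo[
        (fun s => s `^ s * (s + 1) `^ ((s + 1) / (r - 1)) /
                  (r * s + 1) `^ ((r * s + 1) / (r - 1)))].
Proof.
move=> r1 vM.
have rs s : 0 < s -> 0 < r * s by move=> s0; rewrite mulr_gt0//; lra.
have [nu lapE] := isID_measure (isID_takacs r1).
have [|||hd [mu [h1 h2 h3 h4]]] := @dual_case _ mu0 nu _ _ _
   (fun s => ln s + 1 + (ln (s + 1) + 1) / (r - 1) - r * (ln (r * s + 1) + 1) / (r - 1))
   cM vM open_oy lapE.
- move=> s /oy_gt0 s0; have := rs s s0 => rs0.
  rewrite /deriv1; apply: dereq; first by der; lra.
  by rewrite /=; field; lra.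
- move=> s /oy_gt0 s0; have := rs s s0 => rs0.
  rewrite /deriv1; apply: dereq; first by der; lra.
  by rewrite /=; field; lra.
- by apply: singular_boundary_oy; [rewrite !mul0r|continuous_poly].
split => //; exists mu, nu; split => //.
apply: has_laplace_eq h4 => s /oy_gt0 s0; have := rs s s0 => rs0.
by rewrite !powR_expln ?addr_gt0// -expRN -!expRD.
Qed.

Lemma kendall_ressel_case : has_varfun mu0 `]0, +oo[ (fun m => m ^+ 2 * (1 + m)) ->
    has_dual (TEF F) /\
    exists mu nu, [/\ dual_pair F mu nu,
      has_varfun mu `]0, +oo[ (fun m => m ^+ 2 * (1 + m)) &
      has_laplace nu `]0, +oo[ (fun s => ((s + 1) / s) `^ (s + 1))].
Proof.
move=> vM.
have [nu lapE] := isID_measure (isID_kendall (lexx 0) (@ltr01 R)).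
have lapE' s : `]0, +oo[%classic s ->
    laplace nu s = (expR ((s + 1) * ln (s + 1) - (s + 1) * ln s))%:E.
  by move=> /lapE; rewrite addr0.
have [|||hd [mu [h1 h2 h3 h4]]] := @dual_case _ mu0 nu _ _ _
   (fun s => ln (s + 1) - ln s + 1 - (s + 1) / s) cM vM open_oy lapE'.
- move=> s /oy_gt0 s0; rewrite /deriv1; apply: dereq; first by der; lra.
  by rewrite /=; field; lra.
- move=> s /oy_gt0 s0; rewrite /deriv1; apply: dereq; first by der; lra.
  by rewrite /=; field; lra.
- by apply: singular_boundary_oy; [rewrite expr0n mul0r|continuous_poly].
split => //; exists mu, nu; split => //.
apply: has_laplace_eq h4 => s /oy_gt0 s0.
by rewrite !powR_expln ?divr_gt0 ?addr_gt0// ln_div ?posrE ?addr_gt0// mulrBr.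
Qed.

Lemma inverse_gaussian_case (lambda : R) : 0 < lambda ->
    has_varfun mu0 `]0, +oo[ (fun m => m ^+ 3 / lambda) ->
    has_dual (TEF F) /\
    exists mu nu, [/\ dual_pair F mu nu,
      has_varfun mu `]0, +oo[ (fun m => m ^+ 3 / lambda),
      has_laplace mu `]0, +oo[
        (fun s => expR (- (Num.sqrt lambda * Num.sqrt (2 * s)))),
      forall m, meandom nu m ->
        varfun nu m = 2 `^ (3 / 2) / Num.sqrt lambda * m `^ (3 / 2) &
      has_laplace nu `]0, +oo[ (fun s => expR (lambda / (2 * s)))].
Proof.
move=> l0 vM.
have [|nu lapE] := @isID_measure (fun s => lambda / (2 * s)).
  have c0 : 0 <= lambda / 2 by rewrite divr_ge0// ltW.
  apply: isID_ext (isIDZ c0 (isID_Lap (@isLap_inv R))) => s s0.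
  by field; rewrite gt_eqF.
have sl0 : 0 < Num.sqrt lambda by rewrite sqrtr_gt0.
have sl2 : Num.sqrt lambda ^+ 2 = lambda by rewrite sqr_sqrtr// ltW.
have [||||||hd [mu [h1 h2 h3 h4 h5]]] := @dual_case_explicit _ mu0 nu _ _ _
   (fun s => - (lambda / (2 * s ^+ 2))) cM vM
   open_oy lapE _ _ _ `]0, +oo[%classic (fun s => - (Num.sqrt lambda * Num.sqrt (2 * s)))
   (fun s => Num.sqrt lambda / Num.sqrt (2 * s))
   (fun m => 2 `^ (3 / 2) / Num.sqrt lambda * m `^ (3 / 2)).
- move=> s /oy_gt0 s0; rewrite /deriv1; apply: dereq; first by der; lra.
  by rewrite /=; field; lra.
- move=> s /oy_gt0 s0; rewrite /deriv1; apply: dereq.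
    by der; rewrite gt_eqF// mulr_gt0// exprn_gt0.
  by rewrite /=; field; rewrite !gt_eqF.
- by apply: singular_boundary_oy; [rewrite expr0n mul0r|continuous_poly].
- by move=> m /oy_gt0 m0; apply: gt0_oy; rewrite opprK divr_gt0// mulr_gt0// exprn_gt0.
- move=> s /oy_gt0 s0; have s2 : 0 < 2 * s by rewrite mulr_gt0.
  have q0 : 0 < Num.sqrt (2 * s) by rewrite sqrtr_gt0.
  split.
  + rewrite /deriv1; apply: dereq.
      apply: derN; apply: derM; first exact: dercst.
      by apply: dercomp; [rewrite /deriv1; exact: is_derive1_sqrt|der].
    by rewrite /=; field; rewrite gt_eqF.
  + by apply: gt0_oy; rewrite divr_gt0.
  + rewrite expr_div_n sl2 sqr_sqrtr ?ltW//.
    by field; rewrite !gt_eqF.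
- move=> x /oy_gt0 x0; rewrite opprK.
  have y0 : 0 < Num.sqrt lambda / x by rewrite divr_gt0.
  rewrite mulrAC -powRM ?divr_ge0 ?mulr_ge0 ?exprn_ge0 ?(ltW l0) ?(ltW x0)//.
  have -> : 2 * (lambda / (2 * x ^+ 2)) = (Num.sqrt lambda / x) `^ 2.
    by rewrite (powR_mulrn 2 (ltW y0)) expr_div_n sl2 //; field; rewrite gt_eqF.
  rewrite -powRrM (_ : 2 * (3 / 2) = 3%:R); last by field.
  rewrite powR_mulrn ?ltW// -[in RHS]sl2.
  by field; rewrite !gt_eqF.
by split => //; exists mu, nu; split.
Qed.

Lemma strict_arcsine_case : has_varfun mu0 `]0, +oo[ (fun m => m * (1 + m ^+ 2)) ->
    has_dual (TEF F) /\
    exists mu nu, [/\ dual_pair F mu nu,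
      has_varfun mu `]0, +oo[ (fun m => m * (1 + m ^+ 2)) &
      has_laplace nu `]0, +oo[
        (fun s => (s / Num.sqrt (1 + s ^+ 2)) `^ s * expR (- atan s))].
Proof.
move=> vM.
pose L (s : R) := s * ln s - 2^-1 * s * ln (1 + s ^+ 2) - atan s.
pose G (s : R) := ln s - 2^-1 * ln (1 + s ^+ 2).
have q0 (s : R) : 0 < 1 + s ^+ 2 by rewrite ltr_pwDl// sqr_ge0.
have dL s : 0 < s -> deriv1 L s (G s).
  move=> s0; rewrite /deriv1 /L /G; apply: dereq; first by der.
  by rewrite /=; field; rewrite !gt_eqF.
have dG s : 0 < s -> deriv1 G s (s * (1 + s ^+ 2))^-1.
  move=> s0; rewrite /deriv1 /G; apply: dereq; first by der.
  by rewrite /=; field; rewrite !gt_eqF.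
have [|nu lapE] := @isID_measure L.
  apply: (@isID_arcsine _ 0 1 (lexx 0) ltr01 _ L G dL); first by rewrite expr0n expr1n add0r.
  by move=> s s0; rewrite /asin_q mulr0 addr0; exact: dG.
have [|||hd [mu [h1 h2 h3 h4]]] := @dual_case _ mu0 nu _ _ L G cM vM open_oy lapE.
- by move=> s /oy_gt0; exact: dL.
- by move=> s /oy_gt0; exact: dG.
- by apply: singular_boundary_oy; [rewrite mul0r|continuous_poly].
split => //; exists mu, nu; split => //.
apply: has_laplace_eq h4 => s /oy_gt0 s0.
have r0 : 0 < Num.sqrt (1 + s ^+ 2) by rewrite sqrtr_gt0.
have lq : ln (1 + s ^+ 2) = 2 * ln (Num.sqrt (1 + s ^+ 2)).
  by rewrite -[in LHS](sqr_sqrtr (ltW (q0 s))) lnXn// mulr_natl.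
rewrite powR_expln ?divr_gt0// ln_div ?posrE// -expRD /L lq.
by congr expR; field.
Qed.

Lemma large_arcsine_case (a : R) : 0 < a -> a < pi / 2 ->
    has_varfun mu0 `]0, +oo[ (fun m => m * (1 + 2 * m * cos a + m ^+ 2)) ->
    has_dual (TEF F) /\
    exists mu nu, [/\ dual_pair F mu nu,
      dual_measure mu nu,
      has_varfun mu `]0, +oo[ (fun m => m * (1 + 2 * m * cos a + m ^+ 2)) &
      has_laplace nu `]0, +oo[ (fun s => expR (large_arcsine_ell a s))].
Proof.
move=> a0 api vM.
have pi0 := pi_gt0 R.
have ca0 : 0 < cos a by apply: cos_gt0_pihalf; apply/andP; split; lra.
have sa0 : 0 < sin a by apply: sin_gt0_pi; apply/andP; split; lra.
have cs : cos a ^+ 2 + sin a ^+ 2 = 1 by exact: cos2Dsin2.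
pose G (s : R) := ln s - 2^-1 * ln (1 + 2 * s * cos a + s ^+ 2)
  - cos a / sin a * atan ((s + cos a) / sin a) + (- 2^-1 + (pi / 2 - a) * cos a).
have sn : sin a != 0 by rewrite gt_eqF.
have q0 s : 0 < s -> 0 < 1 + 2 * s * cos a + s ^+ 2.
  by move=> s0; rewrite addr_gt0 ?exprn_gt0// addr_gt0// !mulr_gt0.
have uE s : 0 < s ->
    (1 + ((s + cos a) / sin a) ^+ 2)^-1 = sin a ^+ 2 / (1 + 2 * s * cos a + s ^+ 2).
  move=> s0; rewrite -[RHS]invrK; congr (_^-1).
  have -> : 1 + 2 * s * cos a + s ^+ 2 = sin a ^+ 2 + (s + cos a) ^+ 2.
    by have := cs; lra.
  rewrite invf_div; field; exact: sn.
have dL s : 0 < s -> deriv1 (large_arcsine_ell a) s (G s).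
  move=> s0; have Q0 := q0 s s0.
  rewrite /deriv1 /large_arcsine_ell /G; apply: dereq; first by der.
  rewrite /= uE//; field.
  by rewrite !gt_eqF.
have dG s : 0 < s -> deriv1 G s (s * (1 + 2 * s * cos a + s ^+ 2))^-1.
  move=> s0; have Q0 := q0 s s0.
  rewrite /deriv1 /G; apply: dereq; first by der.
  rewrite /= uE//; field.
  by rewrite !gt_eqF.
have [|nu lapE] := @isID_measure (large_arcsine_ell a).
  exact: (@isID_arcsine _ (cos a) (sin a) (ltW ca0) sa0 cs _ G dL).
have [|||hd [mu [h1 h2 h3 h4]]] := @dual_case _ mu0 nu _ _ (large_arcsine_ell a) G cM vM open_oy lapE.
- by move=> s /oy_gt0; exact: dL.
- by move=> s /oy_gt0; exact: dG.
- by apply: singular_boundary_oy; [rewrite mul0r|continuous_poly].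
by split => //; exists mu, nu; split.
Qed.

End families.

(** * The dual families *)

Theorem mainTheorem6 (R : realType)
    (F : set (probability (measurableTypeR R) R))
    (mu0 : {measure set (measurableTypeR R) -> \bar R})
    (hmu0 : calM mu0) (hF : F = NEF mu0) :
  (* (A) *)
  (* Poisson *)
  (has_varfun mu0 `]0, +oo[ (fun m => m) ->
    has_dual (TEF F) /\
    exists mu nu, [/\ dual_pair F mu nu,
      has_varfun mu `]0, +oo[ (fun m => m),
      has_laplace mu setT (fun s => expR (expR (- s))),
      forall m, meandom nu m -> varfun nu m = expR m &
      has_laplace nu `]0, +oo[ (fun s => expR (- s) * s `^ s)]) /\
  (* Bernoulli, binomial *)
  (has_varfun mu0 `]0, 1[ (fun m => m - m ^+ 2) ->
    has_dual (TEF F) /\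
    exists mu nu, [/\ dual_pair F mu nu,
      has_varfun mu `]0, 1[ (fun m => m - m ^+ 2),
      has_laplace mu setT (fun s => 1 + expR (- s)),
      forall m, meandom nu m -> varfun nu m = 4 * cosh (m / 2) ^+ 2 &
      has_laplace nu `]0, 1[ (fun s => s `^ s * (1 - s) `^ (1 - s))]) /\
  (forall N : nat, (0 < N)%N ->
    has_varfun mu0 `]0, N%:R[ (fun m => m - m ^+ 2 / N%:R) ->
    has_dual (TEF F) /\
    exists mu nu, [/\ dual_pair F mu nu,
      has_varfun mu `]0, N%:R[ (fun m => m - m ^+ 2 / N%:R),
      has_laplace mu setT (fun s => (1 + expR (- s)) ^+ N),
      forall m, meandom nu m ->
        varfun nu m = 4 / N%:R * cosh (m / 2) ^+ 2 &
      has_laplace nu `]0, N%:R[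
        (fun s => s `^ s * (N%:R - s) `^ (N%:R - s))]) /\
  (* Negative binomial *)
  (has_varfun mu0 `]0, +oo[ (fun m => m + m ^+ 2) ->
    has_dual (TEF F) /\
    exists mu nu, [/\ dual_pair F mu nu,
      has_varfun mu `]0, +oo[ (fun m => m + m ^+ 2),
      has_laplace mu `]0, +oo[ (fun s => (1 - expR (- s))^-1),
      forall m, meandom nu m -> varfun nu m = 4 * sinh (m / 2) ^+ 2 &
      has_laplace nu `]0, +oo[ (fun s => s `^ s * (1 + s) `^ (- 1 - s))]) /\
  (* Gamma *)
  (forall lambda : R, 0 < lambda ->
    has_varfun mu0 `]0, +oo[ (fun m => m ^+ 2 / lambda) ->
    has_dual (TEF F) /\
    exists mu nu, [/\ dual_pair F mu nu,
      has_varfun mu `]0, +oo[ (fun m => m ^+ 2 / lambda),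
      has_laplace mu `]0, +oo[ (fun s => s `^ (- lambda)),
      forall m, meandom nu m -> varfun nu m = m ^+ 2 / lambda &
      has_laplace nu `]0, +oo[ (fun s => s `^ (- lambda))]) /\
  (* Gaussian *)
  (forall sigma : R, 0 < sigma ->
    has_varfun mu0 setT (fun=> sigma ^+ 2) ->
    has_dual (TEF F) /\
    exists mu nu, [/\ dual_pair F mu nu,
      has_varfun mu setT (fun=> sigma ^+ 2),
      has_laplace mu setT (fun s => expR (2^-1 * sigma ^+ 2 * s ^+ 2)),
      forall m, meandom nu m -> varfun nu m = sigma ^- 2 &
      has_laplace nu setT (fun s => expR (2^-1 * sigma ^- 2 * s ^+ 2))]) /\
  (* Abel *)
  (has_varfun mu0 `]0, +oo[ (fun m => m * (1 + m) ^+ 2) ->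
    has_dual (TEF F) /\
    exists mu nu, [/\ dual_pair F mu nu,
      has_varfun mu `]0, +oo[ (fun m => m * (1 + m) ^+ 2) &
      has_laplace nu `]0, +oo[ (fun s => s `^ s / (s + 1) `^ s)]) /\
  (* Takacs *)
  (forall r : R, 1 < r ->
    has_varfun mu0 `]0, +oo[ (fun m => m * (1 + m) * (1 + r * m)) ->
    has_dual (TEF F) /\
    exists mu nu, [/\ dual_pair F mu nu,
      has_varfun mu `]0, +oo[ (fun m => m * (1 + m) * (1 + r * m)) &
      has_laplace nu `]0, +oo[
        (fun s => s `^ s * (s + 1) `^ ((s + 1) / (r - 1)) /
                  (r * s + 1) `^ ((r * s + 1) / (r - 1)))]) /\
  (* Kendall-Ressel *)
  (has_varfun mu0 `]0, +oo[ (fun m => m ^+ 2 * (1 + m)) ->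
    has_dual (TEF F) /\
    exists mu nu, [/\ dual_pair F mu nu,
      has_varfun mu `]0, +oo[ (fun m => m ^+ 2 * (1 + m)) &
      has_laplace nu `]0, +oo[ (fun s => ((s + 1) / s) `^ (s + 1))]) /\
  (* Inverse Gaussian *)
  (forall lambda : R, 0 < lambda ->
    has_varfun mu0 `]0, +oo[ (fun m => m ^+ 3 / lambda) ->
    has_dual (TEF F) /\
    exists mu nu, [/\ dual_pair F mu nu,
      has_varfun mu `]0, +oo[ (fun m => m ^+ 3 / lambda),
      has_laplace mu `]0, +oo[
        (fun s => expR (- (Num.sqrt lambda * Num.sqrt (2 * s)))),
      forall m, meandom nu m ->
        varfun nu m = 2 `^ (3 / 2) / Num.sqrt lambda * m `^ (3 / 2) &
      has_laplace nu `]0, +oo[ (fun s => expR (lambda / (2 * s)))]) /\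
  (* Strict arcsine *)
  (has_varfun mu0 `]0, +oo[ (fun m => m * (1 + m ^+ 2)) ->
    has_dual (TEF F) /\
    exists mu nu, [/\ dual_pair F mu nu,
      has_varfun mu `]0, +oo[ (fun m => m * (1 + m ^+ 2)) &
      has_laplace nu `]0, +oo[
        (fun s => (s / Num.sqrt (1 + s ^+ 2)) `^ s * expR (- atan s))]) /\
  (* Large arcsine *)
  (forall a : R, 0 < a -> a < pi / 2 ->
    has_varfun mu0 `]0, +oo[ (fun m => m * (1 + 2 * m * cos a + m ^+ 2)) ->
    has_dual (TEF F) /\
    exists mu nu, [/\ dual_pair F mu nu,
      dual_measure mu nu,
      has_varfun mu `]0, +oo[ (fun m => m * (1 + 2 * m * cos a + m ^+ 2)) &
      has_laplace nu `]0, +oo[ (fun s => expR (large_arcsine_ell a s))]) /\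
  (* (B) Hyperbolic *)
  (has_varfun mu0 setT (fun m => m ^+ 2 + 1) -> ~ has_dual (TEF F)).
Proof.
rewrite hF.
split; first exact: poisson_case.
split.
  have E : (fun m : R => m - m ^+ 2 / 1%:R) = (fun m => m - m ^+ 2).
    by apply/funext => m; rewrite divr1.
  move=> vM; have vM' : has_varfun mu0 `]0, 1%:R[ (fun m => m - m ^+ 2 / 1%:R) by rewrite E.
  have [hd [mu [nu [h1 h2 h3 h4 h5]]]] := binomial_case hmu0 (ltn0Sn 0) vM'.
  split; first exact: hd.
  rewrite E in h2; exists mu, nu; split; [exact: h1|exact: h2|exact: h3| |exact: h5].
  by move=> m /h4; rewrite divr1.
split; first by move=> N N0; exact: binomial_case.
split; first exact: negbin_case.
split; first by move=> lambda l0; exact: gamma_case.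
split; first by move=> sigma s0; exact: gaussian_case.
split; first exact: abel_case.
split; first by move=> r r1; exact: takacs_case.
split; first exact: kendall_ressel_case.
split; first by move=> lambda l0; exact: inverse_gaussian_case.
split; first exact: strict_arcsine_case.
split; first by move=> a a0 api; exact: large_arcsine_case.
exact: hyperbolic_no_dual.
Qed.
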